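(* Fix $k\in\mathbb{N}$. Let $n=n(d)>d$ be an integer sequence. If $n(d)\leq e^{d/(k(e+\varepsilon))}$ for some $\varepsilon>0$ and all sufficiently large $d$, then $$\binom nk-\mathbb{E}f_{k-1}(C_{n-1,d})=O(n^{-\eta})$$ (as $d\to\infty$) for some $\eta>0$, and the polytope $C_{n-1,d}$ is $k$-neighborly with probability approaching $1$, more precisely $$\mathbb{P}\left[f_{k-1}(C_{n-1,d})=\binom nk\right]=1-O(n^{-\eta}).$$ If, on the other hand, $n(d)\geq e^{d/(k(e-\varepsilon))}$ for some $\varepsilon\in(0,e)$ and all sufficiently large $d$, then $$\lim_{d\to\infty}\left(\binom nk-\mathbb{E}f_{k-1}(C_{n-1,d})\right)=+\infty.$$
   Context: For each $d$, let $\xi_1,\ldots,\xi_{n-1}$ (with $n=n(d)$, $n-1\geq d$) be random vectors in $\mathbb{R}^d$ (possibly dependent, with joint law allowed to depend on $d$), and let $S_0=0$, $S_i=\xi_1+\cdots+\xi_i$, $1\leq i\leq n-1$. Standing assumptions: (Exchangeability) for every permutation $\sigma$ of $\{1,\ldots,n-1\}$, $(\xi_{\sigma(1)},\ldots,\xi_{\sigma(n-1)})$ has the same distribution as $(\xi_1,\ldots,\xi_{n-1})$; (General position) for every $1\leq i_1<\cdots<i_d\leq n-1$ the probability that $S_{i_1},\ldots,S_{i_d}$ are linearly dependent is $0$. Let $C_{n-1,d}:=\operatorname{conv}(S_0,S_1,\ldots,S_{n-1})\subset\mathbb{R}^d$, the convex hull of $n$ points, and let $f_\ell(C_{n-1,d})$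 be the number of $\ell$-dimensional faces of this polytope. The maximal possible value of $f_{k-1}(C_{n-1,d})$ is $\binom nk$, and $C_{n-1,d}$ is called $k$-neighborly if $f_{k-1}(C_{n-1,d})=\binom nk$. In the bounds, $e$ is Euler's number. *)

(* Defs.v *)
From HB Require Import structures.
From mathcomp Require Import all_boot all_order all_algebra finmap perm.
From mathcomp Require Import all_classical all_reals all_analysis.

Set Implicit Arguments.
Unset Strict Implicit.
Unset Printing Implicit Defensive.

Import Order.TTheory GRing.Theory Num.Theory.
Import numFieldNormedType.Exports.

Local Open Scope classical_set_scope.
Local Open Scope ring_scope.

(* m x d matrices with the Borel sigma-algebra. A family of m random vectors
   in R^d on a probability space is a random variable with values in this
   type: the i-th vector is the i-th row. *)
Definition borel_mx (R : realType) (m d : nat) :=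
  g_sigma_algebraType (@open 'M[R]_(m, d)).

Definition conv_hull (R : realType) (d : nat) (A : set 'rV[R]_d) :
    set 'rV[R]_d :=
  smallest (@convex_set R 'rV[R]_d) A.

Definition affine_set (R : realType) (d : nat) (A : set 'rV[R]_d) : Prop :=
  forall (x y : 'rV[R]_d) (t : R), A x -> A y -> A (t *: x + (1 - t) *: y).

Definition affine_hull (R : realType) (d : nat) (A : set 'rV[R]_d) :
    set 'rV[R]_d :=
  smallest (@affine_set R d) A.

(* The dimension of a set is that of its affine hull; the empty set has no
   dimension in nat. *)
Definition has_dim (R : realType) (d : nat) (A : set 'rV[R]_d) (l : nat) :
    Prop :=
  exists (x0 : 'rV[R]_d) (V : {vspace 'rV[R]_d}),
    \dim V = l /\ affine_hull A = [set x0 + v | v in [set v | v \in V]].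

(* Faces are cut out by valid linear inequalities; c = 0 gives the improper
   faces, C itself and the empty set. *)
Definition is_face (R : realType) (d : nat) (C F : set 'rV[R]_d) : Prop :=
  exists (c : 'cV[R]_d) (b : R),
    (forall x, C x -> (x *m c) 0 0 <= b) /\
    F = [set x | C x /\ (x *m c) 0 0 = b].

(* fset_set sends an infinite set to the empty one, so this is only meant for
   polytopes, which have finitely many faces. *)
Definition num_faces (R : realType) (d : nat) (l : nat) (C : set 'rV[R]_d) :
    nat :=
  #|` fset_set [set F | is_face C F /\ has_dim F l] |.

Definition walk (R : realType) (m d : nat) (x : 'M[R]_(m, d)) (i : nat) :
    'rV[R]_d :=
  \sum_(j < m | (j < i)%N) row j x.

Definition walk_hull (R : realType) (m d : nat) (x : 'M[R]_(m, d)) :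
    set 'rV[R]_d :=
  conv_hull [set walk x i | i in [set i | (i <= m)%N]].

Section RandomWalk.
Context (R : realType) (dsp : measure_display) (T : measurableType dsp).
Context (P : probability T R) (m d : nat) (xi : {RV P >-> borel_mx R m d}).

Definition exchangeable : Prop :=
  forall (s : 'S_m) (B : set (borel_mx R m d)), measurable B ->
    P [set w | B (row_perm s (xi w : 'M[R]_(m, d)))] = P (xi @^-1` B).

(* Ordinals start at 0: the d times 1 <= i_1 < ... < i_d <= m of the walk are
   the (i r).+1. *)
Definition general_position : Prop :=
  forall i : 'I_d -> 'I_m, {homo i : r s / (r < s)%N} ->
    P [set w | ~~ free [seq walk (xi w : 'M[R]_(m, d)) (i r).+1
                       | r <- enum 'I_d]] = 0%E.

Definition face_count (l : nat) (w : T) : R :=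
  (num_faces l (walk_hull (xi w : 'M[R]_(m, d))))%:R.

End RandomWalk.

(* Main.v *)
Require Import Defs.
From HB Require Import structures.
From mathcomp Require Import all_boot all_order all_algebra finmap perm.
From mathcomp Require Import all_classical all_reals all_analysis.
From mathcomp Require Import measurable_realfun.
From mathcomp Require Import ring lra zify.

(** Let m = n - 1 be the number of steps xi_1, ..., xi_m and S_0, ..., S_m the
    points of the walk. In general position a face of dimension k - 1 < d is a
    simplex, so the defect 'C(n, k) - f_(k-1) is the number of hidden sets:
    the k-subsets J of {0, ..., m} that no affine functional exposes
    ([num_faces_hidden]). The whole theorem is a two-sided estimate of the
    expected number of hidden sets; the statement on neighborliness then is
    Markov's inequality ([missing_probability]).

    By Farkas' lemma J is hidden exactly when there is an affine relation
    between the points S_j whose coefficients are positive off J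
    ([not_exposed_relation]). Its tail sums y_i satisfy y_0 = 0 and sum_i y_i
    xi_i = 0, and they decrease strictly along the cyclic order 0, 1, ..., m
    except just after the elements of J ([feasible_relation]). By
    exchangeability the expected number of hidden sets is N / m!, where N
    counts the pairs (order of the steps, J) that admit such a y. For fixed
    steps N counts, over all distributions of the points into k blocks, the
    chambers of a product of k braid arrangements that meet the linear space
    of all y with sum_i y_i xi_i = 0.

    In general position this number does not depend on the steps, up to a
    factor of two. A generic additional coordinate t ^ i turns the linear
    space into two opposite affine ones ([exists_lift]), and for an affine
    space of codimension D the vertices can be inserted one at a time
    ([count_inserts]). When a vertex p is inserted into a feasible cyclic
    arrangement of the vertices below p, the feasible places are k free ones,
    plus one for every vertex a at whose level y_p can be put. Feasibility
    with y_p unconstrained is feasibility after projecting along xi_p, in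
    codimension D - 1; feasibility with y_p = y_a is feasibility after
    replacing xi_a by xi_a + xi_p, in codimension D. Hence the recursion N(p +
    1, D) = k N(p, D - 1) + p N(p, D) of [feasible_count], whose solution is
    the sum of the coefficients of degree at least D of prod_(0 < i <= m) (k t
    + i).

    Evaluating this polynomial at t = e bounds N / m! by e ^ (- d) prod_i (1 +
    k e / i), which is at most a constant times n ^ (k e) e ^ (- d)
    ([feasible_count_upper]); this is O(n ^ (- k eps)) in the first regime.
    For the lower bound only the arrangements in which the first k vertices
    belong to different blocks are counted: these have at most one mark at
    each vertex, and their number satisfies the same recursion. Following it
    along a geometric sequence of times gives, up to a constant, the lower
    bound 'C(b, s) gain ^ s with s close to d, and this is about (k ln n) ^ s
    / s! ([rate_blocks]). It diverges as soon as k e ln n exceeds d by a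
    constant factor ([rate_divergence]), which is the second regime. *)

Set Implicit Arguments.
Unset Strict Implicit.
Unset Printing Implicit Defensive.

Import Order.TTheory GRing.Theory Num.Theory.

Local Open Scope ring_scope.

(** * Cyclic arrangements and configurations of steps in general position *)

Section Arrangements.
Variable R : realFieldType.
Implicit Types (y u w z : nat -> R) (s : seq (nat * nat)).

(** The relations between the points of a walk determine y only up to an
    additive constant; y 0 = 0 fixes it. *)
Definition solves D (xi : nat -> 'rV[R]_D) (v : 'rV[R]_D) (p : nat) y : Prop :=
  y 0%N = 0 /\ \sum_(i < p) y i *: xi i = v.

(** An arrangement is a cyclic sequence of pairs (vertex, number of marks). A
    mark ends a block, so y has to decrease from an unmarked vertex to the
    next one. Several marks at one vertex stand for empty blocks. *)
Definition descends y (a b : nat * nat) : bool :=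
  (a.2 == 0%N) ==> (y b.1 < y a.1).

Definition feasible D (xi : nat -> 'rV[R]_D) (v : 'rV[R]_D) p s : Prop :=
  exists2 y, solves xi v p y & cycle (descends y) s.

(** General position, in a form that survives both steps of the recursion. A
    vector y that is constant on the classes of a colouring with q nonzero
    colours is a relation between q sums of disjoint families of steps, and v
    counts as one more vector if b holds: any D of these vectors are
    independent. *)
Definition generic D (xi : nat -> 'rV[R]_D) (v : 'rV[R]_D) (p : nat) : Prop :=
  forall (q : nat) (c : nat -> nat) z (b : bool),
    (q + b <= D)%N -> c 0%N = 0%N -> z 0%N = 0 ->
    (forall i, (i < p)%N -> (c i <= q)%N) ->
    \sum_(i < p) z (c i) *: xi i = b%:R *: v ->
    b = false /\ forall i, (i < p)%N -> z (c i) = 0.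

(** The configuration obtained by imposing y p = y a. *)
Definition merge D (xi : nat -> 'rV[R]_D) (a p : nat) : nat -> 'rV[R]_D :=
  fun i => if i == a then xi a + xi p else xi i.

Lemma sum_merge D (xi : nat -> 'rV[R]_D) a p y : (a < p)%N ->
  \sum_(i < p) y i *: merge xi a p i = \sum_(i < p) y i *: xi i + y a *: xi p.
Proof.
move=> ap; rewrite (bigD1 (Ordinal ap)) //= [in RHS](bigD1 (Ordinal ap)) //=.
rewrite {1}/merge eqxx scalerDr -!addrA; congr (_ + _); rewrite addrC.
congr (_ + _); apply: eq_bigr => i /negbTE ia; rewrite /merge.
by rewrite -val_eqE /= in ia; rewrite ia.
Qed.

(** A colouring of the vertices below p extends to p by the colour of a,
    without a new colour. *)
Lemma generic_merge D (xi : nat -> 'rV[R]_D) v p a :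
  (a < p)%N -> generic xi v p.+1 -> generic (merge xi a p) v p.
Proof.
move=> ap gen q c z b qb c0 z0 cq; rewrite (sum_merge _ (fun i => z (c i))) // => E.
pose c' i := if i == p then c a else c i.
have c'E i : (i < p)%N -> c' i = c i by move=> ip; rewrite /c' ltn_eqF.
have [||||-> H] := gen q c' z b qb.
- by rewrite /c'; case: eqP => // p0; rewrite -p0 in ap.
- by [].
- move=> i; rewrite /c'; case: eqP => [_ _|/eqP ip]; first exact: cq.
  by rewrite ltnS leq_eqVlt (negbTE ip); exact: cq.
- rewrite big_ord_recr /= {2}/c' eqxx -E; congr (_ + _).
  by apply: eq_bigr => i _; rewrite c'E.
by split => // i ip; rewrite -c'E // H // ltnW.
Qed.

(** A relation modulo [xi p] is a relation in which p has a colour of its own,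
    which accounts for the drop of the dimension from D to D - 1. *)
Lemma generic_proj D (xi : nat -> 'rV[R]_D) v p (P : 'M[R]_(D, D.-1)) :
  (0 < p)%N -> (forall x, x *m P = 0 -> exists t, x = t *: xi p) ->
  generic xi v p.+1 -> generic (fun i => xi i *m P) (v *m P) p.
Proof.
move=> p0 kerP gen q c z b qb c0 z0 cq E.
have [D0|D0] := posnP D.
  have [q0 b0] : q = 0%N /\ b = false by subst D; case: b qb {E} => /=; lia.
  split=> // i /cq; rewrite q0 leqn0 => /eqP ->; exact: z0.
have [|t Et] := kerP (\sum_(i < p) z (c i) *: xi i - b%:R *: v).
  rewrite mulmxBl mulmx_suml -scalemxAl -E -sumrB big1 // => i _.
  by rewrite -scalemxAl subrr.
(* - t is the missing value at p, with the new colour q + 1. *)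
pose c' i := if i == p then q.+1 else c i.
pose z' j := if j == q.+1 then - t else z j.
have c'E i : (i < p)%N -> z' (c' i) = z (c i).
  by move=> ip; rewrite /c' ltn_eqF // /z' ltn_eqF // ltnS cq.
have [|||||-> H] := gen q.+1 c' z' b.
- by lia.
- by rewrite /c' ltn_eqF.
- by rewrite /z'.
- by move=> i ip; rewrite /c'; case: eqP => // /eqP ip'; rewrite leqW // cq //; lia.
- rewrite big_ord_recr /= {2}/c' {2}/z' !eqxx.
  under eq_bigr do rewrite c'E //.
  move: Et => /(canRL (subrK _)) ->; rewrite scaleNr; by rewrite addrAC subrr add0r.
by split=> // i ip; rewrite -c'E // H // ltnW.
Qed.

Lemma line_kernel D (x0 : 'rV[R]_D) : (x0 != 0) || (D == 0%N) ->
  exists2 P : 'M[R]_(D, D.-1), x0 *m P = 0 &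
    forall x, x *m P = 0 -> exists t, x = t *: x0.
Proof.
case/orP => [x0N|/eqP D0]; last first.
  subst D; exists 0; first by rewrite mulmx0.
  by move=> x _; exists 0; apply/rowP; case.
have e : \rank (cokermx x0) = D.-1.
  by rewrite mxrank_coker rank_rV x0N subn1.
suff [P H1 H2] : exists2 P : 'M[R]_(D, \rank (cokermx x0)), x0 *m P = 0 &
    forall x, x *m P = 0 -> exists t, x = t *: x0.
  by move: P H1 H2; rewrite e => P H1 H2; exists P.
exists (col_base (cokermx x0)).
  have := mulmx_coker x0; rewrite -{1}(mulmx_base (cokermx x0)) mulmxA => H.
  by apply: (row_free_inj (row_base_free (cokermx x0))); rewrite H mul0mx.
move=> x Hx; apply/sub_rVP; rewrite submxE -(mulmx_base (cokermx x0)) mulmxA Hx.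
by rewrite mul0mx.
Qed.

Lemma generic_neq0 D (xi : nat -> 'rV[R]_D) v p : (0 < p)%N ->
  generic xi v p.+1 -> (xi p != 0) || (D == 0%N).
Proof.
move=> p0 gen; have [D0|D0] := posnP D; first by apply/orP; right; apply/eqP.
apply/orP; left; apply/eqP => xp0.
have [|||||_ /(_ p)] := gen 1%N (fun i => nat_of_bool (i == p)) (fun j => (j == 1%N)%:R) false.
- by lia.
- by rewrite ltn_eqF.
- by rewrite eq_sym oner_eq0.
- by move=> i _; case: (i == p).
- rewrite scale0r big1 // => i _.
  have [->|_] := eqVneq (i : nat) p; first by rewrite xp0 scaler0.
  by rewrite scale0r.
by rewrite eqxx ltnS leqnn => /(_ isT) /eqP; rewrite oner_eq0.
Qed.

(** With at least D steps, the first D of them already form a basis. *)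
Lemma generic_span D (xi : nat -> 'rV[R]_D) v p : (D < p)%N -> generic xi v p ->
  forall x, exists2 w, w 0%N = 0 & \sum_(i < p) w i *: xi i = x.
Proof.
move=> Dp gen x.
pose M : 'M[R]_D := \matrix_(i < D) xi i.+1.
pose ww (r : 'rV[R]_D) (i : nat) : R :=
  if i is j.+1 then (if insub j is Some j' then r 0 j' else 0) else 0.
have wwE (r : 'rV_D) : \sum_(i < p) ww r i *: xi i = r *m M.
  rewrite mulmx_sum_row -(big_mkord xpredT (fun i => ww r i *: xi i)).
  rewrite (big_cat_nat (n := D.+1)) //= [X in _ + X]big_nat_cond.
  rewrite [X in _ + X]big1 ?addr0; last first.
    move=> [|i]; rewrite ?andbT; first by [].
    by move=> /andP[Hi _]; rewrite /ww insubF ?scale0r //; lia.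
  rewrite big_nat_recl //= scale0r add0r big_mkord; apply: eq_bigr => i _.
  by rewrite rowK valK.
have Mu : M \in unitmx.
  rewrite -row_free_unit -kermx_eq0; apply/rowV0P => r /sub_kermxP rM.
  pose c i := if (i <= D)%N then i else 0%N.
  have wc i : ww r (c i) = ww r i.
    rewrite /c; case: leqP => // Di; case: i Di => // i Di.
    by rewrite /ww insubF //; lia.
  have [|||||_ H] := gen D c (ww r) false.
  - by rewrite addn0.
  - by [].
  - by [].
  - by move=> i _; rewrite /c; case: ifP.
  - by under eq_bigr do rewrite wc; rewrite wwE rM scale0r.
  apply/rowP => i; rewrite mxE; have := H i.+1; rewrite wc /= valK; apply.
  by have := ltn_ord i; lia.
exists (ww (x *m invmx M)) => //.
by rewrite wwE mulmxKV.
Qed.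

(** Solutions on the hyperplane y p = y a can be moved off it inside the
    solution space. Such a solution forces D < p, so the merged steps span the
    space and a combination of them compensates for a change of y p alone. *)
Lemma generic_direction D (xi : nat -> 'rV[R]_D) v p a y :
  (a < p)%N -> generic xi v p.+1 -> solves xi v p.+1 y -> y p = y a ->
  exists2 u, solves xi 0 p.+1 u & u p - u a = 1.
Proof.
move=> ap gen [y0 Ey] ypa.
have p0 : (0 < p)%N by lia.
(* y itself uses at most p - 1 nonzero colours, as p shares the one of a. *)
have Dp : (D < p)%N.
  rewrite ltnNge; apply/negP => pD.
  pose c i := if i == p then a else i.
  have [|||||//] := gen p.-1 c y true.
  - by rewrite /=; lia.
  - by rewrite /c ltn_eqF.
  - by [].
  - by move=> i ip; rewrite /c; case: eqP; lia.
  - rewrite scale1r -Ey; apply: eq_bigr => i _; rewrite /c.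
    by case: eqP => // ->; rewrite ypa.
have [w w0 Ew] := generic_span Dp (generic_merge ap gen) (xi p).
rewrite sum_merge // in Ew.
exists (fun i => if i == p then 1 - w a else - w i).
  split; first by rewrite ltn_eqF // w0 oppr0.
  rewrite big_ord_recr /= eqxx -[in X in _ + X]Ew.
  rewrite (eq_bigr (fun i : 'I_p => - (w i *: xi i))); last first.
    by move=> i _; rewrite ltn_eqF // scaleNr.
  rewrite sumrN -[X in X + _]opprK.
  rewrite scalerBl scale1r Ew -[in X in _ + (X - _)]Ew.
  by rewrite addrK opprK addrC subrr.
by rewrite eqxx ltn_eqF // opprK subrK.
Qed.

End Arrangements.

(** * Inserting one vertex into a cyclic arrangement *)

Section Insertion.
Variable R : realFieldType.
Implicit Types (y u w z : nat -> R) (s : seq (nat * nat)).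

Definition insert_at (p : nat) s (i m : nat) : seq (nat * nat) :=
  let a := nth (0, 0)%N s i in
  take i s ++ (a.1, m) :: (p, a.2 - m)%N :: drop i.+1 s.

Definition inserts (p : nat) s : seq (seq (nat * nat)) :=
  [seq insert_at p s i m
     | i <- iota 0 (size s), m <- iota 0 (nth (0, 0)%N s i).2.+1].

Definition next_at s i := nth (0, 0)%N (rot 1 s) i.

Lemma next_atE s i (a := nth (0, 0)%N s i) : (i < size s)%N ->
  next_at s i = head a (drop i.+1 s ++ take i s).
Proof.
move=> is_; rewrite /next_at /rot nth_cat size_drop nth_drop add1n.
  case: ltnP => h.
    by rewrite (drop_nth (0, 0)%N) //; lia.
  have Ei : i.+1 = size s by lia.
  rewrite drop_oversize; last by rewrite -Ei.
  rewrite -Ei subSS subn0 subnn /=.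
  case: (s) is_ Ei @a => //= a0 [|a1 s'] //= _ [->] //=.
Qed.

(** Splitting the marks of the i-th entry a as m + (a.2 - m) around the new
    vertex p adds the condition y p < y a if no mark stays before p, and the
    condition that the next entry lies below p if no mark is left after p. In
    the unmarked case both hold and imply the old condition between a and its
    successor. *)
Lemma cycle_insert y p s i m (a := nth (0, 0)%N s i) :
  (i < size s)%N -> (m <= a.2)%N ->
  cycle (descends y) (insert_at p s i m) =
  [&& cycle (descends y) s, (m == 0%N) ==> (y p < y a.1)
    & (m == a.2) ==> (y (next_at s i).1 < y p)].
Proof.
move=> is_ ma.
pose l := drop i.+1 s ++ take i s.
have -> : next_at s i = head a l by apply: next_atE.
rewrite -(@rot_cycle i _ _ s) /rot (drop_nth (0, 0)%N) // -/a cat_cons -/l /=.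
rewrite /insert_at -/a.
rewrite -(@rot_cycle (size (take i s)) _ _) rot_size_cat !cat_cons -/l /=.
have E : forall b c x1 x2, (b.1 = c.1) ->
    path (descends y) x1 (rcons x2 b) = path (descends y) x1 (rcons x2 c).
  move=> b c x1 x2 bc; rewrite !rcons_path /descends bc; by [].
rewrite (E (a.1, m) a) //.
have -> : descends y (a.1, m) (p, (a.2 - m)%N) = (m == 0%N) ==> (y p < y a.1).
  by [].
have H : forall b, descends y (p, (a.2 - m)%N) b = (m == a.2) ==> (y b.1 < y p).
  by move=> b; rewrite /descends /= subn_eq0; congr (_ ==> _); lia.
have AB b : (m == 0%N) ==> (y p < y a.1) -> (m == a.2) ==> (y b.1 < y p) ->
    descends y a b.
  rewrite /descends => A B; apply/implyP => /eqP a0; move: ma A B.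
  by rewrite a0 leqn0 => /eqP -> /= h1 h2; exact: lt_trans h2 h1.
case: l => [|b l] /=; rewrite H.
  rewrite !andbT; apply/andP/and3P => [[A B]|[_ -> ->]] //.
  by rewrite A B AB.
apply/and3P/and3P => [[A B ->]|[/andP[_ ->] -> ->]] //.
by rewrite A B AB.
Qed.

Lemma lt_open (a b a' b' : R) : a < b ->
  exists2 e, 0 < e & forall t, 0 <= t <= e -> a + t * a' < b + t * b'.
Proof.
move=> ab; exists ((b - a) / (`|a' - b'| + 1)).
  by rewrite divr_gt0 ?subr_gt0 ?ltr_pwDr.
move=> t /andP[t0 te].
have n0 : 0 < `|a' - b'| + 1 by rewrite ltr_pwDr.
rewrite ler_pdivlMr // in te.
have [t00|tp] := eqVneq t 0; first by rewrite t00 !mul0r !addr0.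
have : t * (a' - b') <= t * `|a' - b'| by rewrite ler_wpM2l // ler_norm.
have : 0 < t by rewrite lt_def tp.
lra.
Qed.

(** Finitely many strict inequalities survive a small perturbation. *)
Lemma cycle_open y u s : cycle (descends y) s ->
  exists2 e, 0 < e & forall t, 0 <= t <= e ->
    cycle (descends (fun i => y i + t * u i)) s.
Proof.
case: s => [|a s]; first by exists 1.
rewrite /=; elim: (rcons s a) {1 3}a => [|b l IH] x /=; first by exists 1.
case/andP=> xb /IH[e e0 He].
have [f f0 Hf] : exists2 f, 0 < f & forall t, 0 <= t <= f ->
    descends (fun i => y i + t * u i) x b.
  move: xb; rewrite /descends; case: eqP => _ /=; last by exists 1.
  exact: lt_open.
exists (Num.min e f); first by rewrite lt_min e0 f0.
by move=> t /andP[t0]; rewrite le_min => /andP[te tf]; rewrite Hf ?He ?t0.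
Qed.

Variables (D : nat) (xi : nat -> 'rV[R]_D) (v : 'rV[R]_D) (p : nat).
Variable s : seq (nat * nat).
Hypothesis gen : generic xi v p.+1.
Hypothesis p0 : (0 < p)%N.
Hypothesis sp : forall a, a \in s -> (a.1 < p)%N.

(** Solutions for the vertices up to p whose restriction to the vertices below
    p follows the arrangement s; the place of y p is free. *)
Definition fits y := solves xi v p.+1 y /\ cycle (descends y) s.

Lemma fits_line y u : fits y -> solves xi 0 p.+1 u ->
  exists2 e, 0 < e & forall t, 0 <= t <= e -> fits (fun i => y i + t * u i).
Proof.
move=> [[y0 Ey] Cy] [u0 Eu]; have [e e0 He] := cycle_open u Cy.
exists e => // t te; split; last exact: He.
split; first by rewrite y0 u0 mulr0 addr0.
under eq_bigr do rewrite scalerDl -scalerA.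
by rewrite big_split /= -scaler_sumr Eu scaler0 addr0.
Qed.

Lemma fits_perturb_up y a c : (a < p)%N -> fits y -> y p = y a -> y p < y c ->
  exists2 y', fits y' & y' a < y' p < y' c.
Proof.
move=> ap Fy ypa ypc; have [u Su u1] := generic_direction ap gen Fy.1 ypa.
have [e e0 He] := fits_line Fy Su; have [f f0 Hf] := lt_open (u p) (u c) ypc.
have g0 : 0 < Num.min e f by rewrite lt_min e0 f0.
exists (fun i => y i + Num.min e f * u i).
  by apply: He; rewrite ltW //= ge_min lexx.
apply/andP; split; last by apply: Hf; rewrite ltW //= ge_min lexx orbT.
rewrite ypa ltrD2l ltr_pM2l //; lra.
Qed.

Lemma fits_perturb y a : (a < p)%N -> fits y -> y p = y a ->
  (exists2 y', fits y' & y' a < y' p) /\ (exists2 y', fits y' & y' p < y' a).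
Proof.
move=> ap Fy ypa; have [u Su u1] := generic_direction ap gen Fy.1 ypa.
have Su' : solves xi 0 p.+1 (fun i => - u i).
  split; first by rewrite Su.1 oppr0.
  by under eq_bigr do rewrite scaleNr; rewrite sumrN Su.2 oppr0.
have [e e0 He] := fits_line Fy Su; have [f f0 Hf] := fits_line Fy Su'.
split.
  exists (fun i => y i + e * u i); first by apply: He; rewrite lexx ltW.
  by rewrite ypa ltrD2l ltr_pM2l //; lra.
exists (fun i => y i + f * - u i); first by apply: Hf; rewrite lexx ltW.
by rewrite ypa ltrD2l ltr_pM2l //; lra.
Qed.

(** The solutions form a convex set, so y p - y a vanishes somewhere between
    two solutions at which it has opposite signs. *)
Lemma fits_cross y1 y2 a : fits y1 -> fits y2 -> y1 p < y1 a -> y2 a < y2 p ->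
  exists2 y, fits y & y p = y a.
Proof.
move=> [[z1 S1] C1] [[z2 S2] C2] h1 h2.
(* The root of the affine function y p - y a on the segment from y2 to y1. *)
pose t := (y2 p - y2 a) / ((y2 p - y2 a) + (y1 a - y1 p)).
have d0 : 0 < (y2 p - y2 a) + (y1 a - y1 p) by lra.
have t0 : 0 < t by rewrite divr_gt0 // subr_gt0.
have t1 : t < 1 by rewrite /t ltr_pdivrMr // mul1r ltrDl subr_gt0.
have tE : t * (y1 p - y1 a) + (1 - t) * (y2 p - y2 a) = 0.
  by rewrite /t; field; rewrite gt_eqF.
clearbody t; exists (fun i => t * y1 i + (1 - t) * y2 i); last by lra.
split.
  split; first by rewrite z1 z2 !mulr0 addr0.
  under eq_bigr do rewrite scalerDl -!scalerA.
  by rewrite big_split /= -!scaler_sumr S1 S2 -scalerDl addrC subrK scale1r.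
case: (s) C1 C2 => [//|a0 s']; rewrite /=.
elim: (rcons s' a0) {1 3 5}a0 => [|b l IH] x //= /andP[x1 l1] /andP[x2 l2].
rewrite IH // andbT.
move: x1 x2; rewrite /descends; case: eqP => //= _ x1 x2.
by rewrite ltrD // ltr_pM2l // subr_gt0.
Qed.

Definition above b : bool := `[< exists2 y, fits y & y b < y p >].
Definition below a : bool := `[< exists2 y, fits y & y p < y a >].
Definition meets a : bool := `[< exists2 y, fits y & y p = y a >].

(** By convexity and perturbation, y p can be put at the level of y a exactly
    when it can be put on both sides, and one side is always possible. *)
Lemma above_below a : (a < p)%N -> (exists y, fits y) ->
  (below a + above a = 1 + meets a)%N.
Proof.
move=> ap [y Fy]; have [M|M] := boolP (meets a).
  move/asboolP: M => [z Fz za]; have [U L] := fits_perturb ap Fz za.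
  by rewrite /above /below !asboolT.
have [/asboolP[y1 F1 h1]|nB] := boolP (below a).
  rewrite [above a](_ : _ = false) //; apply: contraNF M => /asboolP[y2 F2 h2].
  by apply/asboolP; apply: fits_cross F1 F2 h1 h2.
have [//|nA] := boolP (above a).
case: (ltgtP (y p) (y a)) => h.
- by case/negP: nB; apply/asboolP; exists y.
- by case/negP: nA; apply/asboolP; exists y.
- by case/negP: M; apply/asboolP; exists y.
Qed.

(** The gap between consecutive unmarked a and b is reachable exactly when y p
    can be both below y a and above y b; since b stays below a, one of the two
    is always possible. This makes the count additive. *)
Lemma insert_between a b : (a < p)%N -> (b < p)%N -> (exists y, fits y) ->
  (forall y, fits y -> y b < y a) ->
  (`[< exists2 y, fits y & ((y p < y a) && (y b < y p))%R >] + 1 =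
   below a + above b)%N.
Proof.
move=> ap bp [y Fy] ba.
have DU : ~~ below a -> above b.
  move=> nB; apply/asboolP; exists y => //; rewrite (lt_le_trans (ba _ Fy)) // leNgt.
  by apply: contraNN nB => h; apply/asboolP; exists y.
have [B|B] := boolP (below a); last first.
  rewrite asboolF ?DU // => -[z Fz /andP[h _]].
  by case/negP: B; apply/asboolP; exists z.
have [A|A] := boolP (above b); last first.
  rewrite asboolF // => -[z Fz /andP[_ h]].
  by case/negP: A; apply/asboolP; exists z.
rewrite asboolT //.
move/asboolP: B => [y1 F1 h1]; move/asboolP: A => [y2 F2 h2].
case: (ltgtP (y1 p) (y1 b)) => h.
- have [z Fz zb] := fits_cross F1 F2 h h2.
  have [|z' Fz' /andP[zz1 zz2]] := @fits_perturb_up z b a bp Fz zb.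
    by rewrite zb ba.
  by exists z'; rewrite ?zz1 ?zz2.
- by exists y1; rewrite ?h1 ?h.
- have [z' Fz' /andP[zz1 zz2]] := fits_perturb_up bp F1 h h1.
  by exists z'; rewrite ?zz1 ?zz2.
Qed.

Lemma feasible_insert i m (a := nth (0, 0)%N s i) :
  (i < size s)%N -> (m <= a.2)%N ->
  feasible xi v p.+1 (insert_at p s i m) <->
  exists2 y, fits y & ((m == 0%N) ==> (y p < y a.1))
                    && ((m == a.2) ==> (y (next_at s i).1 < y p)).
Proof.
move=> si ma; split=> [[y Sy]|[y [Sy Cy] H]].
  by rewrite cycle_insert // => /andP[Cy H]; exists y.
by exists y => //; rewrite cycle_insert // Cy.
Qed.

Lemma next_at_mem i : (i < size s)%N -> next_at s i \in s.
Proof. by move=> si; rewrite -(mem_rot 1) mem_nth // size_rot. Qed.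

Lemma cycle_next y i : (i < size s)%N -> cycle (descends y) s ->
  descends y (nth (0, 0)%N s i) (next_at s i).
Proof.
move=> si; rewrite next_atE // -(@rot_cycle i _ _ s) /rot (drop_nth (0, 0)%N) //=.
by case: (drop _ _ ++ take _ _) => [|x l] /=; [rewrite andbT|case/andP].
Qed.

(** The contribution of the entry a: all ways of splitting its marks together
    count [below a] + [above (next a)] + (marks of a) - 1, whether a is marked
    or not. *)
Lemma count_insert_at i (a := nth (0, 0)%N s i) : (i < size s)%N ->
  (exists y, fits y) ->
  (\sum_(m <- iota 0 a.2.+1) `[< feasible xi v p.+1 (insert_at p s i m) >] + 1 =
   below a.1 + above (next_at s i).1 + a.2)%N.
Proof.
move=> si ne; have as_ : a \in s by rewrite mem_nth.
have ap := sp as_; have bp := sp (next_at_mem si).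
rewrite (eq_big_seq (fun m : nat => nat_of_bool
   `[< exists2 y, fits y & ((m == 0%N) ==> (y p < y a.1))%R
                    && ((m == a.2) ==> (y (next_at s i).1 < y p))%R >])); last first.
  move=> m; rewrite mem_iota => ma; congr nat_of_bool; apply: asbool_equiv_eq.
  by apply: feasible_insert => //; lia.
have [a0|a0] := posnP a.2.
  rewrite a0 big_seq1 /= addn0 -insert_between // => y [_ C].
  by have := cycle_next si C; rewrite /descends -/a a0.
have -> : iota 0 a.2.+1 = 0%N :: rcons (iota 1 a.2.-1) a.2.
  rewrite /= -cats1; congr (_ :: _).
  have {1}-> : a.2 = (a.2.-1 + 1)%N by lia.
  by rewrite iotaD /= add1n prednK.
rewrite big_cons big_rcons.
have -> : (0%N == a.2) = false by lia.
have -> : (a.2 == 0%N) = false by lia.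
rewrite !eqxx /=.
rewrite (eq_big_seq (fun _ => 1%N)); last first.
  move=> m; rewrite mem_iota => mm.
  rewrite gtn_eqF /=; last by lia.
  rewrite ltn_eqF /=; last by lia.
  by rewrite asboolT //; case: ne => y Fy; exists y.
rewrite sum1_size size_iota.
have -> : `[< exists2 y, fits y & (y p < y a.1) && true >] = below a.1.
  by apply: asbool_equiv_eq; split=> -[y Fy h]; exists y; move: h; rewrite ?andbT.
rewrite -/(above _); lia.
Qed.

(** Summing [count_insert_at] around the cycle, [above (next a)] can be
    replaced by [above a], and [above_below] turns below + above - 1 into
    [meets]. *)
Lemma count_inserts : uniq (map fst s) -> map fst s =i iota 0 p ->
  (\sum_(t <- inserts p s) `[< feasible xi v p.+1 t >] =
   if `[< exists y, fits y >] then
     (\sum_(a <- s) a.2) + \sum_(a < p) meets a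
   else 0)%N.
Proof.
move=> us s_iota; rewrite big_allpairs_dep.
case: asboolP => [ne|ne]; last first.
  rewrite big_seq big1 // => i; rewrite mem_iota => si.
  rewrite big_seq big1 // => m; rewrite mem_iota => ma.
  by rewrite asboolF // feasible_insert // => -[y Fy _]; apply: ne; exists y.
apply/eqP; rewrite -(eqn_add2r (size s)); apply/eqP.
have -> : (\sum_(i <- iota 0 (size s)) \sum_(m <- iota 0 (nth (0,0) s i).2.+1)
    `[< feasible xi v p.+1 (insert_at p s i m) >] + size s =
   \sum_(i <- iota 0 (size s)) (below (nth (0,0) s i).1 + above (next_at s i).1
      + (nth (0,0) s i).2))%N.
  rewrite [X in (_ + X)%N](_ : _ = \sum_(i <- iota 0 (size s)) 1)%N; last first.
    by rewrite sum1_size size_iota.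
  rewrite -big_split.
  by apply: eq_big_seq => i; rewrite mem_iota => /= si; rewrite -count_insert_at.
rewrite !big_split /=.
have nthE (F : nat * nat -> nat) t : size t = size s ->
  (\sum_(i <- iota 0 (size s)) F (nth (0,0) t i) = \sum_(a <- t) F a)%N.
  move=> st; rewrite -[in RHS](mkseq_nth (0,0)%N t) /mkseq big_map st.
  by [].
rewrite (nthE (fun a => below a.1)) // (nthE snd) // /next_at.
rewrite (nthE (fun a => above a.1)) ?size_rot //.
rewrite [X in (_ + X + _)%N](perm_big s); last by rewrite perm_rot.
rewrite -big_split /= [LHS]addnC -addnA; congr addn.
rewrite -sum1_size.
rewrite -(big_mkord xpredT (fun a => meets a : nat)) /index_iota subn0.
rewrite -(perm_big _ (uniq_perm us (iota_uniq 0 p) s_iota)) big_map.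
rewrite -big_split /=; apply: eq_big_seq => a as_.
by rewrite above_below ?sp // addnC.
Qed.

End Insertion.

(** * The number of feasible arrangements *)

Section Counting.
Variable R : realFieldType.
Implicit Types (y u w z : nat -> R) (s : seq (nat * nat)).

Definition arrangement (k p : nat) s : Prop :=
  perm_eq (map fst s) (iota 0 p) /\ (\sum_(a <- s) a.2 = k)%N.

Lemma arrangement_mem k p s a : arrangement k p s -> a \in s -> (a.1 < p)%N.
Proof.
by move=> [sp _] /(map_f fst); rewrite (perm_mem sp) mem_iota add0n.
Qed.

Lemma insertsP p s t : reflect
  (exists i m, [/\ (i < size s)%N, (m <= (nth (0, 0)%N s i).2)%N
     & t = insert_at p s i m]) (t \in inserts p s).
Proof.
apply: (iffP allpairsPdep) => [[i [m [H1 H2 ->]]]|[i [m [H1 H2 ->]]]].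
  by exists i, m; split=> //; move: H1 H2; rewrite !mem_iota !add0n /= ?ltnS; lia.
by exists i, m; split=> //; rewrite mem_iota; lia.
Qed.

Lemma arrangement_insert k p s t :
  arrangement k p s -> t \in inserts p s -> arrangement k p.+1 t.
Proof.
move=> [sp sk] /insertsP[i [m [si ma ->]]]; rewrite /insert_at.
set a := nth _ _ _ in ma *.
have sE : s = take i s ++ a :: drop i.+1 s by rewrite -drop_nth ?cat_take_drop.
split.
  apply: (@perm_trans _ (p :: map fst s)); last first.
    by rewrite -addn1 iotaD add0n cats1 perm_sym perm_rcons perm_cons perm_sym.
  rewrite [in X in perm_eq _ X]sE !map_cat /=.
  by apply/seq.permP => f; rewrite /= !count_cat /=; lia.
rewrite -sk [in RHS]sE !big_cat !big_cons /=; lia.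
Qed.

Fixpoint arrangements (p0 : nat) (base : seq (nat * nat)) (j : nat) :=
  if j is j'.+1 then
    flatten [seq inserts (p0 + j') s | s <- arrangements p0 base j']
  else [:: base].

(** The sum of the coefficients of degree at least D of t ^ (p0 - 1) prod_(p0
    <= i < p0 + j) (k t + i), computed by the recursion that the insertions
    satisfy. The truncation of D.-1 at D = 0 is the right one, since then all
    coefficients are summed. *)
Fixpoint feasible_count (k p0 j D : nat) : nat :=
  if j is j'.+1 then
    k * feasible_count k p0 j' D.-1 + (p0 + j') * feasible_count k p0 j' D
  else (D < p0)%N.

Variables (k p0 : nat) (base : seq (nat * nat)).
Hypothesis p0_gt0 : (0 < p0)%N.
Hypothesis base_arr : arrangement k p0 base.
Hypothesis base_marked : all (fun a => 0 < a.2)%N base.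

Lemma arrangementsP j s :
  s \in arrangements p0 base j -> arrangement k (p0 + j) s.
Proof.
elim: j s => [|j IH] s /=; first by rewrite inE addn0 => /eqP ->.
case/flatten_mapP => t /IH tA st; rewrite addnS.
exact: arrangement_insert st.
Qed.

Lemma cycle_marked y s : all (fun a => 0 < a.2)%N s -> cycle (descends y) s.
Proof.
case: s => //= a s /andP[a0 sall].
suff H c : (0 < c.2)%N -> path (descends y) c (rcons s a) by exact: H.
elim: s c sall => [|b s IH] c /= sall c0; rewrite {1}/descends gtn_eqF //=.
by case/andP: sall => b0 sall; exact: IH.
Qed.

(** When every vertex is marked there is no order condition, and feasibility
    means that the p0 - 1 free steps span the target space. *)
Lemma feasible_marked D (xi : nat -> 'rV[R]_D) v s : generic xi v p0 ->
  all (fun a => 0 < a.2)%N s -> feasible xi v p0 s <-> (D < p0)%N.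
Proof.
move=> gen sall; split=> [[y [y0 Ey] _]|Dp].
  rewrite ltnNge; apply/negP => pD.
  have [|||||//] := gen p0.-1 id y true.
  - by rewrite /=; lia.
  - by [].
  - by [].
  - by move=> i; lia.
  - by rewrite scale1r.
have [w w0 Ew] := generic_span Dp gen v.
by exists w => //; exact: cycle_marked.
Qed.

Lemma descends_eq_in p y y' s : (forall a, a \in s -> (a.1 < p)%N) ->
  (forall i, (i < p)%N -> y i = y' i) ->
  cycle (descends y) s = cycle (descends y') s.
Proof.
move=> sp yy'; apply: (@eq_in_cycle _ (mem s)); last exact/allP.
by move=> a b /sp ap /sp bp; rewrite /descends !yy'.
Qed.

(** The value y p is determined by the residual along the line of [xi p]. *)
Lemma fits_project D (xi : nat -> 'rV[R]_D) v p s (P : 'M[R]_(D, D.-1)) :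
  (0 < p)%N -> (forall a, a \in s -> (a.1 < p)%N) ->
  xi p *m P = 0 -> (forall x, x *m P = 0 -> exists t, x = t *: xi p) ->
  (exists y, fits xi v p s y) <->
  feasible (fun i => xi i *m P) (v *m P) p s.
Proof.
move=> p_gt0 sp xP kerP; split=> [[y [[y0 Ey] Cy]]|[y [y0 Ey] Cy]].
  exists y => //; split=> //.
  have := congr1 (fun x => x *m P) Ey; rewrite big_ord_recr /= mulmxDl.
  rewrite -scalemxAl xP scaler0 addr0 mulmx_suml => <-.
  by apply: eq_bigr => i _; rewrite scalemxAl.
have [|t Et] := kerP (\sum_(i < p) y i *: xi i - v).
  rewrite mulmxBl mulmx_suml -Ey -sumrB big1 // => i _.
  by rewrite -scalemxAl subrr.
exists (fun i => if i == p then - t else y i); split; last first.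
  rewrite (@descends_eq_in p _ y) // => i ip; by rewrite ltn_eqF.
split; first by rewrite ltn_eqF.
rewrite big_ord_recr /= eqxx.
under eq_bigr do rewrite ltn_eqF //.
move: Et => /(canRL (subrK _)) ->; rewrite scaleNr.
by rewrite addrAC subrr add0r.
Qed.

Lemma meets_merge D (xi : nat -> 'rV[R]_D) v p s a :
  (a < p)%N -> (forall a, a \in s -> (a.1 < p)%N) ->
  meets xi v p s a = `[< feasible (merge xi a p) v p s >].
Proof.
move=> ap sp; apply: asbool_equiv_eq; split=> [[y [[y0 Ey] Cy] ya]|[y [y0 Ey] Cy]].
  exists y => //; split=> //; rewrite (sum_merge _ y) //.
  by rewrite -ya -Ey big_ord_recr.
exists (fun i => if i == p then y a else y i); last by rewrite eqxx ltn_eqF.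
split; last first.
  by rewrite (@descends_eq_in p _ y) // => i ip; rewrite ltn_eqF.
split; first by rewrite ltn_eqF //; lia.
rewrite big_ord_recr /= eqxx -Ey (sum_merge _ y) //; congr (_ + _).
by under eq_bigr do rewrite ltn_eqF //.
Qed.

(** The number of feasible arrangements depends on the steps only through the
    codimension D. *)
Theorem count_feasible j D (xi : nat -> 'rV[R]_D) v : generic xi v (p0 + j) ->
  (\sum_(s <- arrangements p0 base j) `[< feasible xi v (p0 + j) s >] =
   feasible_count k p0 j D)%N.
Proof.
elim: j D xi v => [|j IH] D xi v gen /=.
  rewrite big_seq1 addn0 in gen *; congr nat_of_bool.
  case: ltnP => h; [rewrite asboolT //|rewrite asboolF //].
    by apply/feasible_marked.
  by move/(feasible_marked gen base_marked); lia.
rewrite addnS in gen *.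
have pj : (0 < p0 + j)%N by lia.
have [P xP kerP] := line_kernel (generic_neq0 pj gen).
rewrite big_flatten big_map /=.
rewrite -(IH D.-1 _ _ (generic_proj pj kerP gen)).
have -> : ((p0 + j) * feasible_count k p0 j D = \sum_(a < p0 + j)
    \sum_(s <- arrangements p0 base j)
      `[< feasible (merge xi a (p0 + j)) v (p0 + j) s >])%N.
  under eq_bigr => a _ do rewrite (IH D _ _ (generic_merge (ltn_ord a) gen)).
  by rewrite sum_nat_const card_ord.
rewrite exchange_big /= big_distrr /= -big_split /=.
apply: eq_big_seq => s sA; have [sp sk] := arrangementsP sA.
have smem := arrangement_mem (conj sp sk).
rewrite (count_inserts gen pj smem); last 2 first.
- by rewrite (perm_uniq sp) iota_uniq.
- by move=> i; rewrite (perm_mem sp).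
have -> : `[< exists y, fits xi v (p0 + j) s y >] =
    `[< feasible (fun i => xi i *m P) (v *m P) (p0 + j) s >].
  by apply: asbool_equiv_eq; exact: fits_project.
rewrite [X in (_ = _ + X)%N](eq_bigr (fun a : 'I_(p0 + j) =>
  nat_of_bool (meets xi v (p0 + j) s a))); last first.
  by move=> a _; rewrite meets_merge.
case: asboolP => [_|NF]; first by rewrite sk muln1.
rewrite muln0 add0n big1 // => a _; rewrite [meets _ _ _ _ _]asboolF //.
move=> [y Fy _]; apply: NF; rewrite -(fits_project _ pj smem xP kerP).
by exists y.
Qed.

End Counting.

(** * Arrangements as permutations with a marked subset *)

Section MarkedPermutations.
Implicit Types (s t : seq (nat * nat)).

(** The walk with steps permuted by [sg], as a cyclic sequence of vertices.
    Vertex i > 0 stands for the step leading to S_i in the original walk, and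
    position 0 is always occupied by vertex 0. The elements of J carry one
    mark each. *)
Definition marked_walk m (sg : 'S_m) (J : {set 'I_m.+1}) : seq (nat * nat) :=
  [seq (val (lift_perm ord0 ord0 sg i), (i \in J) : nat) | i <- enum 'I_m.+1].

Lemma leq_sum_subset (T : eqType) (A B : seq T) (F : T -> nat) :
  uniq A -> uniq B -> {subset A <= B} ->
  (\sum_(a <- A) F a <= \sum_(b <- B) F b)%N.
Proof.
by move=> uA uB AB; apply: (uniq_sub_le_big leqnn (fun x y => leq_addr y x)).
Qed.

(** The inverse of an insertion: p is deleted and its marks go back to its
    predecessor. *)
Definition remove_vertex p t :=
  let i := index p (map fst t) in
  let a := nth (0, 0)%N t i.-1 in
  take i.-1 t ++ (a.1, a.2 + (nth (0, 0)%N t i).2)%N :: drop i.+1 t.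

Lemma index_insert_at p s i m : p \notin map fst s -> (i < size s)%N ->
  index p (map fst (insert_at p s i m)) = i.+1.
Proof.
move=> ps si; rewrite /insert_at map_cat /= index_cat.
have /negbTE -> : p \notin map fst (take i s).
  by rewrite map_take; apply: contra ps; exact: mem_take.
rewrite size_map size_takel ?(ltnW si) //= eqxx.
case: eqP => [E|_]; last by rewrite addn1.
by case/negP: ps; rewrite -E; apply: map_f; rewrite mem_nth.
Qed.

Lemma insert_atK p s i m : p \notin map fst s -> (i < size s)%N ->
  (m <= (nth (0, 0)%N s i).2)%N -> remove_vertex p (insert_at p s i m) = s.
Proof.
move=> ps si mi; rewrite /remove_vertex index_insert_at //= /insert_at.
have st : size (take i s) = i by rewrite size_takel // ltnW.
rewrite !nth_cat st ltnn subnn /= ltnNge leqW //= subSnn /=.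
rewrite take_cat st ltnn subnn cats0 drop_cat st ltnNge leqW //=.
rewrite -addn2 addKn /= drop0 subnKC //.
rewrite -[X in _ = X](cat_take_drop i) (drop_nth (0, 0)%N si).
by congr (_ ++ _ :: _); case: (nth _ _ _).
Qed.

Lemma insert_at_inj p s i m i' m' : p \notin map fst s ->
  (i < size s)%N -> (i' < size s)%N -> insert_at p s i m = insert_at p s i' m' ->
  i = i' /\ m = m'.
Proof.
move=> ps si si' E.
have ii : i = i'.
  by apply: succn_inj; rewrite -(index_insert_at m ps si) E index_insert_at.
split=> //; rewrite -ii in E; move: E; rewrite /insert_at => /eqP.
by rewrite eqseq_cat // eqxx /= => /eqP[].
Qed.

Lemma arrangements_uniq k p0 base j : (0 < p0)%N -> arrangement k p0 base ->
  uniq (arrangements p0 base j).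
Proof.
move=> p0_gt0 base_arr; elim: j => [//|j IH] /=.
have notin s : s \in arrangements p0 base j -> (p0 + j)%N \notin map fst s.
  move=> /(arrangementsP base_arr)[sp _]; rewrite (perm_mem sp) mem_iota; lia.
have -> : flatten [seq inserts (p0 + j) s | s <- arrangements p0 base j] =
    [seq t | s <- arrangements p0 base j, t <- inserts (p0 + j) s].
  by congr flatten; apply: eq_map => s; rewrite map_id.
apply: allpairs_uniq_dep => //.
- move=> s /notin sj; apply: allpairs_uniq_dep; first exact: iota_uniq.
    by move=> i _; exact: iota_uniq.
  move=> u u' /allpairsPdep[i [m [Hi Hm ->]]] /allpairsPdep[i' [m' [Hi' Hm' ->]]] /=.
  rewrite mem_iota in Hi; rewrite mem_iota in Hi'.
  by case/(insert_at_inj sj Hi Hi') => -> ->.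
move=> u u' /allpairsPdep[s [t [Hs Ht ->]]] /allpairsPdep[s' [t' [Hs' Ht' ->]]] /= E.
have [i [m [si mi Et]]] := insertsP _ _ _ Ht.
have [i' [m' [si' mi' Et']]] := insertsP _ _ _ Ht'.
suff ss' : s = s' by rewrite ss' E.
rewrite -(insert_atK (notin _ Hs) si mi) -Et E Et'.
by rewrite (insert_atK (notin _ Hs') si' mi').
Qed.

(** Insertions are made after an existing entry, so vertex 0 stays at the head
    and represents the cyclic sequence without ambiguity. *)
Definition rooted s := (head (0, 0)%N s).1 = 0%N.

Lemma insert_rooted p s t : rooted s -> t \in inserts p s -> rooted t.
Proof.
move=> rs /insertsP[i [m [si mi ->]]]; rewrite /insert_at /rooted.
by case: s rs si {mi} => // a s; case: i.
Qed.

Lemma arrangements_rooted p0 base j s : rooted base ->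
  s \in arrangements p0 base j -> rooted s.
Proof.
move=> rb; elim: j s => [|j IH] s /=; first by rewrite inE => /eqP ->.
by case/flatten_mapP => t /IH rt; exact: insert_rooted.
Qed.

(** Every arrangement arises by insertions: the largest vertex is not the
    head, so it can be removed by giving its marks to its predecessor. *)
Lemma mem_arrangements k j s : arrangement k j.+1 s -> rooted s ->
  s \in arrangements 1 [:: (0, k)%N] j.
Proof.
elim: j s => [|j IH] s [sp sk] rs /=.
  case: s sp sk rs => [|a [|b s]] /=.
  - by move=> /perm_size.
  - rewrite big_seq1 /rooted /= => _ <- <-; by rewrite inE; case: a.
  - by move=> /perm_size.
apply/flatten_mapP; rewrite add1n.
have : j.+1 \in map fst s by rewrite (perm_mem sp) mem_iota; lia.
case/(nthP 0%N) => i; rewrite size_map => si Ei.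
rewrite (nth_map (0, 0)%N) // in Ei.
case: i si Ei => [|i] si Ei; first by move: rs Ei; rewrite /rooted nth0 => ->.
set a := nth (0, 0)%N s i; set b := nth (0, 0)%N s i.+1 in Ei.
have sE : s = take i s ++ a :: b :: drop i.+2 s.
  by rewrite -drop_nth // -drop_nth ?cat_take_drop //; lia.
have st : size (take i s) = i by rewrite size_takel //; lia.
pose t := take i s ++ (a.1, a.2 + b.2)%N :: drop i.+2 s.
have ti : nth (0, 0)%N t i = (a.1, a.2 + b.2)%N by rewrite nth_cat st ltnn subnn.
exists t; last first.
  apply/insertsP; exists i, a.2; rewrite ti size_cat st /=; split; try lia.
  rewrite /insert_at ti /= take_cat st ltnn subnn cats0 drop_cat st ltnNge leqW //=.
  rewrite subSnn /= drop0 addKn -Ei {1}sE.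
  by case: (a) (b) => [a1 a2] [b1 b2].
apply: IH; last first.
  move: rs; rewrite /rooted /t {1}sE; case: (take i s) => //=.
split.
  have H : perm_eq (j.+1 :: map fst t) (j.+1 :: iota 0 j.+1).
    apply: (@perm_trans _ (map fst s)).
      rewrite [in X in perm_eq _ X]sE /t; apply/seq.permP => f.
      rewrite /= !map_cat !count_cat /= Ei; lia.
    apply: (perm_trans sp); rewrite -[j.+2]addn1 iotaD add0n cats1.
    by rewrite perm_rcons.
  by rewrite perm_cons in H.
rewrite -sk [in RHS]sE /t !big_cat !big_cons /=; lia.
Qed.

Lemma marked_walk_arrangement m (sg : 'S_m) (J : {set 'I_m.+1}) :
  arrangement #|J| m.+1 (marked_walk sg J).
Proof.
split; last first.
  by rewrite big_map /= big_enum /= -sum1_card [in RHS]big_mkcond; apply: eq_bigr => i _; case: ifP.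
rewrite -map_comp -val_enum_ord.
rewrite (map_comp val (lift_perm ord0 ord0 sg)); apply: perm_map.
apply: uniq_perm; rewrite ?enum_uniq //.
  by rewrite map_inj_uniq ?enum_uniq //; exact: perm_inj.
move=> i; rewrite mem_enum; apply/mapP; exists ((lift_perm ord0 ord0 sg)^-1 i)%g.
  by rewrite mem_enum.
by rewrite permKV.
Qed.

Lemma marked_walk_rooted m (sg : 'S_m) J : rooted (marked_walk sg J).
Proof.
by rewrite /rooted /marked_walk enum_ordSl /= lift_perm_id.
Qed.

Lemma marked_walk_inj m (sg sg' : 'S_m) J J' :
  marked_walk sg J = marked_walk sg' J' -> sg = sg' /\ J = J'.
Proof.
move/eq_in_map => H.
have H' i : val (lift_perm ord0 ord0 sg i) = val (lift_perm ord0 ord0 sg' i) /\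
   (i \in J) = (i \in J').
  have := H i (mem_enum _ _) => -[h0 h]; split; first exact: h0.
  by move: h; do 2!case: (_ \in _).
split; last by apply/setP => i; case: (H' i).
apply/permP => i; have [/val_inj + _] := H' (lift ord0 i).
by rewrite !lift_perm_lift => /lift_inj.
Qed.

(** An arrangement with at most one mark at each vertex is read off as a
    permutation of the vertices fixing 0, hence of the steps, and a set of
    marked positions. *)
Lemma marked_walk_surj m k s : arrangement k m.+1 s -> rooted s ->
  all (fun a => a.2 <= 1)%N s ->
  exists (sg : 'S_m) (J : {set 'I_m.+1}), #|J| = k /\ s = marked_walk sg J.
Proof.
move=> [sp sk] rs s1.
have ss : size s = m.+1 by have := perm_size sp; rewrite size_map size_iota.
have us : uniq (map fst s) by rewrite (perm_uniq sp) iota_uniq.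
have sm (i : 'I_m.+1) : ((nth (0, 0)%N s i).1 < m.+1)%N.
  by apply: (arrangement_mem (conj sp sk)); rewrite mem_nth // ss.
pose f (i : 'I_m.+1) : 'I_m.+1 := Ordinal (sm i).
have f_inj : injective f.
  move=> i j /(congr1 val) /= /eqP.
  rewrite -!(nth_map _ 0%N) ?ss // nth_uniq ?size_map ?ss //.
  by move/eqP/val_inj.
have f0 : f ord0 = ord0.
  by apply: val_inj; rewrite /= nth0; exact: rs.
pose g (i : 'I_m) : 'I_m := odflt i (unlift ord0 (f (lift ord0 i))).
have gE i : lift ord0 (g i) = f (lift ord0 i).
  rewrite /g; case: unliftP => [j -> //|E].
  by have := f_inj _ _ (etrans E (esym f0)).
have g_inj : injective g.
  move=> i j /(congr1 (lift ord0)); rewrite !gE => /f_inj; exact: lift_inj.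
pose sg := perm g_inj; pose J := [set i : 'I_m.+1 | (nth (0, 0)%N s i).2 == 1%N].
have sE : s = marked_walk sg J.
  apply: (@eq_from_nth _ (0, 0)%N); first by rewrite size_map size_enum_ord.
  move=> i; rewrite ss => im.
  rewrite (nth_map ord0) ?size_enum_ord // (_ : nth ord0 _ i = Ordinal im); last first.
    by apply: val_inj; rewrite /= nth_enum_ord.
  have -> : lift_perm ord0 ord0 sg (Ordinal im) = f (Ordinal im).
    case: (unliftP ord0 (Ordinal im)) => [j ->|->].
      by rewrite lift_perm_lift permE gE.
    by rewrite lift_perm_id f0.
  rewrite inE /=; have := allP s1 (nth (0, 0)%N s i).
  rewrite mem_nth ?ss // => /(_ isT); case: (nth _ _ _) => a [|[|//]] //.
exists sg, J; split=> //.
have [_ <-] := marked_walk_arrangement sg J.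
by rewrite -sE.
Qed.

End MarkedPermutations.

Section CountBounds.
Variable R : realFieldType.

Definition feasible_total m k D (xi : nat -> 'rV[R]_D) v : nat :=
  \sum_(sg : 'S_m) \sum_(J : {set 'I_m.+1} | #|J| == k)
    `[< feasible xi v m.+1 (marked_walk sg J) >].

Lemma feasible_totalE m k D (xi : nat -> 'rV[R]_D) v :
  exists2 A : seq (seq (nat * nat)),
    uniq A /\ (forall s, s \in A <-> exists (sg : 'S_m) (J : {set 'I_m.+1}),
       #|J| = k /\ s = marked_walk sg J) &
  feasible_total m k xi v = (\sum_(s <- A) `[< feasible xi v m.+1 s >])%N.
Proof.
pose B := [seq x : 'S_m * {set 'I_m.+1} <- enum {: 'S_m * {set 'I_m.+1}} | #|x.2| == k].
exists [seq marked_walk x.1 x.2 | x <- B].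
  split.
    rewrite map_inj_uniq; first by apply: filter_uniq; exact: enum_uniq.
    move=> [a b] [a' b'] /=.
    by case/marked_walk_inj => -> ->.
  move=> s; split=> [/mapP[x]|[sg [J [Jk ->]]]].
    by rewrite mem_filter => /andP[/eqP xk _] ->; exists x.1, x.2.
  by apply/mapP; exists (sg, J) => //; rewrite mem_filter mem_enum /= Jk eqxx.
rewrite big_map big_filter big_enum_cond /=.
rewrite /feasible_total pair_big_dep /=; apply: eq_bigl => x.
by [].
Qed.

(** All pairs (order, J) are among the arrangements that grow from the vertex
    0 carrying k marks. *)
Lemma feasible_total_upper m k D (xi : nat -> 'rV[R]_D) v : (0 < k)%N ->
  generic xi v m.+1 -> (feasible_total m k xi v <= feasible_count k 1 m D)%N.
Proof.
move=> k0 gen; have [A [uA memA] ->] := feasible_totalE m k xi v.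
have ba : arrangement k 1 [:: (0, k)%N] by split; rewrite ?big_seq1.
rewrite -add1n in gen.
rewrite -(count_feasible _ ba _ gen) //=; last by rewrite k0.
apply: leq_sum_subset => //; first exact: arrangements_uniq ba.
move=> s /memA[sg [J [<- ->]]]; apply: mem_arrangements.
  exact: marked_walk_arrangement.
exact: marked_walk_rooted.
Qed.

(** The arrangements that grow from the vertices 0, ..., k - 1 with one mark
    each have at most one mark everywhere, because an insertion splits a
    single mark as 1 + 0 or 0 + 1. *)
Lemma feasible_total_lower m k D (xi : nat -> 'rV[R]_D) v : (0 < k <= m.+1)%N ->
  generic xi v m.+1 ->
  (feasible_count k k (m.+1 - k) D <= feasible_total m k xi v)%N.
Proof.
move=> /andP[k0 km] gen; have [A [uA memA] ->] := feasible_totalE m k xi v.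
pose b := [seq (i, 1%N) | i <- iota 0 k].
have ba : arrangement k k b.
  split; first by rewrite -map_comp map_id.
  by rewrite big_map sum1_size size_iota.
have kE : m.+1 = (k + (m.+1 - k))%N by lia.
rewrite {1}kE in gen.
rewrite -(count_feasible k0 ba _ gen); last by apply/allP => a /mapP[i _ ->].
rewrite -kE; apply: leq_sum_subset => //; first exact: arrangements_uniq ba.
move=> s sA; apply/memA; apply: marked_walk_surj.
- by rewrite kE; apply: arrangementsP sA.
- apply: arrangements_rooted sA; rewrite /rooted /b.
  by case: (k) k0.
elim: (m.+1 - k)%N s sA => [|j IH] s /=.
  by rewrite inE => /eqP ->; apply/allP => a /mapP[i _ ->].
case/flatten_mapP => t /IH /allP tall /insertsP[i [n [ti ni ->]]].
have ai : ((nth (0, 0)%N t i).2 <= 1)%N by apply: tall; rewrite mem_nth.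
rewrite /insert_at all_cat /= (leq_trans ni ai) (leq_trans (leq_subr _ _) ai) /=.
apply/andP; split; apply/allP => a at_; apply: tall.
  exact: mem_take at_.
exact: mem_drop at_.
Qed.

End CountBounds.

(** * Theorems of the alternative *)

Section Alternatives.
Variable R : realFieldType.

(** By induction on the generators: if the functional c that separates v from
    the cone of the other generators is negative on the new generator f p,
    then everything is projected along f p onto the kernel of c, and a
    solution or a separating functional of the projected problem is lifted
    back. *)
Lemma farkas (I : eqType) N (s : seq I) (f : I -> 'rV[R]_N) (v : 'rV[R]_N) :
  uniq s ->
  (exists2 lam : I -> R, (forall i, 0 <= lam i) & v = \sum_(i <- s) lam i *: f i)
  \/ (exists2 c : 'cV[R]_N, (forall i, i \in s -> 0 <= (f i *m c) 0 0)
        & (v *m c) 0 0 < 0).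
Proof.
elim: s f v => [|p s IH] f v /=.
  move=> _; have [->|v0] := eqVneq v 0.
    by left; exists (fun=> 0) => //; rewrite big_nil.
  right; exists (- v^T) => //; rewrite mulmxN mxE oppr_lt0 mxE.
  have [i vi] : exists i, v 0 i != 0 by apply/rV0Pn.
  rewrite (bigD1 i) //= ltr_pwDl //; first by rewrite mxE -expr2 exprn_even_gt0.
  by apply: sumr_ge0 => j _; rewrite mxE -expr2 sqr_ge0.
case/andP => ps us.
have [[lam lam0 ->]|[c cs cv]] := IH f v us.
  left; exists (fun i => if i == p then 0 else lam i); first by move=> i; case: eqP.
  rewrite big_cons eqxx scale0r add0r; apply: eq_big_seq => i si.
  by case: eqP => // ip; rewrite -ip si in ps.
have [cp|cp] := leP 0 ((f p *m c) 0 0).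
  right; exists c => // i; rewrite inE => /predU1P[->//|]; exact: cs.
(* x - r x *: f p is the projection of x along f p to the kernel of c. *)
pose r (x : 'rV[R]_N) := (x *m c) 0 0 / (f p *m c) 0 0.
pose g i := f i - r (f i) *: f p.
have rv : 0 < r v by rewrite /r -mulrNN -invrN divr_gt0 ?oppr_gt0.
have rs i : i \in s -> 0 <= - r (f i).
  by move=> si; rewrite /r -mulrN -invrN divr_ge0 ?cs // oppr_ge0 ltW.
have [[lam lam0 E]|[c' cs' cv']] := IH g (v - r v *: f p) us.
  move: (r v) rv E => b b0 /(canRL (subrK _)) ->.
  left; exists (fun i => if i == p then b + \sum_(j <- s) lam j * - r (f j)
                         else lam i).
    move=> i; case: eqP => _ //; apply: addr_ge0; first exact: ltW.
    by rewrite big_seq; apply: sumr_ge0 => j js; rewrite mulr_ge0 ?rs.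
  rewrite big_cons eqxx scalerDl -addrA [RHS]addrC.
  congr (_ + _); rewrite scaler_suml -big_split /=.
  apply: eq_big_seq => i si; case: eqP => [ip|_]; first by rewrite -ip si in ps.
  by rewrite /g scalerBr mulrN scaleNr scalerA addrC.
pose c2 := c' - ((f p *m c') 0 0 / (f p *m c) 0 0) *: c.
have c2E x : (x *m c2) 0 0 = ((x - r x *: f p) *m c') 0 0.
  rewrite mulmxBr mulmxBl -scalemxAr -scalemxAl.
  have subE (A B : 'M[R]_1) : (A - B) 0 0 = A 0 0 - B 0 0 by rewrite !mxE.
  have sclE t (A : 'M[R]_1) : (t *: A) 0 0 = t * A 0 0 by rewrite mxE.
  by rewrite !subE !sclE /r; ring.
right; exists c2; last by rewrite c2E.
move=> i; rewrite inE c2E => /predU1P[->|/cs' //].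
by rewrite /r divff ?lt_eqF // scale1r subrr mul0mx mxE.
Qed.

(** Farkas' lemma for - a j0 and the cone generated by all a i and the - a i
    with i in J gives, for each j0 off J, a relation with nonnegative
    coefficients off J and a positive one at j0; the sum of these relations is
    positive off J. *)
Lemma gordan n N (a : 'I_n -> 'rV[R]_N) (J : {set 'I_n}) :
  (exists2 lam : 'I_n -> R, \sum_i lam i *: a i = 0
     & forall i, i \notin J -> 0 < lam i) \/
  (exists c : 'cV[R]_N, [/\ forall i, (a i *m c) 0 0 <= 0,
     forall i, i \in J -> (a i *m c) 0 0 = 0 & exists i, (a i *m c) 0 0 < 0]).
Proof.
pose f (x : 'I_n * bool) := if x.2 then (if x.1 \in J then - a x.1 else 0) else a x.1.
case: (pselect (exists j0, exists2 c : 'cV[R]_N,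
    (forall i, i \in enum {: 'I_n * bool} -> 0 <= (f i *m c) 0 0)
    & ((- a j0) *m c) 0 0 < 0)) => [[j0 [c cf cj]]|H].
  right; exists (- c).
  have ca i : 0 <= (a i *m c) 0 0 by have := cf (i, false) (mem_enum _ _).
  split.
  - by move=> i; rewrite mulmxN mxE oppr_le0.
  - move=> i iJ; rewrite mulmxN mxE; have := cf (i, true) (mem_enum _ _).
    rewrite /f /= iJ mulNmx mxE oppr_ge0 => h.
    by apply/eqP; rewrite oppr_eq0 eq_le h ca.
  - by exists j0; rewrite mulmxN -mulNmx.
left.
have {}H j0 : exists mu : 'I_n -> R,
    [/\ \sum_i mu i *: a i = 0, forall i, i \notin J -> 0 <= mu i & 0 < mu j0] \/
    j0 \in J.
  have [j0J|j0J] := boolP (j0 \in J); first by exists (fun=> 0); right.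
  have [[lam lam0 E]|C] := farkas f (- a j0) (enum_uniq {: 'I_n * bool}); last first.
    by case: H; exists j0.
  pose mu i := lam (i, false) - (if i \in J then lam (i, true) else 0) + (i == j0)%:R.
  exists mu; left; split.
  - rewrite /mu; under eq_bigr do rewrite scalerDl.
    rewrite big_split /=.
    have -> : \sum_i (i == j0)%:R *: a i = a j0.
      rewrite (bigD1 j0) //= eqxx scale1r big1 ?addr0 // => i /negbTE ->.
      by rewrite scale0r.
    rewrite -[X in _ + X]opprK E big_enum /=.
    rewrite (eq_bigr (fun p => lam (p.1, p.2) *: f (p.1, p.2))); last by case.
    rewrite -(pair_bigA _ (fun i b => lam (i, b) *: f (i, b))) /=.
    rewrite -sumrB big1 // => i _; rewrite big_bool /f /= scalerBl.
    by case: ifP => _; rewrite ?scalerN ?scale0r ?scaler0 ?subr0 ?add0r ?subrr // addrC subrr.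
  - by move=> i iJ; rewrite /mu (negbTE iJ) subr0 addr_ge0 ?ler0n.
  - by rewrite /mu (negbTE j0J) subr0 eqxx ltr_wpDl.
have [mu muP] := choice H.
exists (fun i => \sum_(j | j \notin J) mu j i).
  under eq_bigr do rewrite scaler_suml.
  rewrite exchange_big /= big1 // => j jJ.
  by have [[]|] := muP j; last by rewrite (negbTE jJ).
move=> i iJ; rewrite (bigD1 i) //= ltr_pwDl //.
  by have [[]|] := muP i; last by rewrite (negbTE iJ).
apply: sumr_ge0 => j /andP[jJ _].
by have [[_ /(_ i iJ)]|] := muP j; last by rewrite (negbTE jJ).
Qed.

End Alternatives.

(** * Points of a walk in general position *)

Section Walks.
Variables (R : realType) (m d : nat).
Implicit Types (x : 'M[R]_(m, d)) (y : nat -> R) (J : {set 'I_m.+1}).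

(** Numbered from 1, so that step i leads to point i. *)
Definition steps x (i : nat) : 'rV[R]_d :=
  if i is j.+1 then (if insub j is Some j' then row j' x else 0) else 0.

(** [generic] without the target vector; the codimension is d. *)
Definition in_general_position x : Prop :=
  forall (q : nat) (c : nat -> nat) (z : nat -> R),
    (q <= d)%N -> c 0%N = 0%N -> z 0%N = 0 ->
    (forall i, (i < m.+1)%N -> (c i <= q)%N) ->
    \sum_(i < m.+1) z (c i) *: steps x i = 0 ->
    forall i, (i < m.+1)%N -> z (c i) = 0.

Definition exposed x J : Prop :=
  exists (c : 'cV[R]_d) (b : R), forall i : 'I_m.+1,
    if i \in J then (walk x i *m c) 0 0 = b else (walk x i *m c) 0 0 < b.

Lemma walk0 x : walk x 0 = 0.
Proof. by rewrite /walk big_pred0. Qed.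

Lemma walkS x i : walk x i.+1 = walk x i + steps x i.+1.
Proof.
rewrite /walk /steps; case: insubP => [j _ ji|im].
  rewrite (bigD1 j) /= ?ji // addrC; congr (_ + _); apply: eq_bigl => l.
  by rewrite -(inj_eq val_inj) /= ji; lia.
rewrite addr0; apply: eq_bigl => l; have := ltn_ord l; lia.
Qed.

Lemma steps_row_perm (sg : 'S_m) x (i : 'I_m.+1) :
  steps (row_perm sg x) i = steps x (lift_perm ord0 ord0 sg i).
Proof.
case: (unliftP ord0 i) => [j ->|->]; last by rewrite lift_perm_id.
by rewrite lift_perm_lift !lift0 /= !valK; apply/rowP => l; rewrite !mxE.
Qed.

(** Summation by parts, which exchanges the coefficients of the points of the
    walk with those of its steps. *)
Lemma abel_walk x y n :
  \sum_(i < n) (y i - y i.+1) *: walk x i =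
  \sum_(i < n) y i *: steps x i - y n *: walk x n.-1.
Proof.
elim: n => [|n IH]; first by rewrite !big_ord0 walk0 scaler0 subrr.
rewrite !big_ord_recr /= IH scalerBl -!addrA; congr (_ + _).
rewrite addrA; congr (_ - _).
case: n {IH} => [|n]; first by rewrite !walk0 !scaler0 oppr0 addr0.
by rewrite /= walkS scalerDr addrA addNr add0r.
Qed.

Definition tail_sum (lam : 'I_m.+1 -> R) (i : nat) : R :=
  \sum_(j < m.+1 | (i <= j)%N) lam j.

Lemma tail_sumP (lam : 'I_m.+1 -> R) : tail_sum lam m.+1 = 0 /\
  forall i : 'I_m.+1, lam i = tail_sum lam i - tail_sum lam i.+1.
Proof.
split=> [|i]; first by rewrite /tail_sum big_pred0 // => j; rewrite leqNgt ltn_ord.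
rewrite /tail_sum (bigD1 i) //= addrC (eq_bigl (fun j : 'I__ => (i < j)%N)); last first.
  by move=> j; rewrite -(inj_eq val_inj) /=; lia.
by rewrite addrC addrK.
Qed.

(** The tail sums of a relation supported on F change only at elements of F
    and vanish at both ends, so cyclically they take at most #|F| values
    including 0. They are thus described by a colouring with #|F| - 1 <= d
    nonzero colours. *)
Lemma affine_independent x (lam : 'I_m.+1 -> R) : in_general_position x ->
  \sum_i lam i = 0 -> \sum_i lam i *: walk x i = 0 ->
  (#|[set i | lam i != 0%R]| <= d.+1)%N -> forall i, lam i = 0.
Proof.
move=> gp s0 sw Fd; have [ym lamE] := tail_sumP lam.
set y := tail_sum lam in ym lamE.
pose F := [set i | lam i != 0].
(* The colour of i is the number of elements of F before i, cyclically. *)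
pose cnt (i : nat) := #|[set j in F | (j < i)%N]|.
pose c i := if cnt i == #|F| then 0%N else cnt i.
pose z (r : nat) := \sum_(j in F | (r <= cnt j)%N) lam j.
have cntF j : j \in F -> (cnt j < #|F|)%N.
  move=> jF; apply/proper_card/properP; split.
    by apply/fintype.subsetP => l; rewrite inE => /andP[].
  by exists j => //; rewrite inE ltnn andbF.
have cnt_lt i j : j \in F -> (cnt i <= cnt j)%N = (i <= j)%N.
  move=> jF; case: leqP => ij; case: leqP => // cij.
    exfalso; move: ij; rewrite leqNgt => /negP; apply.
    apply/proper_card/properP; split.
      apply/fintype.subsetP => l; rewrite !inE => /andP[-> /=]; lia.
    by exists j => //; rewrite !inE in jF *; rewrite jF /= ?ltnn //; lia.
  exfalso; move: ij; rewrite ltnNge => /negP; apply.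
  apply/subset_leq_card/fintype.subsetP => l; rewrite !inE => /andP[-> /=]; lia.
have yz i : y i = z (cnt i).
  rewrite /y /tail_sum /z [LHS]big_mkcond [RHS]big_mkcond; apply: eq_bigr => j _.
  have [jF|jF] := boolP (j \in F); first by rewrite cnt_lt.
  by move: jF; rewrite inE negbK => /eqP ->; case: ifP.
have z0 : z 0%N = 0.
  rewrite -[RHS]s0 /z [LHS]big_mkcond; apply: eq_bigr => j _.
  by rewrite andbT inE; case: eqP => // ->.
have zF : z #|F| = 0.
  by rewrite /z big_pred0 // => j; case: (boolP (j \in F)) => // /cntF; rewrite ltnNge => /negbTE.
have yc i : y i = z (c i).
  by rewrite yz /c; case: eqP => // ->; rewrite zF z0.
have ysteps : \sum_(i < m.+1) y i *: steps x i = 0.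
  have := abel_walk x y m.+1; rewrite ym scale0r subr0 => <-.
  by rewrite -[RHS]sw; apply: eq_bigr => i _; rewrite -lamE.
have y0 i : (i < m.+1)%N -> y i = 0.
  move=> im; rewrite yc.
  apply: (gp #|F|.-1 c z) => //; first by rewrite -subn1 leq_subLR add1n.
  - rewrite /c; case: eqP => //; rewrite /cnt => _.
    by apply: eq_card0 => j; rewrite inE ltn0 andbF.
  - move=> j _; rewrite /c; case: eqP => // cF.
    have : (cnt j <= #|F|)%N.
      by apply/subset_leq_card/fintype.subsetP => l; rewrite inE => /andP[].
    lia.
  - by under eq_bigr do rewrite -yc.
move=> i; rewrite lamE y0 ?ltn_ord // sub0r.
have [im|im] := ltnP i.+1 m.+1; first by rewrite y0 ?oppr0.
by rewrite (_ : i.+1 = m.+1) ?ym ?oppr0 //; have := ltn_ord i; lia.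
Qed.

(** Points with a last coordinate 1, so that affine functionals become linear.
    *)
Definition lifted x (i : 'I_m.+1) : 'rV[R]_(d + 1) := row_mx (walk x i) 1%:M.

Lemma sum_lifted x (lam : 'I_m.+1 -> R) : \sum_i lam i *: lifted x i = 0 <->
  \sum_i lam i = 0 /\ \sum_i lam i *: walk x i = 0.
Proof.
have -> : \sum_i lam i *: lifted x i =
    row_mx (\sum_i lam i *: walk x i) (\sum_i lam i)%:M.
  transitivity (\sum_i row_mx (lam i *: walk x i) (lam i)%:M).
    by apply: eq_bigr => i _; rewrite scale_row_mx scale_scalar_mx mulr1.
  elim: (index_enum _) => [|i s IH].
    by rewrite !big_nil scalar_mx_is_semi_additive row_mx0.
  by rewrite !big_cons IH add_row_mx raddfD.
split=> [/eqP|[-> ->]]; last by rewrite raddf0 row_mx0.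
rewrite row_mx_eq0 => /andP[/eqP -> /eqP/rowP/(_ 0)].
by rewrite !mxE.
Qed.

End Walks.

(** * Hidden sets and feasible arrangements *)

Section Exposed.
Variables (R : realType) (m d : nat).
Implicit Types (x : 'M[R]_(m, d)) (y : nat -> R) (J F : {set 'I_m.+1}).

Lemma lifted_free x F : in_general_position x -> (#|F| <= d.+1)%N ->
  row_free (\matrix_(i < #|F|) lifted x (enum_val i)).
Proof.
move=> gp Fd; rewrite -kermx_eq0; apply/rowV0P => r /sub_kermxP.
rewrite mulmx_sum_row => E.
pose lam i := \sum_(l < #|F| | enum_val l == i) r 0 l.
have lamE l : lam (enum_val l) = r 0 l.
  by rewrite /lam (big_pred1 l) // => l'; rewrite (inj_eq enum_val_inj).
have lamF i : i \notin F -> lam i = 0.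
  by move=> iF; rewrite /lam big_pred0 // => l; apply: contraNF iF => /eqP <-; exact: enum_valP.
have : \sum_i lam i *: lifted x i = 0.
  rewrite (bigID (mem F)) /= [X in _ + X]big1 ?addr0; last first.
    by move=> i /lamF ->; rewrite scale0r.
  rewrite big_enum_val /= -[RHS]E; apply: eq_bigr => l _.
  by rewrite lamE rowK.
move=> /sum_lifted[s0 sw].
have lam0 := affine_independent gp s0 sw.
apply/rowP => l; rewrite mxE -lamE; apply: lam0.
apply: leq_trans Fd; apply/subset_leq_card/fintype.subsetP => i.
by rewrite inE; apply: contraR => /lamF ->.
Qed.

Lemma open_strict (I : eqType) (s : seq I) (u w : I -> R) :
  (forall i, i \in s -> u i < 0) ->
  exists2 e, 0 < e & forall i, i \in s -> u i + e * w i < 0.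
Proof.
elim: s => [|j s IH] H; first by exists 1.
have [|e e0 He] := IH; first by move=> i si; apply: H; rewrite inE si orbT.
have [f f0 Hf] := @lt_open R (u j) 0 (w j) 0 (H j (mem_head _ _)).
have g0 : 0 < Num.min e f by rewrite lt_min e0 f0.
exists (Num.min e f) => // i; rewrite inE => /predU1P[->|si].
  have := Hf (Num.min e f); rewrite mulr0 add0r; apply.
  by rewrite ltW //= ge_min lexx orbT.
have [wi|wi] := leP (w i) 0.
  apply: le_lt_trans (H i _); last by rewrite inE si orbT.
  by rewrite gerDl mulr_ge0_le0 // ltW.
apply: le_lt_trans (He i si); rewrite lerD2l ler_wpM2r ?(ltW wi) //.
by rewrite ge_min lexx.
Qed.

Lemma exposed_lifted x J : exposed x J <->
  exists c : 'cV[R]_(d + 1), forall i,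
    if i \in J then (lifted x i *m c) 0 0 = 0 else (lifted x i *m c) 0 0 < 0.
Proof.
have E c1 (c2 : 'cV[R]_1) i : (lifted x i *m col_mx c1 c2) 0 0 =
    (walk x i *m c1) 0 0 + c2 0 0.
  by rewrite /lifted mul_row_col mul1mx mxE.
split=> [[c [b H]]|[c H]].
  have bE : ((- b)%:M : 'M[R]_1) 0 0 = - b by rewrite mxE.
  exists (col_mx c (- b)%:M) => i; rewrite E bE; move: (H i).
  by case: ifP => _; [move=> ->; rewrite subrr | rewrite subr_lt0].
exists (usubmx c), (- dsubmx c 0 0) => i; move: (H i).
have -> : (lifted x i *m c) 0 0 = (walk x i *m usubmx c) 0 0 + dsubmx c 0 0.
  by rewrite -{1}[c]vsubmxK E.
case: ifP => _; first by move/eqP; rewrite addr_eq0 => /eqP.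
by rewrite -ltrBrDr sub0r.
Qed.

(** Otherwise Gordan's alternative provides a functional c that is zero on J,
    nowhere positive and somewhere negative. The points F on which it vanishes
    are affinely independent, so a functional c' with values 0 on J and - 1 on
    F minus J exists, and c + e c' exposes J for small e > 0. *)
Lemma not_exposed_relation x J : in_general_position x -> ~ exposed x J ->
  exists2 lam : 'I_m.+1 -> R, \sum_i lam i *: lifted x i = 0 &
    forall i, i \notin J -> 0 < lam i.
Proof.
move=> gp nE; have [//|[c [c_le cJ [i0 ci0]]]] := gordan (lifted x) J.
case: nE; apply/exposed_lifted.
pose F := [set i | (lifted x i *m c) 0 0 == 0].
have JF : J \subset F by apply/fintype.subsetP => i /cJ; rewrite inE => ->.
have Fd : (#|F| <= d)%N.
  rewrite leqNgt; apply/negP => dF.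
  have [G GF Gd] : exists2 G : {set 'I_m.+1}, G \subset F & #|G| = d.+1.
    have /card_gt0P[G] : (0 < #|[set G : {set 'I_m.+1} | G \subset F & #|G| == d.+1]|)%N.
      by rewrite cards_draws bin_gt0.
    by rewrite inE => /andP[GF /eqP Gd]; exists G.
  have Gfree : row_free (\matrix_(i < #|G|) lifted x (enum_val i)).
    by apply: lifted_free => //; rewrite Gd.
  have /row_fullP[B BE] : row_full (\matrix_(i < #|G|) lifted x (enum_val i)).
    by rewrite /row_full (eqP Gfree) Gd addn1.
  move: ci0; rewrite (_ : c = 0) ?mulmx0 ?mxE ?ltxx //.
  rewrite -[c]mul1mx -BE -mulmxA (_ : _ *m c = 0) ?mulmx0 //.
  apply/row_matrixP => i; rewrite row_mul rowK row0; apply/matrixP => a b.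
  rewrite !ord1 [RHS]mxE; apply/eqP.
  have := fintype.subsetP GF _ (enum_valP i); by rewrite inE.
have /row_freeP[B BE] := lifted_free gp (leqW Fd).
pose rhs : 'cV[R]_#|F| := \col_i (if enum_val i \in J then 0 else -1).
pose c' := B *m rhs.
have c'E i : i \in F -> (lifted x i *m c') 0 0 = if i \in J then 0 else -1.
  move=> iF.
  have <- : row (enum_rank_in iF i) (\matrix_(i < #|F|) lifted x (enum_val i)) = lifted x i.
    by rewrite rowK enum_rankK_in.
  by rewrite /c' -row_mul mulmxA BE mul1mx !mxE enum_rankK_in.
have [|e e0 He] := @open_strict _ (enum (~: F)) (fun i => (lifted x i *m c) 0 0)
    (fun i => (lifted x i *m c') 0 0).
  by move=> i; rewrite mem_enum !inE lt_def eq_sym => -> /=.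
exists (c + e *: c') => i.
have -> : (lifted x i *m (c + e *: c')) 0 0 =
    (lifted x i *m c) 0 0 + e * (lifted x i *m c') 0 0.
  by rewrite mulmxDr -scalemxAr mxE [X in _ + X]mxE.
case: ifP => iJ.
  by rewrite c'E ?(fintype.subsetP JF) // iJ mulr0 addr0 cJ.
have [iF|iF] := boolP (i \in F); last by apply: He; rewrite mem_enum inE.
by rewrite c'E // iJ; move: iF; rewrite inE => /eqP ->; rewrite add0r mulrN1 oppr_lt0.
Qed.

(** An exposing functional applied to the relation gives a sum of negative
    terms. *)
Lemma relation_not_exposed x J (lam : 'I_m.+1 -> R) :
  J != [set: 'I_m.+1] -> \sum_i lam i *: lifted x i = 0 ->
  (forall i, i \notin J -> 0 < lam i) -> ~ exposed x J.
Proof.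
move=> JT E lam0 /exposed_lifted[c H].
have [i0 i0J] : exists i0, i0 \notin J.
  apply/existsP; apply: contraR JT; rewrite negb_exists => /forallP JT.
  by apply/eqP/setP => i; rewrite inE; apply/negbNE.
have : (\sum_i lam i *: lifted x i *m c) 0 0 = 0.
  by rewrite -mulmx_suml E mul0mx mxE.
rewrite summxE (bigD1 i0) //= -scalemxAl mxE.
apply/eqP; rewrite lt_eqF // -[ltRHS]addr0 ltr_leD //.
  by rewrite pmulr_rlt0 ?lam0 //; have := H i0; rewrite (negbTE i0J).
apply: sumr_le0 => i _; rewrite -scalemxAl mxE; have := H i.
case: ifPn => iJ; first by move=> ->; rewrite mulr0.
by move=> h; rewrite ltW // pmulr_rlt0 // lam0.
Qed.

Lemma cycle_enum n (T : Type) (e : rel T) (f : 'I_n.+1 -> T) :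
  cycle e [seq f i | i <- enum 'I_n.+1] <-> forall i, e (f i) (f (ordS i)).
Proof.
set s := map _ _; have ss : size s = n.+1 by rewrite size_map size_enum_ord.
have sE (i : 'I_n.+1) : nth (f ord0) s i = f i.
  by rewrite (nth_map ord0) ?size_enum_ord // nth_ord_enum.
have -> : cycle e s = path e (nth (f ord0) s 0) (rcons (behead s) (nth (f ord0) s 0)).
  by case: (s) ss.
have s0 : nth (f ord0) s 0 = f ord0 by rewrite (sE ord0).
have sbe : size (behead s) = n by rewrite size_behead ss.
have nthE (i : 'I_n.+1) : nth (f ord0) (rcons (behead s) (f ord0)) i = f (ordS i).
  rewrite nth_rcons sbe nth_behead; case: ltngtP => ni.
  - have h : (i.+1 < n.+1)%N by [].
    rewrite (sE (Ordinal h)); congr f; apply: val_inj; by rewrite /= modn_small.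
  - by have := ltn_ord i; lia.
  - by congr f; apply: val_inj; rewrite /= ni modnn.
have nthE' (i : 'I_n.+1) : nth (f ord0) (f ord0 :: rcons (behead s) (f ord0)) i = f i.
  rewrite -(sE i); case: i => [[|i] hi] /=; first by rewrite s0.
  have hi' : (i < n)%N by []. 
  by rewrite nth_rcons sbe nth_behead hi'.
rewrite s0; split=> [/(pathP (f ord0)) H i|H].
  by have := H i; rewrite nthE nthE' size_rcons sbe; apply.
apply/(pathP (f ord0)) => i; rewrite size_rcons sbe => hi.
by have := H (Ordinal hi); rewrite -nthE -[f (Ordinal _)]nthE'.
Qed.

(** The bijection between relations and their tail sums, where y has to be
    read at the vertex visited by the permuted walk. *)
Lemma feasible_relation x (sg : 'S_m) J :
  feasible (steps x) 0 m.+1 (marked_walk sg J) <->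
  exists2 lam : 'I_m.+1 -> R,
    \sum_i lam i *: lifted (row_perm sg x) i = 0 &
    forall i, i \notin J -> 0 < lam i.
Proof.
set pi := lift_perm ord0 ord0 sg.
have pi0 : pi ord0 = ord0 by rewrite /pi lift_perm_id.
have desc y : cycle (descends y) (marked_walk sg J) <->
    forall i, i \notin J -> y (pi (ordS i)) < y (pi i).
  rewrite /marked_walk cycle_enum; split=> H i.
    by move=> /negbTE iJ; have := H i; rewrite /descends /= iJ.
  by rewrite /descends /=; have := H i; case: (i \in J) => //= ->.
have stepsE y y' : (forall i : 'I_m.+1, y' i = y (pi i)) ->
    \sum_(i < m.+1) y' i *: steps (row_perm sg x) i =
    \sum_(i < m.+1) y i *: steps x i.
  move=> yy'; rewrite [RHS](reindex_inj (@perm_inj _ pi)) /=.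
  by apply: eq_bigr => i _; rewrite yy' steps_row_perm.
split=> [[y [y0 Ey] /desc Cy]|[lam /sum_lifted[s0 sw] lam0]].
  pose y' i := if insub i is Some i' then y (pi i') else 0.
  have y'E (i : 'I_m.+1) : y' i = y (pi i) by rewrite /y' valK.
  have y'm : y' m.+1 = 0 by rewrite /y' insubF ?ltnn.
  have y'0 : y' 0%N = 0 by rewrite (y'E ord0) pi0.
  have y'S (i : 'I_m.+1) : y' i.+1 = y (pi (ordS i)).
    have [im|im] := ltnP i.+1 m.+1.
      rewrite (y'E (Ordinal im)); congr (y (pi _)); apply: val_inj.
      by rewrite /= modn_small.
    have -> : ordS i = ord0.
      by apply: val_inj; rewrite /= (_ : i.+1 = m.+1) ?modnn //; have := ltn_ord i; lia.
    by rewrite pi0 y0 (_ : i.+1 = m.+1) //; have := ltn_ord i; lia.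
  exists (fun i : 'I_m.+1 => y' i - y' i.+1).
    apply/sum_lifted; split.
      rewrite -(big_mkord xpredT (fun i => y' i - y' i.+1)).
      under eq_bigr do rewrite -opprB.
      by rewrite sumrN telescope_sumr // y'm y'0 subrr oppr0.
    rewrite abel_walk y'm scale0r subr0 -[RHS]Ey; apply: stepsE => i; exact: y'E.
  by move=> i iJ; rewrite y'E y'S subr_gt0 Cy.
have [ym lamE] := tail_sumP lam; set y' := tail_sum lam in ym lamE.
have y'0 : y' 0%N = 0 by rewrite -[RHS]s0; apply: eq_bigl.
pose y i := if insub i is Some i' then y' (pi^-1 i')%g else 0.
have yE (i : 'I_m.+1) : y (pi i) = y' i by rewrite /y valK permK.
exists y.
  split; first by have := yE ord0; rewrite pi0 => ->.
  rewrite -(stepsE y y') => [|i]; last by rewrite yE.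
  have := abel_walk (row_perm sg x) y' m.+1; rewrite ym scale0r subr0 => <-.
  by rewrite -[RHS]sw; apply: eq_bigr => i _; rewrite -lamE.
apply/desc => i iJ; rewrite !yE -subr_gt0.
have -> : y' (ordS i) = y' i.+1.
  have [im|im] := ltnP i.+1 m.+1; first by rewrite /= modn_small.
  have -> : i.+1 = m.+1 by have := ltn_ord i; lia.
  rewrite ym -y'0; congr y'.
  by rewrite /= (_ : i.+1 = m.+1) ?modnn //; have := ltn_ord i; lia.
by rewrite -lamE lam0.
Qed.

End Exposed.

(** * From a linear to an affine system *)

Section Lift.
Variables (R : realType) (m d : nat).
Implicit Types (x : 'M[R]_(m, d)) (y : nat -> R) (J F : {set 'I_m.+1}).

Lemma general_position_row_perm x (sg : 'S_m) :
  in_general_position x -> in_general_position (row_perm sg x).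
Proof.
move=> gp q c z qd c0 z0 cq E.
pose pi := lift_perm ord0 ord0 sg.
pose c' i := if insub i is Some i' then c ((pi^-1)%g i') else 0%N.
have c'E (i : 'I_m.+1) : c' (pi i) = c i by rewrite /c' valK permK.
move=> i im; rewrite -[i]/(val (Ordinal im)) -c'E.
apply: (gp q c' z) => //.
- by have := c'E ord0; rewrite /pi lift_perm_id => ->.
- by move=> j jm; rewrite /c' insubT cq.
rewrite (reindex_inj (@perm_inj _ pi)) /= -[RHS]E.
by apply: eq_bigr => j _; rewrite c'E steps_row_perm.
Qed.

Lemma common_nonroot (I : finType) (p : I -> {poly R}) :
  (forall i, p i != 0) -> exists t, forall i, (p i).[t] != 0.
Proof.
move=> p0; pose P := \prod_i p i.
have P0 : P != 0 by apply/prodf_neq0 => i _.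
suff [t Pt] : exists t, ~~ root P t.
  exists t => i; apply: contra Pt => pit; rewrite /P (bigD1 i) //= rootM.
  by rewrite /root pit.
apply: contrapT => H.
have := @max_poly_roots _ P [seq i%:R | i <- iota 0 (size P)] P0.
rewrite size_map size_iota ltnn => h; suff: false by []; apply: h.
  by apply/allP => t _; apply: contrapT => nt; apply: H; exists t; apply/negP.
rewrite map_inj_uniq ?iota_uniq // => i j /eqP; rewrite eqr_nat => /eqP //.
Qed.

(** The value of the additional coordinate sum_i y_i t ^ i, as a polynomial in
    t. It is nonzero unless y is, so finitely many y can be avoided by one t.
    *)
Definition moment y : {poly R} := \poly_(i < m.+1) y i.

Lemma momentE y t : (moment y).[t] = \sum_(i < m.+1) y i * t ^+ i.
Proof. by rewrite horner_poly. Qed.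

Lemma moment_eq0 y : moment y = 0 -> forall i, (i < m.+1)%N -> y i = 0.
Proof.
move=> H i im; have := congr1 (fun p : {poly R} => p`_i) H.
by rewrite coef_poly im coef0.
Qed.

Definition relation x y := \sum_(i < m.+1) y i *: steps x i = 0.

(** Relations that follow one colouring with d + 1 nonzero colours are unique
    up to a factor: a combination that kills one colour has only d colours
    left, and then vanishes by general position. *)
Lemma proportional x (c : nat -> nat) (z z' : nat -> R) :
  in_general_position x -> c 0%N = 0%N -> z 0%N = 0 -> z' 0%N = 0 ->
  (forall i, (i < m.+1)%N -> (c i <= d.+1)%N) ->
  relation x (z \o c) -> relation x (z' \o c) ->
  forall i0, (i0 < m.+1)%N -> z' (c i0) != 0 ->
  forall i, (i < m.+1)%N -> z (c i) = z (c i0) / z' (c i0) * z' (c i).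
Proof.
move=> gp c0 z0 z'0 cd rz rz' i0 i0m nz i im.
set al := _ / _; set r := c i0 in al nz *.
pose w j := z j - al * z' j.
have wr : w r = 0 by rewrite /w /al divfK ?subrr.
have r0 : r <> 0%N by move=> r0; rewrite r0 z'0 eqxx in nz.
(* The colour r is killed; the colour d + 1 takes its place. *)
pose c' j := if c j == r then 0%N else if c j == d.+1 then r else c j.
pose w' j := if j == r then w d.+1 else if j == 0%N then 0 else w j.
have w'c' j : w' (c' j) = w (c j).
  rewrite /c' /w'; case: (eqVneq (c j) r) => [->|cr].
    by case: eqP => [/esym//|_]; rewrite wr.
  case: (eqVneq (c j) d.+1) => [->|cd1]; first by rewrite eqxx.
  rewrite (negbTE cr); case: eqP => // ->; by rewrite /w z0 z'0 mulr0 subrr.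
apply/eqP; rewrite -subr_eq0 -/(w (c i)) -w'c'; apply/eqP.
have c'0 : c' 0%N = 0%N.
  by rewrite /c' c0; case: eqP => //.
apply: (gp d c' w') => //.
- by rewrite /w'; case: eqP => [/esym//|].
- move=> j jm; have := cd _ jm; have := cd _ i0m; rewrite -/r /c'.
  case: eqP => // cr; case: eqP => // cd1; lia.
under eq_bigr do rewrite w'c' scalerBl -scalerA.
by rewrite sumrB -scaler_sumr rz' rz scaler0 subrr.
Qed.

Definition lifted_step x t (i : nat) : 'rV[R]_(d + 1) :=
  row_mx (steps x i) (t ^+ i)%:M.

Lemma sum_lifted_step x t y p : \sum_(i < p) y i *: lifted_step x t i =
  row_mx (\sum_(i < p) y i *: steps x i) (\sum_(i < p) y i * t ^+ i)%:M.
Proof.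
elim: p => [|p IH]; first by rewrite !big_ord0 raddf0 row_mx0.
by rewrite !big_ord_recr /= IH scale_row_mx scale_scalar_mx add_row_mx raddfD.
Qed.

Definition height (e : R) : 'rV[R]_(d + 1) := row_mx 0 e%:M.

Lemma solves_lifted x t e y : solves (lifted_step x t) (height e) m.+1 y <->
  [/\ y 0%N = 0, relation x y & (moment y).[t] = e].
Proof.
rewrite /solves sum_lifted_step /height momentE; split=> [[y0 /eq_row_mx[E1 E2]]|[-> -> ->]] //.
by split=> //; have := congr1 (fun A : 'M[R]_1 => A 0 0) E2; rewrite /= !mxE !eqxx !mulr1n.
Qed.

(** The only relations that the additional coordinate has to destroy are those
    with exactly d + 1 nonzero colours. By [proportional] it suffices to
    destroy one for each of the finitely many colourings. *)
Lemma generic_lift x t : in_general_position x ->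
  (forall g : {ffun 'I_m.+1 -> 'I_d.+2},
     (exists z : nat -> R, [/\ z 0%N = 0, relation x (fun i => z (g (inord i))) &
       exists i : 'I_m.+1, z (g i) != 0]) ->
     exists z : nat -> R, [/\ z 0%N = 0, relation x (fun i => z (g (inord i))),
       (exists i : 'I_m.+1, z (g i) != 0) &
       (moment (fun i => z (g (inord i)))).[t] != 0]) ->
  forall e, e != 0 -> generic (lifted_step x t) (height e) m.+1.
Proof.
move=> gp Ht e e0 q c z b qb c0 z0 cq.
rewrite (sum_lifted_step _ _ (fun i => z (c i))).
have -> : b%:R *: height e = height (b%:R * e).
  by rewrite /height scale_row_mx scaler0 scale_scalar_mx.
move=> /eq_row_mx[E1 E2].
have {}E2 : \sum_(i < m.+1) z (c i) * t ^+ i = b%:R * e.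
  by have := congr1 (fun A : 'M[R]_1 => A 0 0) E2; rewrite /= !mxE !eqxx !mulr1n.
have [qd|qd] := leqP q d.
  have zc := gp q c z qd c0 z0 cq E1; split=> //.
  move: E2; rewrite big1 => [|i _]; last by rewrite zc ?mul0r.
  by case: b {qb} => // /eqP; rewrite mul1r eq_sym (negbTE e0).
have [b0 q1] : b = false /\ q = d.+1 by case: b qb {E2} => /=; split; lia.
split=> //; subst b q; rewrite mul0r in E2; clear qb.
pose g : {ffun 'I_m.+1 -> 'I_d.+2} := [ffun i => inord (c (val i))].
have gE i : (i < m.+1)%N -> g (inord i) = c i :> nat.
  by move=> im; rewrite ffunE /= inordK inordK // ltnS cq.
apply: contrapT => nz.
have [i0 i0m zi0] : exists2 i0, (i0 < m.+1)%N & z (c i0) != 0.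
  apply: contrapT => H; apply: nz => i im; apply/eqP; apply: contrapT => zi.
  by apply: H; exists i => //; apply/negP.
have [|z' [z'0 rz' [i1 z'i1] mz']] := Ht g.
  exists z; split=> //.
    by rewrite /relation -[RHS]E1; apply: eq_bigr => i _; rewrite gE.
  by exists (inord i0) => //; rewrite gE.
have i1E : val (g i1) = c i1 by rewrite -gE // inord_val.
rewrite i1E in z'i1.
have rz'c : relation x (z' \o c).
  by rewrite /relation -[RHS]rz'; apply: eq_bigr => i _ /=; rewrite gE.
have P := proportional gp c0 z0 z'0 cq E1 rz'c (ltn_ord i1) z'i1.
have : z (c i1) / z' (c i1) * (moment (fun i => z' (g (inord i)))).[t] = 0.
  rewrite momentE mulr_sumr -[RHS]E2; apply: eq_bigr => i _.
  by rewrite gE // mulrA -P.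
move/eqP; rewrite mulf_eq0 (negbTE mz') orbF => /eqP al0.
by move: zi0; rewrite P // al0 mul0r eqxx.
Qed.

(** The parameter t is chosen off the roots of finitely many polynomials: the
    moments of one relation for each colouring, to keep general position, and
    of one solution for each feasible arrangement. A solution y of the linear
    system with nonzero moment is rescaled to moment 1 or - 1 by a positive
    factor. *)
Lemma exists_lift x : in_general_position x ->
  exists (xi : nat -> 'rV[R]_(d + 1)) (v w : 'rV[R]_(d + 1)),
  [/\ generic xi v m.+1, generic xi w m.+1,
   forall s, feasible xi v m.+1 s -> feasible (steps x) 0 m.+1 s &
   forall (sg : 'S_m) J, J != [set: 'I_m.+1] ->
     feasible (steps x) 0 m.+1 (marked_walk sg J) ->
     feasible xi v m.+1 (marked_walk sg J) \/
     feasible xi w m.+1 (marked_walk sg J)].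
Proof.
move=> gp.
pose Q (a : ('S_m * {set 'I_m.+1}) + {ffun 'I_m.+1 -> 'I_d.+2}) y :=
  match a with
  | inl (sg, J) => [/\ J != [set: 'I_m.+1], solves (steps x) 0 m.+1 y &
      cycle (descends y) (marked_walk sg J)]
  | inr g => exists z : nat -> R, [/\ z 0%N = 0,
      relation x (fun i => z (g (inord i))), (exists i : 'I_m.+1, z (g i) != 0) &
      y = (fun i => z (g (inord i)))]
  end.
have Qnz a y : Q a y -> moment y != 0.
  case: a => [[sg J] [JT [y0 Sy] Cy]|g [z [z0 rz [i zi] ->]]] /=.
    apply/eqP => /moment_eq0 y_0.
    have [i iJ] : exists i, i \notin J.
      apply/existsP; apply: contraR JT; rewrite negb_exists => /forallP JT.
      by apply/eqP/setP => i; rewrite inE; apply/negbNE.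
    move: Cy; rewrite /marked_walk => /cycle_enum/(_ i).
    by rewrite /descends /= (negbTE iJ) /= !y_0 // ltxx.
  apply/eqP => /moment_eq0/(_ i (ltn_ord i)); rewrite inord_val => zi0.
  by rewrite zi0 eqxx in zi.
have /choice[p pP] : forall a, exists p : {poly R}, p != 0 /\
    ((exists y, Q a y) -> exists2 y, Q a y & p = moment y).
  move=> a; case: (pselect (exists y, Q a y)) => [[y Qy]|nQ].
    by exists (moment y); split; [exact: Qnz Qy|exists y].
  by exists 1; rewrite oner_neq0.
have [t tP] := common_nonroot (fun a => (pP a).1).
have neg1 : -1 != 0 :> R by rewrite oppr_eq0 oner_neq0.
have gen e : e != 0 -> generic (lifted_step x t) (height e) m.+1.
  apply: generic_lift => // g [z [z0 rz [i zi]]].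
  have [_ [|y [z' [z'0 rz' nz' yE]] pE]] := pP (inr g).
    by exists (fun i => z (g (inord i))), z; split=> //; exists i.
  by exists z'; split=> //; rewrite -yE -pE.
exists (lifted_step x t), (height 1), (height (-1)); split.
- by apply: gen; exact: oner_neq0.
- exact: gen.
- by move=> s [y /solves_lifted[y0 ry _] Cy]; exists y.
move=> sg J JT [y Sy Cy].
have [_ [|{Sy Cy}y [_ Sy Cy] pE]] := pP (inl (sg, J)); first by exists y.
have := tP (inl (sg, J)); rewrite pE => nz.
pose sc (b : R) i := b / (moment y).[t] * y i.
have scM b : (moment (sc b)).[t] = b.
  rewrite momentE; under eq_bigr do rewrite /sc -mulrA.
  by rewrite -mulr_sumr -momentE divfK.
have scR b : relation x (sc b).
  rewrite /relation; under eq_bigr do rewrite /sc -scalerA.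
  by rewrite -scaler_sumr Sy.2 scaler0.
have scS b : solves (lifted_step x t) (height b) m.+1 (sc b).
  by apply/solves_lifted; split=> //; rewrite /sc Sy.1 mulr0.
have scC b : 0 < b / (moment y).[t] -> cycle (descends (sc b)) (marked_walk sg J).
  move=> b0; rewrite /marked_walk; apply/cycle_enum => i.
  move: Cy; rewrite /marked_walk => /cycle_enum/(_ i); rewrite /descends /sc.
  by case: eqP => //= _; rewrite ltr_pM2l.
case: (ltgtP (moment y).[t] 0) => h.
- right; exists (sc (-1)) => //; apply: scC.
  by rewrite -mulrNN -invrN opprK divr_gt0 ?oppr_gt0.
- by left; exists (sc 1) => //; apply: scC; rewrite divr_gt0.
- by rewrite h eqxx in nz.
Qed.

Definition hidden_total (k : nat) x : nat :=
  \sum_(sg : 'S_m) \sum_(J : {set 'I_m.+1} | #|J| == k)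
    `[< ~ exposed (row_perm sg x) J >].

Theorem hidden_total_bounds k x : (0 < k <= m)%N -> in_general_position x ->
  (feasible_count k k (m.+1 - k) d.+1 <= hidden_total k x
     <= 2 * feasible_count k 1 m d.+1)%N.
Proof.
move=> /andP[k0 km] gp.
have [xi [v [w [gv gw fv fw]]]] := exists_lift gp.
have JT J : #|J| == k -> J != [set: 'I_m.+1].
  move=> /eqP Jk; apply/eqP => E; move: Jk; rewrite E cardsT card_ord; lia.
have -> : hidden_total k x = feasible_total m k (steps x) 0.
  apply: eq_bigr => sg _; apply: eq_bigr => J Jk; congr nat_of_bool.
  apply: asbool_equiv_eq; rewrite feasible_relation.
  split=> [nE|[lam E lam0]]; last exact: relation_not_exposed (JT _ Jk) E lam0.
  by apply: not_exposed_relation => //; exact: general_position_row_perm.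
apply/andP; split.
  rewrite -[X in feasible_count _ _ _ X]addn1.
  apply: leq_trans (feasible_total_lower (k := k) _ gv) _; first by rewrite k0 leqW.
  apply: leq_sum => sg _; apply: leq_sum => J Jk.
  by case: asboolP => // F; rewrite asboolT //; exact: fv.
rewrite -[X in feasible_count _ _ _ X]addn1 mul2n -addnn.
apply: (@leq_trans (feasible_total m k xi v + feasible_total m k xi w)).
  rewrite /feasible_total -big_split; apply: leq_sum => sg _.
  rewrite -big_split; apply: leq_sum => J Jk /=.
  case: asboolP => // F; have [Fv|Fw] := fw sg J (JT _ Jk) F.
    by rewrite asboolT.
  by rewrite [X in (_ <= _ + nat_of_bool X)%N]asboolT ?leq_addl.
by apply: leq_add; apply: feasible_total_upper.
Qed.

End Lift.

(** * Faces of the convex hull *)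

Section Faces.
Variables (R : realType) (m d : nat).
Implicit Types (x : 'M[R]_(m, d)) (v : 'rV[R]_d) (J F : {set 'I_m.+1}).
Local Open Scope classical_set_scope.

Lemma convex_set_segment (A : set 'rV[R]_d) :
  (forall v w t, 0 <= t <= 1 -> A v -> A w -> A (t *: v + (1 - t) *: w)) ->
  convex_set A.
Proof.
move=> H v w t; rewrite !inE => vA wA; apply: (H v w t%:inum) => //.
by apply/andP; split.
Qed.

Lemma walk_in_hull x (i : 'I_m.+1) : walk_hull x (walk x i).
Proof. by apply: sub_gen_smallest; exists i => //=; rewrite -ltnS. Qed.

Lemma hull_halfspace x (c : 'cV[R]_d) (b : R) :
  (forall i : 'I_m.+1, (walk x i *m c) 0 0 <= b) ->
  forall v, walk_hull x v -> (v *m c) 0 0 <= b.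
Proof.
move=> H; apply: smallest_sub; last first.
  by move=> _ [i /= im <-]; exact: (H (Ordinal (im : (i < m.+1)%N))).
apply: convex_set_segment => v w t /andP[t0 t1] /= vb wb.
rewrite mulmxDl -!scalemxAl mxE [X in X + _]mxE [X in _ + X]mxE.
have -> : b = t * b + (1 - t) * b by rewrite -mulrDl addrC subrK mul1r.
by rewrite lerD // ler_wpM2l // subr_ge0.
Qed.

Lemma hull_combination x v : walk_hull x v -> exists lam : 'I_m.+1 -> R,
  [/\ forall i, 0 <= lam i, \sum_i lam i = 1 & v = \sum_i lam i *: walk x i].
Proof.
move: v; apply: smallest_sub.
  apply: convex_set_segment => v w t /andP[t0 t1] [lam [l0 l1 ->]] [mu [m0 m1 ->]].
  exists (fun i => t * lam i + (1 - t) * mu i); split.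
  - by move=> i; rewrite addr_ge0 // mulr_ge0 // subr_ge0.
  - by rewrite big_split /= -!mulr_sumr l1 m1 !mulr1 addrC subrK.
  - under [RHS]eq_bigr do rewrite scalerDl -!scalerA.
    by rewrite big_split /= -!scaler_sumr.
move=> _ [i /= im <-]; pose i' := Ordinal (im : (i < m.+1)%N).
exists (fun j => (j == i')%:R); split.
- by move=> j; rewrite ler0n.
- by rewrite (bigD1 i') //= eqxx big1 ?addr0 // => j /negbTE ->.
- by rewrite (bigD1 i') //= eqxx scale1r big1 ?addr0 // => j /negbTE ->; rewrite scale0r.
Qed.

(** The part of the hull in the affine span of the points with index in J. For
    an exposed J this is the face that J exposes, without reference to the
    functional. *)
Definition face_of x J : set 'rV[R]_d := [set v | walk_hull x v /\
  exists lam : 'I_m.+1 -> R, [/\ forall i, i \notin J -> lam i = 0,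
    \sum_i lam i = 1 & v = \sum_i lam i *: walk x i]].

Lemma dot_sum x (c : 'cV[R]_d) (lam : 'I_m.+1 -> R) :
  ((\sum_i lam i *: walk x i) *m c) 0 0 = \sum_i lam i * (walk x i *m c) 0 0.
Proof.
by rewrite mulmx_suml summxE; apply: eq_bigr => i _; rewrite -scalemxAl mxE.
Qed.

Lemma face_ofE x J (c : 'cV[R]_d) (b : R) :
  (forall i, if i \in J then (walk x i *m c) 0 0 = b else (walk x i *m c) 0 0 < b) ->
  face_of x J = [set v | walk_hull x v /\ (v *m c) 0 0 = b].
Proof.
move=> H; apply/seteqP; split=> v [Cv].
  move=> [lam [l0 l1 vE]]; split=> //; rewrite vE.
  rewrite dot_sum -[RHS]mul1r -l1 mulr_suml; apply: eq_bigr => i _.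
  by have := H i; case: ifPn => [_ -> //|/l0 ->]; rewrite !mul0r.
move=> vb; split=> //; have [lam [l0 l1 E]] := hull_combination Cv.
exists lam; split=> // i iJ; have := H i; rewrite (negbTE iJ) => ib.
have : \sum_j lam j * (b - (walk x j *m c) 0 0) = 0.
  under eq_bigr do rewrite mulrBr.
  by rewrite sumrB -mulr_suml l1 mul1r -dot_sum -E vb subrr.
have ge0 j : 0 <= lam j * (b - (walk x j *m c) 0 0).
  rewrite mulr_ge0 // subr_ge0.
  by have := H j; case: ifP => _; [move=> -> | move/ltW].
move/(psumr_eq0P (fun j _ => ge0 j))/(_ i isT)/eqP.
by rewrite mulf_eq0 subr_eq0 (gt_eqF ib) orbF => /eqP.
Qed.

Lemma face_of_walk x J (i : 'I_m.+1) : exposed x J -> face_of x J (walk x i) <-> i \in J.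
Proof.
move=> [c [b H]]; rewrite (face_ofE H) /=; split=> [[_]|iJ].
  by have := H i; case: ifP => // _ h E; rewrite E ltxx in h.
by split; [exact: walk_in_hull|have := H i; rewrite iJ].
Qed.

Lemma is_faceP x (G : set 'rV[R]_d) :
  is_face (walk_hull x) G <-> exists2 J, exposed x J & G = face_of x J.
Proof.
split=> [[c [b [Cb ->]]]|[J [c [b H]] ->]].
  pose J := finset (fun i : 'I_m.+1 => (walk x i *m c) 0 0 == b).
  have H i : if i \in J then (walk x i *m c) 0 0 = b else (walk x i *m c) 0 0 < b.
    rewrite inE; case: eqP => // /eqP nb.
    by rewrite lt_neqAle nb Cb //; exact: walk_in_hull.
  by exists J; [exists c, b|rewrite (face_ofE H)].
exists c, b; split; last exact: face_ofE.
apply: hull_halfspace => i; have := H i.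
by case: ifP => _; [move=> -> | move/ltW].
Qed.

(** The row space is the linear span of the lifted points with index in J, so
    its rank is the affine dimension plus one. *)
Definition span_lifted x J : 'M[R]_(m.+1, d + 1) :=
  \matrix_(i < m.+1) (if i \in J then lifted x i else 0).

Lemma combination_lifted x J v :
  (exists lam : 'I_m.+1 -> R, [/\ forall i, i \notin J -> lam i = 0,
    \sum_i lam i = 1 & v = \sum_i lam i *: walk x i]) ->
  (row_mx v 1%:M <= span_lifted x J)%MS.
Proof.
move=> [lam [l0 l1 ->]].
have -> : row_mx (\sum_i lam i *: walk x i) 1%:M = \sum_i lam i *: lifted x i.
  rewrite -[RHS]/(\sum_(i < m.+1) _) -l1.
  elim: (index_enum _) => [|i s IH]; first by rewrite !big_nil raddf0 row_mx0.
  rewrite !big_cons -IH /lifted scale_row_mx add_row_mx scale_scalar_mx mulr1.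
  by rewrite raddfD.
apply: summx_sub => i _; have [iJ|iJ] := boolP (i \in J); last first.
  by rewrite l0 // scale0r sub0mx.
apply: scalemx_sub; have := row_sub i (span_lifted x J).
by rewrite rowK iJ.
Qed.

(** If x0 + V is the affine hull of the face, then the lifted points span the
    lift of x0 together with V. *)
Lemma has_dim_rank x J l : exposed x J -> has_dim (face_of x J) l ->
  \rank (span_lifted x J) = l.+1.
Proof.
move=> eJ [x0 [V [<- aff]]]; set L := span_lifted x J.
have affL : affine_hull (face_of x J) `<=` [set v | (row_mx v 1%:M <= L)%MS].
  apply: smallest_sub => [v w t /= vL wL|v [_ /combination_lifted]] //.
  have -> : row_mx (t *: v + (1 - t) *: w) 1%:M =
      t *: row_mx v (1%:M : 'M[R]_1) + (1 - t) *: row_mx w 1%:M.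
    rewrite !scale_row_mx add_row_mx; congr row_mx.
    by rewrite -scalerDl addrC subrK scale1r.
  by rewrite addmx_sub ?scalemx_sub.
have inL v : v \in V -> (row_mx (x0 + v) 1%:M <= L)%MS.
  by move=> vV; apply: affL; rewrite aff; exists v.
have x0L : (row_mx x0 1%:M <= L)%MS by have := inL 0 (mem0v _); rewrite addr0.
have inL0 v : v \in V -> (row_mx v (0 : 'M[R]_1) <= L)%MS.
  move=> /inL h; have -> : row_mx v 0 = row_mx (x0 + v) 1%:M - row_mx x0 (1%:M : 'M[R]_1).
    by rewrite opp_row_mx add_row_mx addrC addKr subrr.
  by rewrite addmx_sub // eqmx_opp.
pose B : 'M[R]_(\dim V, d) := \matrix_i (vbasis V)`_i.
have BV (i : 'I_(\dim V)) : (vbasis V)`_i \in V.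
  by apply: vbasis_mem; rewrite mem_nth // size_tuple.
pose K := col_mx (row_mx B 0) (row_mx x0 (1%:M : 'M[R]_1)).
have KL : (K == L)%MS.
  apply/andP; split.
    rewrite col_mx_sub x0L andbT; apply/row_subP => i.
    by rewrite row_row_mx rowK row0; apply: inL0.
  apply/row_subP => i; rewrite rowK; case: ifP => [iJ|_]; last exact: sub0mx.
  have : affine_hull (face_of x J) (walk x i).
    by apply: sub_gen_smallest; apply/face_of_walk.
  rewrite aff => -[v vV vE].
  have -> : lifted x i = row_mx v 0 + row_mx x0 1%:M.
    by rewrite add_row_mx add0r /lifted -vE addrC.
  have /andP[KB K0] : (row_mx B 0 <= K)%MS && (row_mx x0 (1%:M : 'M[R]_1) <= K)%MS.
    by rewrite -col_mx_sub.
  rewrite addmx_sub //; apply: submx_trans KB.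
  have -> : row_mx v 0 = (\row_j coord (vbasis V) j v) *m row_mx B (0 : 'M[R]_(_, 1)).
    rewrite mul_mx_row mulmx0; congr row_mx.
    rewrite mulmx_sum_row {1}(coord_vbasis vV); apply: eq_bigr => j _.
    by rewrite rowK mxE.
  exact: submxMl.
have Kfree : row_free K.
  rewrite -kermx_eq0; apply/rowV0P => r /sub_kermxP.
  rewrite -[r]hsubmxK mul_row_col !mul_mx_row mulmx0 add_row_mx add0r mulmx1.
  move=> /eqP; rewrite row_mx_eq0 => /andP[/eqP E1 /eqP E2].
  rewrite E2 mul0mx addr0 in E1 *.
  suff -> : lsubmx r = 0 by rewrite row_mx0.
  rewrite mulmx_sum_row in E1.
  have /freeP fr := basis_free (vbasisP V).
  apply/rowP => j; rewrite [RHS]mxE; apply: (fr (fun j => lsubmx r 0 j)) => //.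
  by rewrite -[RHS]E1; apply: eq_bigr => j' _; rewrite rowK.
by rewrite -(eqmx_rank KL) (eqP Kfree) addn1.
Qed.

(** Affine sets are closed under scaling and addition of differences; the sum
    is twice a midpoint. *)
Lemma affine_closed (A : set 'rV[R]_d) (x0 : 'rV[R]_d) (I : finType)
    (P : pred I) (f : I -> 'rV[R]_d) (k : I -> R) : affine_set A -> A x0 -> (forall i, P i -> A (x0 + f i)) ->
  A (x0 + \sum_(i | P i) k i *: f i).
Proof.
move=> aA A0 Af.
have sc t v : A (x0 + v) -> A (x0 + t *: v).
  move=> h; have := aA _ _ t h A0; congr A.
  by rewrite scalerDr scalerBl scale1r -addrA [_ + (x0 - _)]addrC addrA addrCA subrr addr0.
have ad v w : A (x0 + v) -> A (x0 + w) -> A (x0 + (v + w)).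
  move=> hv hw; have := sc 2 _ (_ : A (x0 + (2^-1 *: v + 2^-1 *: w))).
  rewrite -!scalerDr scalerA divff ?pnatr_eq0 // scale1r; apply.
  have := aA _ _ 2^-1 hv hw; congr A.
  have -> : 1 - 2^-1 = 2^-1 :> R by field.
  rewrite !scalerDr addrACA -scalerDl.
  by have -> : 2^-1 + 2^-1 = 1 :> R; [field|rewrite scale1r].
apply: (big_ind (fun v => A (x0 + v))) => //; first by rewrite addr0.
by move=> i Pi; apply: sc; exact: Af.
Qed.

(** The affine hull is the translate of the span of the differences of
    vertices; its dimension is then the right one by [has_dim_rank]. *)
Lemma rank_has_dim x J l : exposed x J -> \rank (span_lifted x J) = l.+1 ->
  has_dim (face_of x J) l.
Proof.
move=> eJ rL.
have [j0 j0J] : exists j0, j0 \in J.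
  apply/set0Pn; apply/eqP => J0; move: rL; rewrite (_ : span_lifted x J = 0) ?mxrank0 //.
  by apply/row_matrixP => i; rewrite rowK J0 inE row0.
pose f (i : 'I_m.+1) := walk x i - walk x j0.
pose X := [seq f j | j <- enum J]; pose V := <<X>>%VS.
have fV i : i \in J -> f i \in V.
  by move=> iJ; apply/memv_span/map_f; rewrite mem_enum.
have aff : affine_hull (face_of x J) = [set walk x j0 + v | v in [set v | v \in V]].
  apply/seteqP; split.
    apply: smallest_sub.
      move=> _ _ t [v /= vV <-] [w /= wV <-].
      exists (t *: v + (1 - t) *: w) => /=; first by rewrite memvD ?memvZ.
      by rewrite !scalerDr addrACA -scalerDl [t + _]addrC subrK scale1r.
    move=> v [_ [lam [l0 l1 ->]]].
    exists (\sum_i lam i *: f i) => /=.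
      apply: memv_suml => i _; have [iJ|/l0 ->] := boolP (i \in J).
        by rewrite memvZ ?fV.
      by rewrite scale0r mem0v.
    rewrite /f; under eq_bigr do rewrite scalerBr.
    by rewrite sumrB -scaler_suml l1 scale1r addrC subrK.
  move=> _ [v /= vV <-].
  have inA i : i \in J -> affine_hull (face_of x J) (walk x i).
    by move=> iJ; apply: sub_gen_smallest; apply/face_of_walk.
  rewrite (coord_span (X := in_tuple X) vV).
  apply: affine_closed.
  - move=> a b t ha hb A AF; exact: (AF.1 a b t (ha A AF) (hb A AF)).
  - exact: (inA j0 j0J).
  - move=> i _; have : (in_tuple X)`_i \in X by rewrite mem_nth.
    by case/mapP => j; rewrite mem_enum => jJ ->; rewrite /f addrC subrK; exact: inA.
have hd : has_dim (face_of x J) (\dim V) by exists (walk x j0), V.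
by have := has_dim_rank eJ hd; rewrite rL => -[->].
Qed.

(** Faces correspond to exposed sets, even when the points of the walk are in
    special position or coincide; this is what makes the number of faces
    measurable. *)
Theorem num_faces_walk_hull x l : num_faces l (walk_hull x) =
  #|finset (fun J => `[< exposed x J >] && (\rank (span_lifted x J) == l.+1))|.
Proof.
set JJ := finset _; rewrite /num_faces.
have -> : [set G | is_face (walk_hull x) G /\ has_dim G l] =
    face_of x @` [set` JJ].
  apply/seteqP; split=> [G [/is_faceP[J eJ ->] hd]|_ [J /= + <-]].
    by exists J => //=; rewrite inE asboolT // (has_dim_rank eJ hd) eqxx.
  rewrite inE => /andP[/asboolP eJ /eqP rJ]; split; last exact: rank_has_dim.
  by apply/is_faceP; exists J.
have inj : {in [set` JJ] &, injective (face_of x)}.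
  move=> J J'; rewrite !inE /= !inE => /andP[/asboolP eJ _] /andP[/asboolP eJ' _] E.
  apply/setP => i; apply/idP/idP => /face_of_walk.
    by move=> /(_ _ eJ); rewrite E => /face_of_walk; apply.
  by move=> /(_ _ eJ'); rewrite -E => /face_of_walk; apply.
have -> : face_of x @` [set` JJ] = [set` [fset face_of x J | J in JJ]%fset].
  apply/seteqP; split=> [_ [J /= JJJ <-]|G /imfsetP[J /= JJJ ->]].
    by apply/imfsetP; exists J.
  by exists J.
rewrite set_fsetK card_in_imfset /=; last first.
  by move=> J J' hJ hJ'; apply: inj; rewrite inE.
by rewrite cardE.
Qed.

End Faces.

(** * General position of the walk *)

Section GeneralPosition.
Variables (R : realType) (m d : nat).
Implicit Types (x : 'M[R]_(m, d)) (J F : {set 'I_m.+1}).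

Lemma free_enumP n (f : 'I_n -> 'rV[R]_d) :
  free [seq f r | r <- enum 'I_n] <->
  (forall k : 'I_n -> R, \sum_r k r *: f r = 0 -> forall r, k r = 0).
Proof.
pose X := [tuple f r | r < n].
have -> : [seq f r | r <- enum 'I_n] = X by rewrite /= -codomE.
have XE k : \sum_(r < n) k r *: X`_r = \sum_r k r *: f r.
  by apply: eq_bigr => r _; rewrite -tnth_nth tnth_mktuple.
split=> [/freeP H k|H]; first by rewrite -XE; exact: H.
by apply/freeP => k; rewrite XE; exact: H.
Qed.

Lemma sorting_perm (key : 'I_m -> nat) :
  exists sg : 'S_m, forall l l' : 'I_m, (l <= l')%N -> (key (sg l') <= key (sg l))%N.
Proof.
pose leT := fun a b : 'I_m => (key b <= key a)%N.
have tot : total leT by move=> a b; exact: leq_total.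
have tr : transitive leT by move=> a b c h1 h2; exact: leq_trans h2 h1.
have st : size (sort leT (enum 'I_m)) == m by rewrite size_sort size_enum_ord.
have /tuple_permP[sg sgE] : perm_eq (Tuple st) (ord_tuple m).
  by rewrite /= perm_sort.
have sgE' (l : 'I_m) : sg l = nth l (sort leT (enum 'I_m)) l.
  have := congr1 (fun s => nth l s l) sgE.
  by rewrite /= => ->; rewrite (nth_map l) ?size_enum_ord // nth_ord_enum tnth_ord_tuple.
exists sg => l l' ll'.
have so : sorted leT (sort leT (enum 'I_m)) by exact: sort_sorted.
rewrite (sgE' l') (sgE' l) (set_nth_default l' l); last by rewrite (eqP st).
apply: (sorted_leq_nth tr _ l' so) => //.
- by move=> a; rewrite /leT.
- by rewrite inE (eqP st).
- by rewrite inE (eqP st).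
Qed.

Lemma free_walk_coef x (T : {set 'I_m}) (k : 'I_m -> R) : #|T| = d ->
  (forall i : 'I_d -> 'I_m, {homo i : r s / (r < s)%N} ->
     free [seq walk x (i r).+1 | r <- enum 'I_d]) ->
  \sum_(l in T) k l *: walk x l.+1 = 0 -> forall l, l \in T -> k l = 0.
Proof.
move=> Td H E l lT.
pose i (r : 'I_d) : 'I_m := enum_val (cast_ord (esym Td) r).
have i_inc : {homo i : r s / (r < s)%N}.
  move=> r s rs; rewrite /i /enum_val.
  set x0 := enum_default _; set y0 := enum_default _.
  rewrite (set_nth_default x0 y0); last by rewrite -cardE; exact: ltn_ord.
  have so : sorted (fun a b : 'I_m => (a < b)%N) (enum T).
    rewrite /enum_mem; apply: sorted_filter; first by move=> a b c; exact: ltn_trans.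
    have := iota_ltn_sorted 0 m; rewrite -val_enum_ord sorted_map.
    by rewrite enumT.
  apply: (sorted_ltn_nth _ _ so) => //.
  - by move=> a b c; exact: ltn_trans.
  - by rewrite inE -cardE; exact: ltn_ord.
  - by rewrite inE -cardE; exact: ltn_ord.
have /free_enumP fr := H i i_inc.
have [r <-] : exists r, i r = l.
  exists (cast_ord Td (enum_rank_in lT l)).
  by rewrite /i cast_ordK enum_rankK_in.
apply: (fr (k \o i)); rewrite -[RHS]E [RHS]big_enum_val /=.
rewrite [LHS](@reindex _ _ _ 'I_d 'I_#|T| (cast_ord Td)) /=; last first.
  by apply: onW_bij; exists (cast_ord (esym Td)); [exact: cast_ordK|exact: cast_ordKV].
by apply: eq_bigr => a _; rewrite /i cast_ordK.
Qed.

(** Reorder the steps so that those of equal coefficient are adjacent and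
    those of coefficient zero come last. Summation by parts turns the relation
    into one between the points of the reordered walk at the at most q times
    where the coefficient changes, and these points are independent. *)
Lemma general_position_free x : (d <= m)%N ->
  (forall (sg : 'S_m) (i : 'I_d -> 'I_m), {homo i : r s / (r < s)%N} ->
     free [seq walk (row_perm sg x) (i r).+1 | r <- enum 'I_d]) ->
  in_general_position x.
Proof.
move=> dm H q c z qd c0 z0 cq E.
pose key (l : 'I_m) := if z (c l.+1) == 0 then 0%N else c l.+1.
have zkey l : z (key l) = z (c l.+1) by rewrite /key; case: eqP => // ->.
have keyq l : (key l <= q)%N by rewrite /key; case: eqP => // _; apply: cq; rewrite ltnS.
have [sg sgP] := sorting_perm key.
pose x' := row_perm sg x.
pose y (i : nat) : R := if i is j.+1 then
  (if insub j is Some l then z (key (sg l)) else 0) else 0.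
have yE (l : 'I_m) : y l.+1 = z (key (sg l)) by rewrite /y valK.
have ym : y m.+1 = 0 by rewrite /y insubF ?ltnn.
clearbody y.
have Ey : \sum_(i < m.+1) y i *: steps x' i = 0.
  rewrite big_ord_recl /= scaler0 add0r.
  move: E; rewrite big_ord_recl /= scaler0 add0r => E.
  rewrite -[RHS]E [RHS](reindex_inj (@perm_inj _ sg)) /=.
  apply: eq_bigr => l _; rewrite /bump /= !add1n yE zkey.
  by rewrite /steps !valK; congr (_ *: _); apply/rowP => a; rewrite !mxE.
have := abel_walk x' y m.+1; rewrite Ey ym scale0r subr0.
rewrite big_ord_recl /= walk0 scaler0 add0r.
under eq_bigr do rewrite /bump /= add1n.
move=> E2.
(* The times at which the sorted coefficient changes. *)
pose T := [set l : 'I_m | y l.+1 != y l.+2].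
have step (l l' : 'I_m) : (l < l')%N -> l \in T -> (key (sg l') < key (sg l))%N.
  move=> ll'; rewrite inE => lT.
  have lm : (l.+1 < m)%N by have := ltn_ord l'; lia.
  rewrite (yE (Ordinal lm)) yE in lT.
  apply: (leq_ltn_trans (sgP (Ordinal lm) l' _)) => //.
  rewrite ltn_neqAle sgP ?andbT //=; apply: contraNN lT => /eqP h.
  by rewrite h.
have Tpos (l : 'I_m) : l \in T -> (0 < key (sg l))%N.
  move=> lT; rewrite lt0n; apply/eqP => k0; move: (lT); rewrite inE yE k0 z0.
  have [lm|lm] := ltnP l.+1 m.
    by have := step l (Ordinal lm) (ltnSn _) lT; rewrite k0.
  by rewrite (_ : l.+2 = m.+1) ?ym ?eqxx //; have := ltn_ord l; lia.
have Td : (#|T| <= d)%N.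
  apply: leq_trans qd; pose f (l : 'I_m) : 'I_q.+1 := inord (key (sg l)).
  have fE l : f l = key (sg l) :> nat by rewrite inordK // ltnS.
  have f_inj : {in T &, injective f}.
    move=> l l' lT l'T /(congr1 val) /=; rewrite !fE => h.
    apply: val_inj => /=; case: (ltngtP l l') => // ll'.
      by have := step _ _ ll' lT; rewrite h ltnn.
    by have := step _ _ ll' l'T; rewrite h ltnn.
  rewrite -(card_in_imset f_inj) -ltnS -[X in (_ < X)%N]card_ord.
  apply: (@leq_ltn_trans #|[set~ (ord0 : 'I_q.+1)]|).
    apply/subset_leq_card/fintype.subsetP => _ /imsetP[l lT ->].
    by rewrite !inE -(inj_eq val_inj) /= fE -lt0n Tpos.
  by rewrite cardsC1 card_ord ltnSn.
(* Exactly d times are needed to apply the hypothesis. *)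
have [T' [TT' T'd]] : exists T' : {set 'I_m}, T \subset T' /\ #|T'| = d.
  have : (0 < #|[set G : {set 'I_m} | G \subset ~: T & #|G| == (d - #|T|)%N]|)%N.
    by rewrite cards_draws bin_gt0 leq_subLR cardsC card_ord.
  case/card_gt0P => G; rewrite inE => /andP[GT /eqP Gd].
  exists (T :|: G); split; first exact: finset.subsetUl.
  rewrite cardsU (_ : T :&: G = finset.set0) ?cards0 ?Gd ?subn0 ?subnKC //.
  by apply/eqP; rewrite finset.setI_eq0 disjoint_sym finset.disjoints_subset.
have C : forall l : 'I_m, y l.+1 = y l.+2.
  move=> l; apply/eqP; rewrite -subr_eq0; apply/eqP.
  have [lT|lT] := boolP (l \in T'); last first.
    apply/eqP; rewrite subr_eq0; apply: contraNT lT => lT.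
    by apply: (fintype.subsetP TT'); rewrite inE.
  apply: (free_walk_coef (x := x') (k := fun l : 'I_m => y l.+1 - y l.+2) T'd) => //.
    exact: H.
  rewrite -[RHS]E2 [RHS](bigID (mem T')) /= [X in _ = _ + X]big1 ?addr0 // => a aT.
  have : a \notin T by apply: contra aT; apply: (fintype.subsetP TT').
  by rewrite inE negbK => /eqP ->; rewrite subrr scale0r.
have y0 j : (j <= m)%N -> y (m.+1 - j)%N = 0.
  elim: j => [|j IH] jm; first by rewrite subn0.
  have h : (m - j.+1 < m)%N by lia.
  have := C (Ordinal h); rewrite /= (_ : (m - j.+1).+1 = m.+1 - j.+1)%N; last by lia.
  by move=> ->; rewrite (_ : (m.+1 - j.+1).+1 = m.+1 - j)%N ?IH //; lia.
case=> [|j] jm; first by rewrite c0 z0.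
have h : (j < m)%N by [].
pose l := (sg^-1)%g (Ordinal h).
rewrite -[j]/(val (Ordinal h)) -zkey -[Ordinal h](permKV sg) -/l -yE.
have := y0 (m - l)%N (leq_subr _ _).
by rewrite (_ : (m.+1 - (m - l) = l.+1)%N) //; have := ltn_ord l; lia.
Qed.

Lemma span_lifted_sub x F J : F \subset J ->
  (span_lifted x F <= span_lifted x J)%MS.
Proof.
move=> FJ; apply/row_subP => i; rewrite rowK; case: ifP => iF; last exact: sub0mx.
have := row_sub i (span_lifted x J).
by rewrite rowK (fintype.subsetP FJ).
Qed.

Lemma rank_span_lifted x F : in_general_position x -> (#|F| <= d.+1)%N ->
  \rank (span_lifted x F) = #|F|.
Proof.
move=> gp Fd; rewrite -[RHS](eqP (lifted_free gp Fd)); apply: eqmx_rank.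
apply/andP; split; apply/row_subP => i; rewrite rowK.
  case: ifP => iF; last exact: sub0mx.
  rewrite -(enum_rankK_in iF iF); set l := enum_rank_in _ _.
  by have := row_sub l (\matrix_(i < #|F|) lifted x (enum_val i)); rewrite rowK.
have := row_sub (enum_val i) (span_lifted x F).
by rewrite rowK enum_valP.
Qed.

(** Points in general position have affine dimension min(#|J| - 1, d). *)
Lemma rank_span_lifted_eq x J k : in_general_position x -> (k <= d)%N ->
  (\rank (span_lifted x J) == k) = (#|J| == k).
Proof.
move=> gp kd; have [Jd|Jd] := leqP #|J| d.+1; first by rewrite rank_span_lifted.
have [G GJ Gd] : exists2 G : {set 'I_m.+1}, G \subset J & #|G| = d.+1.
  have /card_gt0P[G] : (0 < #|[set G : {set 'I_m.+1} | G \subset J & #|G| == d.+1]|)%N.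
    by rewrite cards_draws bin_gt0 ltnW.
  by rewrite inE => /andP[GJ /eqP Gd]; exists G.
have := mxrankS (span_lifted_sub x GJ).
rewrite rank_span_lifted ?Gd // => h.
apply/idP/idP => /eqP; lia.
Qed.

Definition hidden_count (k : nat) x : nat :=
  \sum_(J : {set 'I_m.+1} | #|J| == k) `[< ~ exposed x J >].

Theorem num_faces_hidden k x : in_general_position x -> (0 < k <= d)%N ->
  (num_faces k.-1 (walk_hull x) + hidden_count k x = 'C(m.+1, k))%N.
Proof.
move=> gp /andP[k0 kd]; rewrite num_faces_walk_hull prednK //.
rewrite -sum1_card big_mkcond /= /hidden_count [X in (_ + X)%N]big_mkcond -big_split /=.
have := card_draws 'I_m.+1 k; rewrite card_ord => <-.
rewrite -sum1_card [RHS]big_mkcond /=; apply: eq_bigr => J _.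
rewrite !inE rank_span_lifted_eq //; case: eqP => //= _.
  by rewrite andbT; case: asboolP => E; case: asboolP.
by rewrite andbF.
Qed.

End GeneralPosition.

(** * Borel measurability *)

Import numFieldNormedType.Exports.
Local Open Scope classical_set_scope.
Local Open Scope ring_scope.

Section Measurability.
Variables (R : realType) (m d : nat).
Implicit Types (x : 'M[R]_(m, d)) (J F : {set 'I_m.+1}).

(** The tube lemma. *)
Lemma compact_projection (X Z : topologicalType) (K : set Z) (Q : set (X * Z)) :
  compact K -> closed Q -> closed [set a | exists2 z, K z & Q (a, z)].
Proof.
move=> cK cQ; rewrite -[X in closed X]setCK; apply: open_closedC.
rewrite openE => a0 na0.
have /compact_near_coveringP nK := cK.
have near_a0 z : K z -> \forall z' \near z & a \near a0, ~ Q (a, z').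
  move=> Kz; have : nbhs (a0, z) (~` Q).
    apply: open_nbhs_nbhs; split; first exact: closed_openC.
    by move=> Qz; apply: na0; exists z.
  case=> -[A B] /= [nA nB] AB; exists (B, A) => //= -[b a] /= [Bb Aa].
  exact: (AB (a, b)).
apply: filterS (nK X (nbhs a0) (fun a z => ~ Q (a, z)) _ near_a0) => a Ha [z Kz].
exact: Ha.
Qed.

Lemma continuous_sum (X : topologicalType) (I : Type) (s : seq I) (p : pred I) (f : I -> X -> R) :
  (forall i, continuous (f i)) -> continuous (fun a => \sum_(i <- s | p i) f i a).
Proof.
move=> cf; apply: (@continuous_big _ _ _ _ p) => [|i _]; last exact: cf.
exact: (@add_continuous R^o).
Qed.

Lemma continuous_prodr (X : topologicalType) (I : Type) (s : seq I) (p : pred I) (f : I -> X -> R) :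
  (forall i, continuous (f i)) -> continuous (fun a => \prod_(i <- s | p i) f i a).
Proof.
move=> cf; apply: (@continuous_big _ _ _ _ p) => [|i _]; last exact: cf.
exact: (@mul_continuous R^o).
Qed.

Lemma continuous_det (X : topologicalType) n (f : X -> 'M[R]_n) :
  (forall i j, continuous (fun a => f a i j)) -> continuous (fun a => \det (f a)).
Proof.
move=> cf; rewrite /determinant; apply: continuous_sum => s a.
apply: (@continuousM _ _ (fun=> (-1) ^+ s)); first exact: cst_continuous.
by apply: continuous_prodr => i; exact: cf.
Qed.

Lemma measurable_neq0 (f : 'M[R]_(m, d) -> R) : continuous f ->
  measurable [set x : borel_mx R m d | f x != 0].
Proof.
move=> cf; apply: sub_sigma_algebra.
have := @open_comp _ _ f [set y | y != 0].
by apply; [move=> y _; exact: cf | exact: open_neq].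
Qed.

Lemma walk_entry (sg : 'S_m) x i j : walk (row_perm sg x) i 0 j =
  \sum_(l < m | (l < i)%N) x (sg l) j.
Proof.
by rewrite /walk summxE; apply: eq_bigr => l _; rewrite !mxE.
Qed.

Lemma continuous_walk (sg : 'S_m) i j :
  continuous (fun x => walk (row_perm sg x) i 0 j : R).
Proof.
under eq_fun do rewrite walk_entry.
by apply: continuous_sum => l; exact: coord_continuous.
Qed.

Lemma continuous_lifted (sg : 'S_m) (i : 'I_m.+1) j :
  continuous (fun x => lifted (row_perm sg x) i 0 j : R).
Proof.
rewrite -[j]splitK; case: (fintype.split j) => l /=.
  rewrite (_ : (fun x => _) = (fun x => walk (row_perm sg x) i 0 l)).
    exact: continuous_walk.
  by apply/funext => x; rewrite /lifted row_mxEl.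
rewrite (_ : (fun x => _) = (fun=> (1%:M : 'M[R]_1) 0 l)).
  by move=> x; exact: cst_continuous.
by apply/funext => x; rewrite /lifted row_mxEr.
Qed.

(** The value at the i-th point of the affine functional encoded by the row
    p.2, whose last entry is the constant term. *)
Definition functional_value (sg : 'S_m) i (p : 'M[R]_(m, d) * 'rV[R]_(d + 1)) : R :=
  \sum_j walk (row_perm sg p.1) i 0 j * p.2 0 (lshift 1 j) + p.2 0 (rshift d 0).

Lemma continuous_functional_value (sg : 'S_m) i : continuous (functional_value sg i).
Proof.
have coord2 (j : 'I_(d + 1)) :
    continuous (fun p : 'M[R]_(m, d) * 'rV[R]_(d + 1) => p.2 0 j : R).
  move=> p; apply: (@continuous_comp _ _ _ snd (fun M : 'rV[R]_(d + 1) => M 0 j)).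
    exact: cvg_snd.
  exact: coord_continuous.
have walk1 j : continuous (fun p : 'M[R]_(m, d) * 'rV[R]_(d + 1) =>
    walk (row_perm sg p.1) i 0 j : R).
  move=> p; apply: (@continuous_comp _ _ _ fst (fun a => walk (row_perm sg a) i 0 j)).
    exact: cvg_fst.
  exact: continuous_walk.
move=> p; apply: cvgD; last exact: coord2.
apply: continuous_sum => j q; apply: cvgM; [exact: walk1|exact: coord2].
Qed.

(** The strict inequalities are bounded away from 0 in order to get a closed
    condition. *)
Definition exposing_pairs (sg : 'S_m) J (N : nat) :
    set ('M[R]_(m, d) * 'rV[R]_(d + 1)) :=
  \bigcap_(i in [set: 'I_m.+1]) (functional_value sg i @^-1`
     (if i \in J then [set t | t = 0] else [set t | t <= - N.+1%:R^-1])).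

Lemma exposing_pairsP (sg : 'S_m) J x : exposed (row_perm sg x) J <->
  exists N : nat, exists2 z : 'rV[R]_(d + 1), `|z| <= N%:R &
    exposing_pairs sg J N (x, z).
Proof.
have E (c : 'cV[R]_d) b i :
    functional_value sg i (x, row_mx c^T (- b)%:M) = (walk (row_perm sg x) i *m c) 0 0 - b.
  rewrite /functional_value /= row_mxEr mxE eqxx mulr1n; congr (_ - _); rewrite [RHS]mxE.
  by apply: eq_bigr => j _; rewrite row_mxEl mxE.
split=> [[c [b H]]|[N [z _ H]]].
  pose z := row_mx c^T (- b)%:M : 'rV[R]_(d + 1).
  (* A bound for the functional and for the inverses of its finitely many gaps. *)
  pose S := `|z| + \sum_(i | i \notin J) (- functional_value sg i (x, z))^-1.
  have neg i : i \notin J -> 0 < - functional_value sg i (x, z).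
    by move=> iJ; rewrite E oppr_gt0 subr_lt0; have := H i; rewrite (negbTE iJ).
  have S0 : 0 <= S.
    by rewrite addr_ge0 // sumr_ge0 // => i /neg h; rewrite invr_ge0 ltW.
  exists (Num.bound S), z.
    apply: le_trans _ (ltW (archi_boundP S0)); rewrite lerDl sumr_ge0 // => i /neg h.
    by rewrite invr_ge0 ltW.
  move=> i _; rewrite /preimage /=; case: ifPn => iJ /=.
    by rewrite E; have := H i; rewrite iJ => ->; rewrite subrr.
  rewrite lerNr -[leRHS]invrK lef_pV2 ?posrE ?invr_gt0 ?ltr0n ?neg //.
  apply: (@le_trans _ _ S).
    rewrite /S (bigD1 i) //= addrCA lerDl addr_ge0 // sumr_ge0 // => j /andP[/neg h _].
    by rewrite invr_ge0 ltW.
  by apply: le_trans (ltW (archi_boundP S0)) _; rewrite ler_nat.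
exists (lsubmx z)^T, (- rsubmx z 0 0) => i.
have zE : z = row_mx ((lsubmx z)^T)^T (- - rsubmx z 0 0)%:M.
  by rewrite trmxK opprK -mx11_scalar hsubmxK.
have Ez : functional_value sg i (x, z) =
    (walk (row_perm sg x) i *m (lsubmx z)^T) 0 0 - - rsubmx z 0 0.
  by rewrite {1}zE E.
have := H i I; rewrite /preimage /= Ez; case: ifP => _ /=.
  by move/eqP; rewrite subr_eq0 => /eqP.
move=> h; rewrite -subr_lt0; apply: le_lt_trans h _.
by rewrite oppr_lt0 invr_gt0 ltr0n.
Qed.

(** The exposed walks are the union over N of the projections of closed sets
    along the compact balls of radius N, hence a countable union of closed
    sets. *)
Lemma measurable_exposed (sg : 'S_m) J :
  measurable [set x : borel_mx R m d | exposed (row_perm sg x) J].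
Proof.
have -> : [set x : borel_mx R m d | exposed (row_perm sg x) J] =
    \bigcup_N [set x : 'M[R]_(m, d) | exists2 z : 'rV[R]_(d + 1),
       [set z | `|z| <= N%:R] z & exposing_pairs sg J N (x, z)].
  apply/seteqP; split=> x.
    by case/exposing_pairsP => N ?; exists N.
  by case=> N _ ?; apply/exposing_pairsP; exists N.
apply: bigcup_measurable => N _; rewrite -[X in measurable X]setCK.
apply: measurableC; apply: sub_sigma_algebra; apply: closed_openC.
apply: compact_projection.
  apply: bounded_closed_compact.
    exists N%:R; split; first exact: realn.
    by move=> M NM z /= /le_trans; apply; exact: ltW.
  have := @closed_comp _ _ (fun z : 'rV[R]_(d + 1) => `|z|) [set t | t <= N%:R].
  by apply; [move=> z _; exact: norm_continuous | exact: closed_le].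
apply: closed_bigI => i _; apply: closed_comp.
  by move=> p _; exact: continuous_functional_value.
by case: ifP => _; [exact: closed_eq|exact: closed_le].
Qed.

(** The rank is detected by minors, which are continuous functions of the
    walk. *)
Lemma rank_geP p q (A : 'M[R]_(p, q)) r : (r <= \rank A)%N <->
  exists2 s : nat, (r <= s)%N & exists fg : {ffun 'I_s -> 'I_p} * {ffun 'I_s -> 'I_q},
    \det (mxsub fg.1 fg.2 A) != 0.
Proof.
split=> [rA|[s rs [[f g] /= fg]]].
  exists (\rank A) => //; pose f := maxrankfun A.
  have fr : row_full (rowsub f A)^T.
    by rewrite /row_full mxrank_tr (eqP (maxrowsub_free A)).
  exists (f, fullrankfun fr) => /=.
  have := fullrowsub_unit fr; rewrite unitmxE unitfE -det_tr.
  congr (\det _ != 0); by apply/matrixP => i j; rewrite !mxE.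
apply: leq_trans rs _.
have : mxsub f g A \in unitmx by rewrite unitmxE unitfE.
move/mxrank_unit => <-.
rewrite mxsubrc; apply: leq_trans (mxrankS (rowsub_sub _ _)) _.
have -> : colsub g A = (rowsub g A^T)^T by apply/matrixP => i j; rewrite !mxE.
rewrite mxrank_tr -[X in (_ <= X)%N]mxrank_tr.
exact: mxrankS (rowsub_sub _ _).
Qed.

Lemma measurable_rank (sg : 'S_m) J r :
  measurable [set x : borel_mx R m d | \rank (span_lifted (row_perm sg x) J) == r].
Proof.
have ge_r s : measurable [set x : borel_mx R m d |
    (s <= \rank (span_lifted (row_perm sg x) J))%N].
  have -> : [set x : borel_mx R m d |
      (s <= \rank (span_lifted (row_perm sg x) J))%N] =
      \bigcup_(s' in [set s' | (s <= s')%N])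
        \bigcup_(fg in [set: {ffun 'I_s' -> 'I_m.+1} * {ffun 'I_s' -> 'I_(d + 1)}])
          [set x : borel_mx R m d |
            \det (mxsub fg.1 fg.2 (span_lifted (row_perm sg x) J)) != 0].
    apply/seteqP; split=> x.
      by move/rank_geP => [s' ss' [fg H]]; exists s' => //; exists fg.
    by case=> s' ss' [fg _ H]; apply/rank_geP; exists s' => //; exists fg.
  apply: bigcup_measurable => s' _; apply: fin_bigcup_measurable => [|fg _].
    exact: finite_finset.
  apply: measurable_neq0; apply: continuous_det => i j.
  under eq_fun do rewrite !mxE.
  case: (fg.1 i \in J); last by move=> x; rewrite mxE; exact: cst_continuous.
  exact: continuous_lifted.
have -> : [set x : borel_mx R m d | \rank (span_lifted (row_perm sg x) J) == r] =
   [set x : borel_mx R m d | (r <= \rank (span_lifted (row_perm sg x) J))%N] `\`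
   [set x : borel_mx R m d | (r.+1 <= \rank (span_lifted (row_perm sg x) J))%N].
  apply/seteqP; split=> x /=; first by move/eqP ->; rewrite ltnn leqnn.
  by case=> h /negP; rewrite -leqNgt eqn_leq h andbT.
exact: measurableD.
Qed.

Lemma measurable_free (sg : 'S_m) (i : 'I_d -> 'I_m) :
  measurable [set x : borel_mx R m d |
    ~~ free [seq walk (row_perm sg x) (i r).+1 | r <- enum 'I_d]].
Proof.
rewrite (_ : mkset _ = ~` [set x : borel_mx R m d |
    \det (\matrix_(r < d) walk (row_perm sg x) (i r).+1) != 0]).
  apply: measurableC; apply: measurable_neq0; apply: continuous_det => a b.
  by under eq_fun do rewrite mxE; exact: continuous_walk.
apply/seteqP; split=> x /=.
  move=> nf /eqP dt; case/negP: nf; apply/free_enumP => k E r.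
  have : \matrix_(r < d) walk (row_perm sg x) (i r).+1 \in unitmx.
    by rewrite unitmxE unitfE; apply/eqP.
  rewrite -row_free_unit -kermx_eq0 => /eqP ker0.
  have : (\row_r k r <= kermx (\matrix_(r < d) walk (row_perm sg x) (i r).+1))%MS.
    apply/sub_kermxP; rewrite mulmx_sum_row -[RHS]E; apply: eq_bigr => r' _.
    by rewrite rowK mxE.
  by rewrite ker0 submx0 => /eqP/rowP/(_ r); rewrite !mxE.
move=> H; apply/negP => /free_enumP fr; apply: H.
rewrite -unitfE -unitmxE -row_free_unit -kermx_eq0; apply/rowV0P => v /sub_kermxP.
rewrite mulmx_sum_row => E; apply/rowP => r; rewrite [RHS]mxE.
apply: (fr (fun r => v 0 r)); rewrite -[RHS]E; apply: eq_bigr => r' _.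
by rewrite rowK.
Qed.

End Measurability.

(** * The expected number of hidden sets *)

Section CountIntegral.
Context (R : realType) (dsp : measure_display) (T : measurableType dsp).
Variable P : probability T R.

Definition event_count (I : finType) (p : pred I) (A : I -> set T) (w : T) : R :=
  \sum_(i | p i) (`[< A i w >])%:R.

Lemma event_countE (I : finType) (p : pred I) (A : I -> set T) :
  (fun w => (event_count p A w)%:E) =
  (fun w => (\sum_(i <- [seq i <- index_enum I | p i]) (\1_(A i) w : R)%:E)%E).
Proof.
apply/funext => w; rewrite sumEFin big_filter; congr EFin.
Qed.

Lemma event_count_ge0 (I : finType) (p : pred I) (A : I -> set T) w :
  0 <= event_count p A w.
Proof. by rewrite sumr_ge0. Qed.

Lemma measurable_event_count (I : finType) (p : pred I) (A : I -> set T) :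
  (forall i, measurable (A i)) ->
  measurable_fun setT (fun w => (event_count p A w)%:E : \bar R).
Proof.
move=> mA; rewrite event_countE; apply: emeasurable_sum => i.
by apply/measurable_EFinP; exact: measurable_indic.
Qed.

Lemma integral_event_count (I : finType) (p : pred I) (A : I -> set T) :
  (forall i, measurable (A i)) ->
  (\int[P]_w (event_count p A w)%:E = \sum_(i | p i) P (A i))%E.
Proof.
move=> mA; rewrite event_countE ge0_integral_sum //; last first.
  by move=> i; apply/measurable_EFinP; exact: measurable_indic.
rewrite big_filter; apply: eq_bigr => i _.
by rewrite integral_indic // setIT.
Qed.

End CountIntegral.

Section Expectation.
Context (R : realType) (dsp : measure_display) (T : measurableType dsp).
Context (P : probability T R) (m d : nat) (xi : {RV P >-> borel_mx R m d}).
Hypothesis exch : exchangeable xi.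
Hypothesis gp : general_position xi.
Hypothesis dm : (d <= m)%N.
Variable k : nat.
Hypothesis kd : (0 < k <= d)%N.

Let X (w : T) : 'M[R]_(m, d) := xi w.

Lemma measurable_event (B : set (borel_mx R m d)) :
  measurable B -> measurable [set w | B (X w)].
Proof. by move=> mB; exact: (measurable_funPTI xi mB). Qed.

(** By exchangeability the walk stays in general position almost surely after
    each of the finitely many permutations of its steps. *)
Lemma ae_general_position : {ae P, forall w, in_general_position (X w)}.
Proof.
have free_ae (p : 'S_m * {ffun 'I_d -> 'I_m}) : {ae P, forall w,
    {homo p.2 : r s / (r < s)%N} ->
    free [seq walk (row_perm p.1 (X w)) (p.2 r).+1 | r <- enum 'I_d]}.
  case: (pselect {homo p.2 : r s / (r < s)%N}) => [inc|ninc]; last first.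
    by apply: nearW => w h.
  pose B := [set x : borel_mx R m d |
    ~~ free [seq walk (x : 'M[R]_(m, d)) (p.2 r).+1 | r <- enum 'I_d]].
  have mB : measurable B.
    have := measurable_free (R := R) 1%g p.2.
    by congr measurable; apply/seteqP; split=> x /=; rewrite row_perm1.
  exists [set w | B (row_perm p.1 (X w))]; split.
  - apply: (measurable_event (B := [set x : borel_mx R m d | B (row_perm p.1 x)])).
    exact: measurable_free.
  - have := exch p.1 mB; rewrite /exchangeable => ->; exact: gp.
  - by move=> w /= nf; apply/negP => fr; apply: nf => _.
apply: filterS (filter_forall _ free_ae) => w H.
apply: general_position_free => // sg i inc.
have := H (sg, [ffun r => i r]) => /=.
have -> : [seq walk (row_perm sg (X w)) ([ffun r => i r] r).+1 | r <- enum 'I_d] =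
   [seq walk (row_perm sg (X w)) (i r).+1 | r <- enum 'I_d].
  by apply: eq_map => r; rewrite ffunE.
by apply => r s rs; rewrite !ffunE; exact: inc.
Qed.

Definition hidden_event (sg : 'S_m) (J : {set 'I_m.+1}) : set T :=
  [set w | ~ exposed (row_perm sg (X w)) J].

Lemma measurable_hidden sg J : measurable (hidden_event sg J).
Proof.
apply: (measurable_event (B := [set x : borel_mx R m d | ~ exposed (row_perm sg x) J])).
apply: (measurableC (A := [set x : borel_mx R m d | exposed (row_perm sg x) J])).
exact: measurable_exposed.
Qed.

Lemma hidden_event_exch sg J : P (hidden_event sg J) = P (hidden_event 1%g J).
Proof.
have mB : measurable [set x : borel_mx R m d | ~ exposed (x : 'M[R]_(m, d)) J].
  apply: (measurableC (A := [set x : borel_mx R m d | exposed (x : 'M[R]_(m, d)) J])).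
  have := measurable_exposed (R := R) (d := d) 1%g J.
  by congr measurable; apply/seteqP; split=> x /=; rewrite row_perm1.
rewrite /hidden_event (exch sg mB); congr (P _).
by apply/seteqP; split=> w /=; rewrite row_perm1.
Qed.

Definition expected_hidden : R :=
  \sum_(J : {set 'I_m.+1} | #|J| == k) fine (P (hidden_event 1%g J)).

Lemma hidden_countE w : (hidden_count k (X w))%:R =
  event_count R (fun J : {set 'I_m.+1} => #|J| == k) (hidden_event 1%g) w.
Proof.
by rewrite /hidden_count natr_sum; apply: eq_bigr => J _; rewrite /hidden_event /= row_perm1.
Qed.

Lemma hidden_totalE w : (hidden_total k (X w))%:R =
  event_count R (fun p : 'S_m * {set 'I_m.+1} => #|p.2| == k)
    (fun p => hidden_event p.1 p.2) w.
Proof.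
rewrite /hidden_total natr_sum; under eq_bigr do rewrite natr_sum.
by rewrite pair_big_dep.
Qed.

Lemma fin_hidden sg J : P (hidden_event sg J) = (fine (P (hidden_event sg J)))%:E.
Proof. by rewrite fineK // fin_num_measure //; exact: measurable_hidden. Qed.

Lemma integral_hidden_count :
  (\int[P]_w (event_count R (fun J : {set 'I_m.+1} => #|J| == k)
     (hidden_event 1%g) w)%:E = expected_hidden%:E)%E.
Proof.
rewrite integral_event_count; last by move=> J; exact: measurable_hidden.
by rewrite /expected_hidden -sumEFin; apply: eq_bigr => J _; exact: fin_hidden.
Qed.

Lemma integral_hidden_total :
  (\int[P]_w (event_count R (fun p : 'S_m * {set 'I_m.+1} => #|p.2| == k)
    (fun p => hidden_event p.1 p.2) w)%:E = ((m`!)%:R * expected_hidden)%:E)%E.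
Proof.
rewrite integral_event_count; last by move=> p; exact: measurable_hidden.
rewrite -(pair_big_dep xpredT (fun _ (J : {set 'I_m.+1}) => #|J| == k)
   (fun sg J => P (hidden_event sg J))) /=.
under eq_bigr do under eq_bigr do rewrite hidden_event_exch fin_hidden.
under eq_bigr do rewrite sumEFin.
rewrite sumEFin sumr_const card_Sn -/expected_hidden mulr_natl //.
Qed.

(** Each hidden event has the same probability for all orders of the steps, so
    the integral of [hidden_total] is m! times the expected number of hidden
    sets. *)
Lemma expected_hidden_bounds :
  (feasible_count k k (m.+1 - k) d.+1)%:R <= (m`!)%:R * expected_hidden
  <= (2 * feasible_count k 1 m d.+1)%:R.
Proof.
have mt := measurable_event_count (R := R) (fun p : 'S_m * {set 'I_m.+1} => #|p.2| == k)
  (fun p => measurable_hidden p.1 p.2).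
have km : (0 < k <= m)%N by lia.
have bnd : {ae P, forall w,
   (feasible_count k k (m.+1 - k) d.+1 <= hidden_total k (X w)
     <= 2 * feasible_count k 1 m d.+1)%N}.
  apply: filterS ae_general_position => w gw; exact: hidden_total_bounds.
have cst (c : R) : (\int[P]_w (cst c%:E w) = c%:E)%E.
  by rewrite integral_cst // [X in (_ * X)%E](@probability_setT _ _ _ P) mule1.
apply/andP; split.
  rewrite -lee_fin -integral_hidden_total -(cst (feasible_count _ _ _ _)%:R).
  apply: ae_ge0_le_integral => //.
  - by move=> w _; rewrite lee_fin.
  - by move=> w _; rewrite lee_fin event_count_ge0.
  - apply: filterS bnd => w /andP[h _] _; rewrite lee_fin -hidden_totalE ler_nat //.
rewrite -lee_fin -integral_hidden_total -(cst (2 * feasible_count _ _ _ _)%:R).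
apply: ae_ge0_le_integral => //.
- by move=> w _; rewrite lee_fin event_count_ge0.
- by move=> w _; rewrite lee_fin.
- apply: filterS bnd => w /andP[_ h] _; rewrite lee_fin -hidden_totalE ler_nat //.
Qed.

Definition face_event (J : {set 'I_m.+1}) : set T :=
  [set w | exposed (X w) J /\ \rank (span_lifted (X w) J) == k].

Lemma measurable_face_event J : measurable (face_event J).
Proof.
apply: (measurable_event (B := [set x : borel_mx R m d | exposed (x : 'M[R]_(m, d)) J /\
   \rank (span_lifted (x : 'M[R]_(m, d)) J) == k])).
have -> : [set x : borel_mx R m d | exposed (x : 'M[R]_(m, d)) J /\
   \rank (span_lifted (x : 'M[R]_(m, d)) J) == k] =
   [set x : borel_mx R m d | exposed (row_perm 1%g (x : 'M[R]_(m, d))) J] `&`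
   [set x : borel_mx R m d | \rank (span_lifted (row_perm 1%g (x : 'M[R]_(m, d))) J) == k].
  by apply/seteqP; split=> x /=; rewrite row_perm1.
by apply: measurableI; [exact: measurable_exposed|exact: measurable_rank].
Qed.

Lemma face_countE w : face_count xi k.-1 w = event_count R xpredT face_event w.
Proof.
rewrite /face_count num_faces_walk_hull -sum1_card natr_sum big_mkcond.
apply: eq_bigr => J _; rewrite inE prednK; last by case/andP: kd.
rewrite /face_event /=; case: asboolP => E /=; case: asboolP => //.
- by case=> _ ->.
- by case: eqP => // r nE; case: nE.
- by case.
Qed.

Lemma ae_face_count_hidden : {ae P, forall w,
  face_count xi k.-1 w + (hidden_count k (X w))%:R = 'C(m.+1, k)%:R}.
Proof.
apply: filterS ae_general_position => w gw.
by rewrite /face_count -natrD (num_faces_hidden gw kd).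
Qed.

Lemma defect_expected_hidden :
  'C(m.+1, k)%:R - fine ('E_P[face_count xi k.-1])%E = expected_hidden.
Proof.
have mf := measurable_event_count (R := R) xpredT measurable_face_event.
have mh := measurable_event_count (R := R) (fun J : {set 'I_m.+1} => #|J| == k)
  (measurable_hidden 1%g).
have E : ('E_P[face_count xi k.-1] + expected_hidden%:E = ('C(m.+1, k)%:R)%:E)%E.
  rewrite unlock /= -integral_hidden_count.
  under eq_integral do rewrite face_countE.
  rewrite -ge0_integralD //.
  - rewrite -[RHS]mule1 -(probability_setT P) -integral_cst //.
    apply: ae_eq_integral => //.
    + exact: emeasurable_funD.
    + apply: filterS ae_face_count_hidden => w h _ /=.
      by rewrite -EFinD -face_countE -hidden_countE h.
  - by move=> w _; rewrite lee_fin event_count_ge0.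
  - by move=> w _; rewrite lee_fin event_count_ge0.
have : 'E_P[face_count xi k.-1]%E \is a fin_num.
  by move: E; case: ('E_P[_])%E.
move=> /fineK h; move: E; rewrite -{1}h -EFinD => -[<-].
by rewrite addrC addKr.
Qed.

(** Almost surely a face is missing only if some set is hidden, and the
    indicator of this event is at most the number of hidden sets. *)
Lemma missing_probability :
  0 <= 1 - fine (P [set w | face_count xi k.-1 w = 'C(m.+1, k)%:R])
    <= expected_hidden.
Proof.
have mf := measurable_event_count (R := R) xpredT measurable_face_event.
have mh := measurable_event_count (R := R) (fun J : {set 'I_m.+1} => #|J| == k)
  (measurable_hidden 1%g).
set A := [set w | _].
have mA : measurable A.
  have -> : A = (fun w => (event_count R xpredT face_event w)%:E) @^-1` [set ('C(m.+1, k)%:R)%:E].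
    by apply/seteqP; split=> w; rewrite /A /= face_countE; [move=> -> | case].
  by rewrite -[X in measurable X]setTI; apply: mf.
have fA : P A \is a fin_num by rewrite fin_num_measure.
have fC : P (~` A) \is a fin_num by rewrite fin_num_measure //; exact: measurableC.
have -> : 1 - fine (P A) = fine (P (~` A)).
  by rewrite probability_setC // fineB.
rewrite fine_ge0 //= -lee_fin fineK // -integral_hidden_count.
rewrite -[X in (P X <= _)%E]setIT -integral_indic //; last exact: measurableC.
apply: ae_ge0_le_integral => //.
- by apply/measurable_EFinP; apply: measurable_indic; exact: measurableC.
- by move=> w _; rewrite lee_fin event_count_ge0.
apply: filterS ae_face_count_hidden => w h _; rewrite lee_fin -hidden_countE indicE.
case: (boolP (w \in ~` A)) => [|_]; last by rewrite ler0n.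
rewrite inE /A /= => wA; rewrite ler_nat lt0n; apply/eqP => h0.
by apply: wA; rewrite -h h0 addr0.
Qed.

End Expectation.

(** * Bounds for the recursion *)

Section UpperBound.
Variable R : realType.

(** A sum of coefficients of degree at least D is at most e ^ (- D) times the
    value of the polynomial at e; the recursion preserves this bound. *)
Lemma feasible_count_chernoff k j D :
  (feasible_count k 1 j D)%:R <=
  expR (- D%:R) * \prod_(i < j) (k%:R * expR 1 + i.+1%:R) :> R.
Proof.
elim: j D => [|j IH] D.
  rewrite big_ord0 mulr1 /=; case: D => [|D] /=; first by rewrite oppr0 expR0.
  exact: expR_ge0.
rewrite big_ord_recr /= natrD !natrM add1n mulrA [leRHS]mulrC mulrDl.
set Q := expR _ * _; apply: lerD; last by rewrite ler_wpM2l // IH.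
rewrite -mulrA ler_wpM2l //.
have Q0 : 0 <= \prod_(i < j) (k%:R * expR 1 + i.+1%:R) :> R.
  by apply: prodr_ge0 => i _; rewrite addr_ge0 // mulr_ge0 // expR_ge0.
apply: (le_trans (IH _)); rewrite /Q mulrA ler_wpM2r // -expRD ler_expR.
clear Q; case: D => [|D] /=; first by rewrite oppr0 addr0.
by rewrite -natr1; lra.
Qed.

Definition harmonic_sum (j : nat) : R := \sum_(i < j) i.+1%:R^-1.

Lemma harmonic_sum_le j : (0 < j)%N -> harmonic_sum j <= 1 + ln j%:R.
Proof.
elim: j => [//|[|j] IH] _.
  by rewrite /harmonic_sum big_ord_recr big_ord0 /= add0r invr1 ln1 addr0.
rewrite /harmonic_sum big_ord_recr /=.
apply: le_trans (lerD (IH isT) (lexx _)) _.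
rewrite -addrA lerD2l -lerBrDl -ln_div ?posrE ?ltr0n //.
rewrite -ler_expR lnK ?posrE ?divr_gt0 ?ltr0n //.
rewrite -[leRHS]invrK -[leLHS]invrK lef_pV2 ?posrE ?invr_gt0 ?expR_gt0 ?divr_gt0 ?ltr0n //.
rewrite -expRN; apply: le_trans (expR_ge1Dx _).
rewrite invf_div -(natr1 j.+1); set t : R := j.+1%:R.
have t0 : 0 < t + 1 by rewrite ltr_wpDl.
by rewrite -(@ler_pM2r _ (t + 1)) // divfK ?gt_eqF // mulrDl mul1r mulNr mulVf ?gt_eqF // addrK.
Qed.

Lemma prod_harmonic (a : R) j : 0 <= a ->
  \prod_(i < j) (a + i.+1%:R) <= (j`!)%:R * expR (a * harmonic_sum j).
Proof.
move=> a0; elim: j => [|j IH].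
  by rewrite big_ord0 /harmonic_sum big_ord0 mulr0 expR0 mulr1.
have -> : a * harmonic_sum j.+1 = a * harmonic_sum j + a * j.+1%:R^-1.
  by rewrite /harmonic_sum big_ord_recr /= mulrDr.
rewrite big_ord_recr /= factS natrM expRD [X in _ <= X * _]mulrC mulrACA.
apply: ler_pM => //.
- by apply: prodr_ge0 => i _; rewrite addr_ge0.
- by rewrite addr_ge0.
rewrite -[X in X + _](@divfK _ j.+1%:R) ?pnatr_eq0 // -[X in _ + X]mul1r -mulrDl mulrC.
rewrite ler_wpM2l // addrC; exact: expR_ge1Dx.
Qed.

Lemma feasible_count_upper k j D : (0 < j)%N ->
  (feasible_count k 1 j D)%:R <=
  (j`!)%:R * expR (k%:R * expR 1 * (1 + ln j%:R) - D%:R) :> R.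
Proof.
move=> j0; apply: le_trans (feasible_count_chernoff _ _ _) _.
have a0 : 0 <= k%:R * expR 1 :> R by rewrite mulr_ge0 // expR_ge0.
rewrite expRB [leRHS]mulrA -expRN mulrC ler_wpM2r ?expR_ge0 //.
apply: le_trans (prod_harmonic j a0) _.
by rewrite ler_wpM2l // ler_expR ler_wpM2l // harmonic_sum_le.
Qed.

End UpperBound.

Section LowerBound.
Variable R : realType.
Variable k : nat.
Hypothesis k0 : (0 < k)%N.

(** The lower bound for the expected number of hidden sets of a walk with p
    points. *)
Definition rate (p D : nat) : R :=
  (feasible_count k k (p - k) D)%:R / ((p.-1)`!)%:R.

Lemma rate_ge0 p D : 0 <= rate p D.
Proof. by rewrite /rate divr_ge0. Qed.

Lemma rate_step p D : (k <= p)%N ->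
  rate p.+1 D = rate p D + k%:R / p%:R * rate p D.-1.
Proof.
move=> kp; rewrite /rate subSn //= subnKC // natrD !natrM.
case: p kp => [|p] kp /=; first by lia.
rewrite factS natrM; field.
by rewrite addrC natr1 !pnatr_eq0 -lt0n fact_gt0.
Qed.

Lemma rate_mono p p' D : (k <= p <= p')%N -> rate p D <= rate p' D.
Proof.
move=> /andP[kp pp']; rewrite -(subnKC pp').
elim: (p' - p)%N => [|i IH]; first by rewrite addn0.
rewrite addnS rate_step; last by lia.
apply: (le_trans IH); rewrite lerDl mulr_ge0 ?rate_ge0 // divr_ge0 //.
Qed.

(** Between the times p and p + i each step adds at least k / (p + i) times
    the rate of the previous degree. *)
Lemma rate_jump p i D : (k <= p)%N -> rate p D +
  k%:R * i%:R / (p + i)%:R * rate p D.-1 <= rate (p + i) D.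
Proof.
move=> kp; pose c : R := k%:R / (p + i)%:R.
suff H l : (l <= i)%N -> rate p D + l%:R * c * rate p D.-1 <= rate (p + l) D.
  apply: le_trans (H i (leqnn _)).
  by rewrite /c [i%:R * _]mulrA [i%:R * k%:R]mulrC.
elim: l => [|l IH] li; first by rewrite addn0 !mul0r addr0.
rewrite addnS rate_step; last by lia.
rewrite -natr1 mulrDl mul1r mulrDl addrA lerD ?IH //; first by exact: ltnW.
apply: ler_pM; rewrite ?rate_ge0 ?divr_ge0 //.
  rewrite /c ler_wpM2l // lef_pV2 ?posrE ?ltr0n ?ler_nat; lia.
by apply: rate_mono; lia.
Qed.

Variable N : nat.
Hypothesis N0 : (0 < N)%N.

(** Times growing by a factor of about 1 + 1 / N; they start so late that the
    rounding error in p %/ N is of smaller order. *)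
Definition block (b : nat) : nat := iter b (fun p => p + p %/ N)%N (k * N ^ 2)%N.

(** A lower bound for the sum of k / p over one block, close to k / N. *)
Definition gain : R := k%:R / N%:R * ((1 - N%:R^-1) / (1 + N%:R^-1)).

Lemma block_ge b : (k * N ^ 2 <= block b)%N.
Proof. by elim: b => [//|b IH]; rewrite /block iterS; apply: leq_trans IH (leq_addr _ _). Qed.

Lemma block_gek b : (k <= block b)%N.
Proof. by apply: leq_trans (block_ge b); rewrite leq_pmulr // expn_gt0 N0. Qed.

Lemma block_le b : (block b)%:R <= (k * N ^ 2)%:R * expR (b%:R / N%:R) :> R.
Proof.
elim: b => [|b IH]; first by rewrite mul0r expR0 mulr1.
rewrite /block iterS -/(block b) natrD -natr1 mulrDl expRD mulrA mul1r.
have : (block b %/ N)%:R <= (block b)%:R / N%:R :> R.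
  by rewrite ler_pdivlMr ?ltr0n // -natrM ler_nat leq_trunc_div.
move=> h; apply: (@le_trans _ _ ((block b)%:R * (1 + N%:R^-1))).
  by rewrite mulrDr mulr1 lerD2l.
apply: ler_pM => //.
exact: expR_ge1Dx.
Qed.

Lemma rate_block b D : rate (block b) D + gain * rate (block b) D.-1 <= rate (block b.+1) D.
Proof.
rewrite {3}/block iterS -/(block b); apply: le_trans (rate_jump _ _ (block_gek b)).
rewrite lerD2l ler_wpM2r ?rate_ge0 // /gain -!mulrA ler_wpM2l //.
set B := block b; set i := (B %/ N)%N; set u : R := N%:R^-1.
have N0' : 0 < N%:R :> R by rewrite ltr0n.
have u0 : 0 < u by rewrite invr_gt0.
have u1 : u <= 1 by rewrite invf_le1 // ler1n.
have BN : 1 <= u ^+ 2 * B%:R.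
  rewrite exprVn ler_pdivlMl ?exprn_gt0 // mulr1 -natrX ler_nat.
  by apply: leq_trans (block_ge b); exact: leq_pmull.
have B0 : 0 < B%:R :> R by rewrite ltr0n; apply: leq_trans k0 (block_gek b).
have i1 : u * B%:R < i%:R + 1.
  by rewrite ltr_pdivrMl // mulrC natr1 -natrM ltr_nat ltn_ceil.
have i2 : i%:R <= u * B%:R.
  by rewrite ler_pdivlMl // mulrC -natrM ler_nat leq_trunc_div.
have Bi : 0 < B%:R + i%:R :> R by rewrite ltr_pwDl.
rewrite natrD ler_pdivlMr //.
rewrite (_ : u * _ * _ = u * (1 - u) * (B%:R + i%:R) / (1 + u)); last by ring.
rewrite ler_pdivrMr ?addr_gt0 //.
apply: (@le_trans _ _ ((1 - u) * u * ((1 + u) * B%:R))).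
  rewrite [u * _]mulrC ler_wpM2l ?mulr_ge0 ?subr_ge0 ?(ltW u0) //.
  by rewrite mulrDl mul1r lerD2l.
rewrite mulrCA mulrC ler_wpM2r ?addr_ge0 ?(ltW u0) //.
rewrite expr2 in BN; rewrite mulrBl mul1r mulrBl; lra.
Qed.

Lemma gain_ge0 : 0 <= gain.
Proof.
have u1 : N%:R^-1 <= 1 :> R by rewrite invf_le1 ?ltr0n // ler1n.
apply: mulr_ge0; first exact: divr_ge0.
by rewrite divr_ge0 // ?subr_ge0 // addr_ge0 // invr_ge0.
Qed.

(** Choosing at most one factor of degree one from each block: Pascal's rule.
    *)
Lemma rate_blocks b s :
  'C(b, s)%:R * gain ^+ s / ((k.-1)`!)%:R <= rate (block b) (k.-1 + s).
Proof.
elim: b s => [|b IH] [|s]; rewrite ?bin0 ?bin0n ?mul0r ?rate_ge0 // ?addn0.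
- rewrite mul1r expr0 mul1r; apply: (@le_trans _ _ (rate k k.-1)).
    by rewrite /rate subnn /= ltn_predL k0 mul1r.
  by apply: rate_mono; rewrite leqnn block_gek.
- rewrite mul1r expr0 mul1r; apply: (@le_trans _ _ (rate k k.-1)).
    by rewrite /rate subnn /= ltn_predL k0 mul1r.
  by apply: rate_mono; rewrite leqnn block_gek.
apply: le_trans (rate_block _ _); rewrite addnS /=.
rewrite binS natrD !mulrDl; apply: lerD; first by rewrite -addnS IH.
rewrite exprS mulrCA -mulrA ler_wpM2l ?gain_ge0 // IH //.
Qed.

(** Stirling's bound up to a factor of order sqrt s, which is harmless against
    exponential growth. *)
Lemma fact_le s : (s.+1`!)%:R <= expR 1 * s.+1%:R * (s.+1%:R / expR 1) ^+ s.+1 :> R.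
Proof.
have e0 := expR_gt0 (1 : R).
elim: s => [|s IH].
  by rewrite expr1 mulr1 mulrC divfK ?gt_eqF // mul1r.
set t : R := s.+1%:R in IH *.
have t0 : 0 < t by rewrite ltr0n.
have t1 : 0 < t + 1 by rewrite addr_gt0.
rewrite -[s.+2%:R]natr1 -/t.
have H : (t / (t + 1)) ^+ s.+2 <= (expR 1)^-1.
  have -> : (expR 1)^-1 = expR (- (t + 1)^-1) ^+ s.+2 :> R.
    rewrite -expRM_natl -expRN; congr expR.
    by rewrite -natr1 -/t mulrN divff // gt_eqF // addr_gt0.
  rewrite lerXn2r ?nnegrE ?expR_ge0 ?divr_ge0 ?addr_ge0 ?(ltW t0) //.
  apply: le_trans (expR_ge1Dx _).
  rewrite -{1}[t](addrK 1) mulrBl divff ?mul1r // gt_eqF // addr_gt0 //.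
have K : expR 1 * (t / expR 1) ^+ s.+2 <= ((t + 1) / expR 1) ^+ s.+2.
  have -> : t / expR 1 = t / (t + 1) * ((t + 1) / expR 1).
    by rewrite mulrA divfK // gt_eqF.
  rewrite exprMn mulrA -[leRHS]mul1r ler_wpM2r //.
    by rewrite exprn_ge0 // divr_ge0 // ltW.
  by rewrite mulrC -ler_pdivlMr // mul1r.
rewrite factS natrM -(natr1 s.+1) -/t.
apply: (@le_trans _ _ (expR 1 * (t + 1) * (expR 1 * (t / expR 1) ^+ s.+2))); last first.
  by rewrite ler_wpM2l // mulr_ge0 // ltW.
rewrite [expR 1 * (t + 1)]mulrC -mulrA ler_wpM2l ?(ltW t1) //.
apply: (le_trans IH); rewrite [in leRHS]exprS le_eqVlt; apply/orP; left.
by apply/eqP; field; rewrite gt_eqF.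
Qed.
End LowerBound.

(** * Divergence of the lower bound *)

Section RateDivergence.
Variable R : realType.

Lemma ffact_ge b s : ((b - s) ^ s <= b ^_ s)%N.
Proof.
elim: s b => [//|s IH] b; rewrite expnS ffactnS.
case: b => [|b]; first by rewrite sub0n.
apply: leq_mul; first exact: leq_subr.
by rewrite subSS; exact: IH.
Qed.

(** The quadratic term is needed to beat the linear loss in [fact_le]. *)
Lemma expr_ge_quadratic (g : R) n : 0 <= g ->
  1 + n%:R * g + n%:R * (n%:R - 1) / 2 * g ^+ 2 <= (1 + g) ^+ n.
Proof.
move=> g0; elim: n => [|n IH]; first by rewrite expr0 !mul0r !addr0.
rewrite [in leRHS]exprS; apply: (@le_trans _ _ ((1 + g) *
   (1 + n%:R * g + n%:R * (n%:R - 1) / 2 * g ^+ 2))); last first.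
  by rewrite ler_wpM2l // addr_ge0.
rewrite -subr_ge0 -natr1; set t : R := n%:R.
rewrite (_ : _ - _ = t * (t - 1) / 2 * g ^+ 3); last by field.
rewrite mulr_ge0 ?exprn_ge0 // divr_ge0 //.
have [n00|n1] := posnP n; first by rewrite /t n00 mul0r.
by rewrite mulr_ge0 // subr_ge0 /t ler1n.
Qed.

(** 'C(b, s) gain ^ s is at least ((b - s) gain) ^ s / s!, hence at least ((b
    - s) gain e / s) ^ s / (e s) by [fact_le]. *)
Lemma rate_blocks_ge k N b s (g : R) : (0 < k)%N -> (0 < N)%N -> 0 <= g ->
  (1 + g) * s.+1%:R <= (b%:R - s.+1%:R) * (gain R k N * expR 1) ->
  (s.+1 <= b)%N ->
  s%:R * g ^+ 2 / (2 * expR 1 * ((k.-1)`!)%:R) <= rate R k (block k N b) (k.-1 + s.+1).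
Proof.
move=> k0 N0 g0 H sb; apply: le_trans (rate_blocks R k0 N0 b s.+1).
have e0 := expR_gt0 (1 : R); have gn := gain_ge0 R k N0.
have f0 : 0 < ((k.-1)`!)%:R :> R by rewrite ltr0n fact_gt0.
have F0 : 0 < ((s.+1)`!)%:R :> R by rewrite ltr0n fact_gt0.
rewrite invfM mulrA ler_wpM2r ?invr_ge0 ?(ltW f0) //.
have C : ((b%:R - s.+1%:R) * gain R k N) ^+ s.+1 / ((s.+1)`!)%:R <=
    'C(b, s.+1)%:R * gain R k N ^+ s.+1.
  rewrite ler_pdivrMr // mulrAC -natrM bin_ffact exprMn.
  rewrite ler_wpM2r ?exprn_ge0 // -natrB // -natrX ler_nat; exact: ffact_ge.
apply: le_trans C; rewrite ler_pdivlMr //.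
have s0 : 0 < s.+1%:R :> R by rewrite ltr0n.
have A0 : 0 <= s%:R * g ^+ 2 / (2 * expR 1).
  by rewrite divr_ge0 ?mulr_ge0 ?exprn_ge0 // ltW.
apply: (le_trans (ler_wpM2l A0 (fact_le R s))).
have -> : (b%:R - s.+1%:R) * gain R k N =
    ((b%:R - s.+1%:R) * (gain R k N * expR 1) / s.+1%:R) * (s.+1%:R / expR 1).
  by field; rewrite !gt_eqF // ltr_wpDr.
rewrite [in leRHS]exprMn mulrA ler_wpM2r ?exprn_ge0 ?divr_ge0 ?(ltW e0) //.
apply: (@le_trans _ _ ((1 + g) ^+ s.+1)); last first.
  rewrite lerXn2r ?nnegrE ?addr_ge0 // ?ler_pdivlMr //.
  rewrite mul0r; apply: mulr_ge0; first by rewrite subr_ge0 ler_nat.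
  by apply: mulr_ge0 => //; exact: ltW.
apply: le_trans (expr_ge_quadratic _ g0); rewrite -(natr1 s); set t : R := s%:R.
have t0 : 0 <= t by rewrite /t.
rewrite (_ : t * g ^+ 2 / (2 * expR 1) * (expR 1 * (t + 1)) =
  t * (t + 1) / 2 * g ^+ 2); last by field; rewrite gt_eqF.
rewrite addrK [(t + 1) * t]mulrC lerDr addr_ge0 // mulr_ge0 // addr_ge0 //.
Qed.

Lemma nat_above (x : R) : exists n : nat, x <= n%:R.
Proof.
exists (Num.bound `|x|); apply: le_trans (ler_norm x) _.
exact/ltW/archi_boundP/normr_ge0.
Qed.

(** With b the number of blocks up to time n, b / N is about ln n, which is at
    least d / (k (e - eps)). Hence (b - s) gain e / d is about e / (e - eps) >
    1 once N is large, and [rate_blocks_ge] applies with s close to d. *)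
Lemma rate_divergence k (eps A : R) : (0 < k)%N -> 0 < eps < expR 1 ->
  exists d0 : nat, forall d n, (d0 <= d)%N ->
    expR (d%:R / (k%:R * (expR 1 - eps))) <= n%:R -> A <= rate R k n d.+1.
Proof.
move=> k0.
have index_arith d D1 D2 (s := (d.+1 - k)%N) : (k + D1 + D2 + k <= d)%N ->
    [/\ (D1 <= d)%N, d.+1 = (k.-1 + s.+1)%N, (s.+1 <= d.+1)%N & (D2 <= s)%N].
  by rewrite /s; split; lia.
move=> /andP[eps0 epse]; set e := expR 1 in epse *; set e' := e - eps.
have e0 : 0 < e by exact: expR_gt0.
have e'0 : 0 < e' by rewrite subr_gt0.
pose rho := e / e'.
have rho1 : 1 < rho by rewrite /rho ltr_pdivlMr // mul1r /e' gtrBl.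
have kR : 0 < k%:R :> R by rewrite ltr0n.
pose X := (2 * rho + e * k%:R) / ((rho - 1) / 2).
have ek : 0 < e * k%:R by rewrite mulr_gt0.
have [N0' XN0'] := nat_above X; set N := N0'.+2.
have XN : X <= N%:R.
  by apply: le_trans XN0' _; rewrite ler_nat; exact: leq_trans (leqnSn _) (leqnSn _).
have N2 : (2 <= N)%N by [].
clearbody N; clear N0' XN0'.
have N0 : (0 < N)%N by exact: leq_trans N2.
have NR : 0 < N%:R :> R by rewrite ltr0n.
pose u : R := N%:R^-1.
have u0 : 0 < u by rewrite invr_gt0.
have u2 : u <= 2^-1 by rewrite lef_pV2 ?posrE // ler_nat.
have uX : (2 * rho + e * k%:R) * u <= (rho - 1) / 2.
  have r0 : 0 < (rho - 1) / 2 by lra.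
  by rewrite /u ler_pdivrMr // [leRHS]mulrC -ler_pdivrMr.
(* rho loses at most a half of rho - 1 through the finite size of N. *)
pose g := (rho - 1) / 4.
have g0 : 0 < g by rewrite /g; lra.
pose G := gain R k N * e.
have G0 : 0 <= G by rewrite mulr_ge0 ?gain_ge0 // ltW.
have key : 1 + 2 * g <= G * (N%:R / (k%:R * e') - 1).
  have -> : G * (N%:R / (k%:R * e') - 1) = (1 - u) / (1 + u) * (rho - e * k%:R * u).
    rewrite /G /gain -/u /rho /u; field.
    rewrite !gt_eqF //= ?addr_gt0 //.
  have pos : 0 <= rho - e * k%:R * u by nra.
  apply: (@le_trans _ _ ((1 - 2 * u) * (rho - e * k%:R * u))); last first.
    rewrite ler_wpM2r // ler_pdivlMr ?addr_gt0 //; nra.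
  have : 0 <= u * (e * k%:R * u) by rewrite !mulr_ge0 // ltW.
  rewrite /g; nra.
pose C0 := ln (k * N ^ 2)%:R : R.
pose K := G * (N%:R * C0 + 2).
pose B := 2 * expR 1 * ((k.-1)`!)%:R : R.
have B0 : 0 < B by rewrite /B !mulr_gt0 ?expR_gt0 // ltr0n fact_gt0.
have kN0 : 0 < (k * N ^ 2)%:R :> R by rewrite ltr0n muln_gt0 k0 expn_gt0 N0.
have [D1 D1P] := nat_above ((1 + g + `|K|) / g).
have [D2 D2P] := nat_above (`|A| * B / g ^+ 2).
exists (k + D1 + D2 + k)%N => d n dD en.
have [D1d ds sd1 D2s] := index_arith _ _ _ dD; set s := (d.+1 - k)%N in ds sd1 D2s.
clearbody s.
have n0 : 0 < n%:R :> R by apply: lt_le_trans en; exact: expR_gt0.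
have lnn : d%:R / (k%:R * e') <= ln n%:R.
  by rewrite -ler_expR lnK ?posrE.
have dR : (1 + g + `|K|) <= g * d%:R.
  rewrite mulrC -ler_pdivrMr //; apply: (le_trans D1P).
  by rewrite ler_nat.
have KK : K <= `|K| by exact: ler_norm.
(* The time of the b-th block is at most kN^2 e^(b/N), so b <= Y is allowed. *)
pose Y := N%:R * (ln n%:R - C0).
have YG : (1 + g) * (d%:R + 1) <= (Y - 1 - (d%:R + 1)) * G.
  have h1 : N%:R * (d%:R / (k%:R * e')) <= N%:R * ln n%:R by rewrite ler_wpM2l // ltW.
  have h2 : (d%:R * (N%:R / (k%:R * e') - 1) - (N%:R * C0 + 2)) * G <=
      (Y - 1 - (d%:R + 1)) * G.
    rewrite ler_wpM2r // /Y.
    have -> : d%:R * (N%:R / (k%:R * e') - 1) = N%:R * (d%:R / (k%:R * e')) - d%:R by ring.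
    lra.
  apply: le_trans h2; rewrite mulrBl [X in _ <= _ - X]mulrC -/K.
  have h3 : d%:R * (1 + 2 * g) <= d%:R * (G * (N%:R / (k%:R * e') - 1)).
    by rewrite ler_wpM2l.
  have -> : d%:R * (N%:R / (k%:R * e') - 1) * G =
    d%:R * (G * (N%:R / (k%:R * e') - 1)) by ring.
  move: (_ * (G * _)) h3 => Z; move: dR KK; clear; lra.
have Y0 : 0 <= Y.
  have : 0 < (Y - 1 - (d%:R + 1)) * G.
    by apply: lt_le_trans YG; apply: mulr_gt0; [rewrite addr_gt0|rewrite ltr_wpDl].
  have [GG|] := ltP 0 G; last by move=> h; rewrite (le_anti (introT andP (conj h G0))) mulr0 ltxx.
  rewrite pmulr_lgt0 // => h; have : 0 <= d%:R :> R by []. lra.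
pose b := Num.truncn Y.
have /andP[b1 b2] : b%:R <= Y < b.+1%:R by rewrite truncn_itv.
have sd : s.+1%:R <= d%:R + 1 :> R by rewrite natr1 ler_nat.
have YG2 : (1 + g) * s.+1%:R <= (b%:R - s.+1%:R) * G.
  rewrite -natr1 in b2.
  apply: (@le_trans _ _ ((1 + g) * (d%:R + 1))).
    by rewrite ler_wpM2l // addr_ge0 // ltW.
  apply: (le_trans YG); rewrite ler_wpM2r //; lra.
have sb : (s.+1 <= b)%N.
  have : 0 < (b%:R - s.+1%:R) * G.
    by apply: lt_le_trans YG2; rewrite mulr_gt0 // addr_gt0.
  have [GG|] := ltP 0 G; last by move=> h; rewrite (le_anti (introT andP (conj h G0))) mulr0 ltxx.
  by rewrite pmulr_lgt0 // subr_gt0 ltr_nat => /ltnW.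
have bn : (block k N b <= n)%N.
  rewrite -(ler_nat R); apply: le_trans (block_le R k N0 b) _.
  rewrite -[X in X * _](@lnK _ (k * N ^ 2)%:R) ?posrE // -expRD -[leRHS](@lnK _ n%:R) ?posrE //.
  rewrite ler_expR -lerBrDl ler_pdivrMr // mulrC; exact: b1.
apply: (@le_trans _ _ (rate R k (block k N b) d.+1)); last first.
  by apply: rate_mono => //; rewrite block_gek.
rewrite ds; apply: le_trans (rate_blocks_ge k0 N0 (ltW g0) YG2 sb).
apply: le_trans (ler_norm _) _; rewrite ler_pdivlMr // -ler_pdivrMr ?exprn_gt0 //.
apply: (le_trans D2P); by rewrite ler_nat.
Qed.

End RateDivergence.

(** * The two regimes *)

Section DefectBounds.
Context (R : realType) (k n d : nat) (dsp : measure_display) (T : measurableType dsp).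
Context (P : probability T R) (xi : {RV P >-> borel_mx R n.-1 d}).
Hypothesis kd : (0 < k <= d)%N.
Hypothesis dn : (d < n)%N.
Hypothesis exch : exchangeable xi.
Hypothesis gp : general_position xi.

Let defect : R := 'C(n, k)%:R - fine ('E_P[face_count xi k.-1])%E.

Lemma defect_eq : defect = expected_hidden xi k.
Proof.
have dm : (d <= n.-1)%N by lia.
rewrite /defect -(defect_expected_hidden exch gp dm kd) prednK //; lia.
Qed.

Lemma missing_le_defect :
  0 <= 1 - fine (P [set w | face_count xi k.-1 w = 'C(n, k)%:R]) <= defect.
Proof.
have dm : (d <= n.-1)%N by lia.
have := missing_probability exch gp dm kd.
rewrite prednK; last by lia.
by rewrite -defect_eq.
Qed.

Lemma defect_upper :
  defect <= 2 * expR (k%:R * expR 1 * (1 + ln n%:R) - d%:R).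
Proof.
have dm : (d <= n.-1)%N by lia.
have m0 : (0 < n.-1)%N by lia.
have /andP[_] := expected_hidden_bounds exch gp dm kd.
rewrite -defect_eq mulrC -ler_pdivlMr ?ltr0n ?fact_gt0 // => /le_trans; apply.
rewrite ler_pdivrMr ?ltr0n ?fact_gt0 // natrM -[leRHS]mulrA ler_wpM2l // [leRHS]mulrC.
apply: le_trans (feasible_count_upper R k d.+1 m0) _.
rewrite ler_wpM2l // ler_expR; apply: lerB.
  rewrite ler_wpM2l ?mulr_ge0 ?expR_ge0 // lerD2l ler_ln ?posrE ?ltr0n ?ler_nat //; lia.
by rewrite ler_nat.
Qed.

Lemma defect_lower : rate R k n d.+1 <= defect.
Proof.
have dm : (d <= n.-1)%N by lia.
have /andP[h _] := expected_hidden_bounds exch gp dm kd.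
rewrite defect_eq /rate ler_pdivrMr ?ltr0n ?fact_gt0 // mulrC.
by move: h; rewrite prednK //; lia.
Qed.

(** Since k (e + eps) ln n <= d, the exponent k e ln n - d of [defect_upper]
    is at most - k eps ln n. *)
Lemma defect_power (eps : R) : 0 < eps ->
  n%:R <= expR (d%:R / (k%:R * (expR 1 + eps))) ->
  defect <= 2 * expR (k%:R * expR 1) * n%:R `^ (- (k%:R * eps)).
Proof.
move=> eps0 nd; apply: (le_trans defect_upper).
have n0 : 0 < n%:R :> R by rewrite ltr0n; lia.
have k0 : 0 < k%:R :> R by rewrite ltr0n; case/andP: kd.
have e0 := expR_gt0 (1 : R).
rewrite -[X in X `^ _](@lnK _ n%:R) ?posrE // -expRM -[leRHS]mulrA -expRD.
rewrite ler_wpM2l // ler_expR.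
have : ln n%:R <= d%:R / (k%:R * (expR 1 + eps)).
  by rewrite -ler_expR lnK ?posrE.
rewrite ler_pdivlMr ?mulr_gt0 ?addr_gt0 //.
lra.
Qed.

End DefectBounds.

Theorem theorem6p3 (R : realType) (k : nat) (n : nat -> nat)
    (dsp : nat -> measure_display)
    (T : forall d : nat, measurableType (dsp d))
    (P : forall d : nat, probability (T d) R)
    (xi : forall d : nat, {RV (P d) >-> borel_mx R (n d).-1 d})
    (k_gt0 : (0 < k)%N)
    (n_gt : forall d : nat, (0 < d)%N -> (d < n d)%N)
    (xi_exch : forall d : nat, (0 < d)%N -> exchangeable (xi d))
    (xi_gp : forall d : nat, (0 < d)%N -> general_position (xi d)) :
  ((exists eps : R, 0 < eps /\
      \forall d \near \oo,
        (n d)%:R <= expR (d%:R / (k%:R * (expR 1 + eps)))) ->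
   exists eta : R, 0 < eta /\
     ((fun d : nat => ('C(n d, k)%:R
         - fine ('E_(P d)[face_count (xi d) k.-1])%E : R^o))
       =O_\oo (fun d : nat => ((n d)%:R `^ (- eta) : R^o))) /\
     ((fun d : nat => (1
         - fine (P d [set w | face_count (xi d) k.-1 w = 'C(n d, k)%:R])
         : R^o))
       =O_\oo (fun d : nat => ((n d)%:R `^ (- eta) : R^o)))) /\
  ((exists eps : R, 0 < eps < expR 1 /\
      \forall d \near \oo,
        expR (d%:R / (k%:R * (expR 1 - eps))) <= (n d)%:R) ->
   (fun d : nat => 'C(n d, k)%:R
         - fine ('E_(P d)[face_count (xi d) k.-1])%E : R)
     @ \oo --> +oo).
Proof.
have large d : (k <= d)%N -> [/\ (0 < k <= d)%N, (d < n d)%N,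
    exchangeable (xi d) & general_position (xi d)].
  move=> kd; have d0 : (0 < d)%N by exact: leq_trans kd.
  by split; [rewrite k_gt0|exact: n_gt|exact: xi_exch|exact: xi_gp].
split.
  move=> [eps [eps0 nd]]; exists (k%:R * eps); split.
    by rewrite mulr_gt0 // ltr0n.
  have C0 : 0 < 2 * expR (k%:R * expR 1) :> R by rewrite mulr_gt0 // expR_gt0.
  have bound : \forall d \near \oo,
    0 <= 1 - fine (P d [set w | face_count (xi d) k.-1 w = 'C(n d, k)%:R])
      <= 'C(n d, k)%:R - fine ('E_(P d)[face_count (xi d) k.-1])%E
    /\ 'C(n d, k)%:R - fine ('E_(P d)[face_count (xi d) k.-1])%E <=
      2 * expR (k%:R * expR 1) * (n d)%:R `^ (- (k%:R * eps)).
    apply: filterS2 (nbhs_infty_ge k) nd => d /large[kd dn ex gp] ndd.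
    by split; [exact: missing_le_defect|exact: defect_power].
  split; apply/eqO_exP; exists (2 * expR (k%:R * expR 1)) => //;
    apply: filterS bound => d [/andP[h0 h1] h2].
    by rewrite /= ger0_norm ?(le_trans h0 h1) // ger0_norm ?powR_ge0.
  by rewrite /= ger0_norm // ger0_norm ?powR_ge0 // (le_trans h1 h2).
move=> [eps [epse nd]]; apply/cvgryPge => A.
have [d0 d0P] := rate_divergence A k_gt0 epse.
apply: filterS3 (nbhs_infty_ge k) (nbhs_infty_ge d0) nd => d /large[kd dn ex gp] d0d ndd.
exact: le_trans (d0P _ _ d0d ndd) (defect_lower kd dn ex gp).
Qed.
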